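(* Let $f$ be a transcendental entire function. Then either the escaping set $I(f)$ is connected or it has infinitely many unbounded components.
   Context: For a transcendental entire function $f$, $f^n$ denotes the $n$th iterate, and the escaping set is $I(f)=\{z\in\mathbb{C}: f^n(z)\to\infty \text{ as } n\to\infty\}$. *)

(* Defs.v *)
From HB Require Import structures.
From mathcomp Require Import all_boot all_order all_algebra.
From mathcomp Require Import all_classical all_reals all_analysis.
From mathcomp Require Import complex.
Set Implicit Arguments. Unset Strict Implicit. Unset Printing Implicit Defensive.
Import Order.TTheory GRing.Theory Num.Theory.
Import numFieldNormedType.Exports.
Local Open Scope classical_set_scope.
Local Open Scope ring_scope.
Local Open Scope complex_scope.

HB.instance Definition _ (R : realType) := GRing.ComAlgebra.copy R[i] R[i]^o.
HB.instance Definition _ (R : realType) := Vector.copy R[i] R[i]^o.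
HB.instance Definition _ (R : realType) := NormedModule.copy R[i] R[i]^o.

(* f is entire: complex-differentiable at every point of C
   (R[i] is a normed module over itself, so derivable is C-differentiability). *)
Definition entire (R : realType) (f : R[i] -> R[i]) : Prop :=
  forall z : R[i], derivable f z 1.

Definition polynomial_fun (R : realType) (f : R[i] -> R[i]) : Prop :=
  exists p : {poly R[i]}, forall z, f z = p.[z].

Definition transcendental_entire (R : realType) (f : R[i] -> R[i]) : Prop :=
  entire f /\ ~ polynomial_fun f.

Definition escaping_set (R : realType) (f : R[i] -> R[i]) : set R[i] :=
  [set z | forall M : R, \forall n \near \oo, M%:C < `|iter n f z| ].

Definition unbounded_components (R : realType) (A : set R[i]) : set (set R[i]) :=
  [set C | exists2 z, A z & C = connected_component A z /\ ~ bounded_set C].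

(* Main.v *)
(* Suppose that only finitely many components of the escaping set [E] are unbounded.  Call
   [z] fast when [|f^n z| >= s_n] for all [n], where [s_(n+1) = 2 max_(|w| <= s_n) |f w|].
   Fast points exist, and by the maximum principle every point with a fast iterate lies in
   an unbounded component; so, by the pigeonhole principle, some component [C1] contains a
   fast point [a] together with its iterate [f^q a].

   If no [f^(qn)], restricted to a disc [D], covers a circle around [p], then by a theorem of
   Landau type the values [|f^(qn) - p|] are comparable on a smaller disc, uniformly in [n].
   This cannot happen around every point of [C1], since [f^(qn) (f^q a)] outgrows
   [f^(qn) a]; hence every [p] has a point [c] of [C1] whose neighbourhoods are mapped over
   circles around [p].  Such circles meet every unbounded connected set through [p], and
   finiteness then forces into [C1] all unbounded connected subsets of [E] whose preimages
   lie in unbounded components.  Applied to sets of fast points, this shows with the same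
   dichotomy that a component [X] of [E] other than [C1] is open; applied to [X] itself, that
   [X] is bounded.  Its frontier does not escape, and the sets [f^n X] are pairwise disjoint.

   No such [X] exists.  Let [b] be a point of [X].  By compactness, finitely many of the sets
   [{|f^n - b| < q}] with [n >= N_q] cover the frontier of [X].  On each [f^n X], a cut-off of
   the disc of radius [q] around [b] is made superharmonic by adding logarithmic potentials
   spread over the grid squares inside [f^n X]; as these images are disjoint, the total mass is
   finite and suitable [N_q] make the sum of all the potentials smaller than [1] at [b].  That
   sum is at least [1] near the frontier, which contradicts the minimum principle. *)
Require Import Defs.
From HB Require Import structures.
From mathcomp Require Import all_boot all_order all_algebra.
From mathcomp Require Import all_classical all_reals all_analysis.
From mathcomp Require Import complex.
From mathcomp Require Import ring lra zify.
Set Implicit Arguments. Unset Strict Implicit. Unset Printing Implicit Defensive.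
Import Order.TTheory GRing.Theory Num.Theory.
Import numFieldNormedType.Exports.
Local Open Scope classical_set_scope.
Local Open Scope ring_scope.

(** * Modulus, discs and compactness *)

Section Basics.
Import complex.
Variable R : realType.
Local Notation C := R[i].
Implicit Types (z w : C) (x e : R).

(** The escaping set is neither open nor closed, so its components cannot be handled by the maximum
    principle directly. Sets of fast points are closed, and that is where unbounded components come
    from. No limit function is ever extracted: the Landau type theorem compares |g - p| at two
    points with one constant for all [g]. Covered circles are the right alternative, because an
    unbounded connected set through [p] has to cross every circle around [p]. The images of X are
    disjoint because two of them that meet are the same bounded component; a fixed iterate would
    then map it to itself, and it would keep infinitely many points of an escaping orbit. In the
    final argument the potentials are pulled back to X by f^n. Hence each one needs to be
    superharmonic only on f^n X, not in the plane, and the mass this costs is bounded by the area of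
    f^n X inside a disc. *)

Definition cabs z : R := Num.sqrt (complex.Re z ^+ 2 + complex.Im z ^+ 2).

Definition rc (x : R) : C := real_complex R x.

Lemma norm_cabs z : `|z| = rc (cabs z).
Proof. exact: normc_def. Qed.

Lemma rc_inj : injective rc. Proof. exact: complexI. Qed.
Lemma rcM : {morph rc : x y / x * y}. Proof. exact: rmorphM. Qed.
Lemma rcD : {morph rc : x y / x + y}. Proof. exact: rmorphD. Qed.
Lemma rcB : {morph rc : x y / x - y}. Proof. exact: rmorphB. Qed.
Lemma rcX n : {morph rc : x / x ^+ n}. Proof. exact: rmorphXn. Qed.
Lemma rcV : {morph rc : x / x^-1}. Proof. exact: fmorphV. Qed.
Lemma rc0 : rc 0 = 0. Proof. by []. Qed.
Lemma rc1 : rc 1 = 1. Proof. by []. Qed.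
Lemma rc_nat n : rc n%:R = n%:R. Proof. exact: rmorph_nat. Qed.
Lemma rc_eq0 x : (rc x == 0) = (x == 0). Proof. exact: fmorph_eq0. Qed.
Lemma rc_ler x y : (rc x <= rc y) = (x <= y). Proof. exact: lecR. Qed.
Lemma rc_ltr x y : (rc x < rc y) = (x < y). Proof. exact: ltcR. Qed.

Lemma cReD z w : complex.Re (z + w) = complex.Re z + complex.Re w.
Proof. by case: z w => a b [c d]. Qed.
Lemma cImD z w : complex.Im (z + w) = complex.Im z + complex.Im w.
Proof. by case: z w => a b [c d]. Qed.
Lemma cReB z w : complex.Re (z - w) = complex.Re z - complex.Re w.
Proof. by case: z w => a b [c d]. Qed.
Lemma cImB z w : complex.Im (z - w) = complex.Im z - complex.Im w.
Proof. by case: z w => a b [c d]. Qed.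
Lemma cReM z w : complex.Re (z * w) = complex.Re z * complex.Re w - complex.Im z * complex.Im w.
Proof. by case: z w => a b [c d]. Qed.
Lemma cImM z w : complex.Im (z * w) = complex.Re z * complex.Im w + complex.Im z * complex.Re w.
Proof. by case: z w => a b [c d]. Qed.
Lemma complex_eq z w : complex.Re z = complex.Re w -> complex.Im z = complex.Im w -> z = w.
Proof. by case: z => a b; case: w => c d /= -> ->. Qed.

Lemma cabs_ge0 z : 0 <= cabs z. Proof. exact: sqrtr_ge0. Qed.

Lemma cabsM z w : cabs (z * w) = cabs z * cabs w.
Proof. by apply: rc_inj; rewrite rcM -!norm_cabs normrM. Qed.
Lemma cabsV z : cabs z^-1 = (cabs z)^-1.
Proof. by apply: rc_inj; rewrite rcV -!norm_cabs normfV. Qed.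
Lemma cabsN z : cabs (- z) = cabs z.
Proof. by apply: rc_inj; rewrite -!norm_cabs normrN. Qed.
Lemma cabsX z n : cabs (z ^+ n) = cabs z ^+ n.
Proof. by apply: rc_inj; rewrite rcX -!norm_cabs normrX. Qed.
Lemma cabs0 : cabs 0 = 0.
Proof. by apply: rc_inj; rewrite -!norm_cabs normr0. Qed.
Lemma cabs1 : cabs 1 = 1.
Proof. by apply: rc_inj; rewrite -!norm_cabs normr1. Qed.
Lemma cabs_eq0 z : (cabs z == 0) = (z == 0).
Proof. by rewrite -rc_eq0 -norm_cabs normr_eq0. Qed.
Lemma cabs_gt0 z : (0 < cabs z) = (z != 0).
Proof. by rewrite lt_def cabs_ge0 cabs_eq0 andbT. Qed.
Lemma cabsD z w : cabs (z + w) <= cabs z + cabs w.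
Proof. by rewrite -rc_ler rcD -!norm_cabs ler_normD. Qed.
Lemma cabsB z w : cabs (z - w) = cabs (w - z).
Proof. by rewrite -cabsN opprB. Qed.
Lemma cabsBD z w : cabs (z - w) <= cabs z + cabs w.
Proof. by rewrite -(cabsN w) cabsD. Qed.
Lemma cabs_subr z w : cabs z - cabs w <= cabs (z - w).
Proof. have := cabsD (z - w) w; rewrite subrK; lra. Qed.
Lemma cabs_tri w z u : cabs (z - u) <= cabs (z - w) + cabs (w - u).
Proof. by have := cabsD (z - w) (w - u); rewrite addrA subrK. Qed.
Lemma cabs_rc x : cabs (rc x) = `|x|.
Proof. by rewrite /cabs /= expr0n addr0 sqrtr_sqr. Qed.
Lemma cabs_nat n : cabs n%:R = n%:R.
Proof. by rewrite -rc_nat cabs_rc ger0_norm. Qed.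
Lemma cabs_i : cabs 'i%C = 1.
Proof. by rewrite /cabs /= expr0n expr1n add0r sqrtr1. Qed.
Lemma sqr_cabs z : cabs z ^+ 2 = complex.Re z ^+ 2 + complex.Im z ^+ 2.
Proof. by rewrite /cabs sqr_sqrtr // addr_ge0 // sqr_ge0. Qed.
Lemma Re_le_cabs z : `|complex.Re z| <= cabs z.
Proof.
rewrite -(@ler_pXn2r _ 2%N) ?nnegrE ?cabs_ge0 // sqr_cabs real_normK ?num_real //.
by rewrite lerDl sqr_ge0.
Qed.
Lemma Im_le_cabs z : `|complex.Im z| <= cabs z.
Proof.
rewrite -(@ler_pXn2r _ 2%N) ?nnegrE ?cabs_ge0 // sqr_cabs real_normK ?num_real //.
by rewrite lerDr sqr_ge0.
Qed.
Lemma cabs_le_ReIm z : cabs z <= `|complex.Re z| + `|complex.Im z|.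
Proof.
have {1}-> : z = rc (complex.Re z) + 'i%C * rc (complex.Im z) by exact: complexE.
by apply: le_trans (cabsD _ _) _; rewrite cabsM cabs_i mul1r !cabs_rc.
Qed.

Lemma complex_gt0P (e : C) : 0 < e -> exists2 x : R, 0 < x & e = rc x.
Proof.
move=> e0; exists (complex.Re e).
  by move: e0; rewrite ltcE /= => /andP[].
by case: e e0 => a b; rewrite ltcE /= => /andP[/eqP->].
Qed.

Lemma nbhsCP z (A : set C) :
  nbhs z A <-> exists2 e : R, 0 < e & forall w, cabs (w - z) < e -> A w.
Proof.
split.
  move/nbhs_ballP => [e /= e0 He]; have [x x0 ex] := complex_gt0P e0.
  exists x => // w wz; apply: He; rewrite -ball_normE /= ex norm_cabs rc_ltr.
  by rewrite cabsB.
move=> [e e0 He]; apply/nbhs_ballP; exists (rc e); first by rewrite /= -rc0 rc_ltr.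
by move=> w; rewrite -ball_normE /= norm_cabs rc_ltr cabsB => /He.
Qed.

Definition disc z e : set C := [set w | cabs (w - z) < e].
Definition cdisc z e : set C := [set w | cabs (w - z) <= e].

Lemma nbhs_disc z e : 0 < e -> nbhs z (disc z e).
Proof. by move=> e0; apply/nbhsCP; exists e. Qed.

Lemma openCP (A : set C) :
  open A <-> forall z, A z -> exists2 e : R, 0 < e & forall w, cabs (w - z) < e -> A w.
Proof.
rewrite openE; split => [H z /H /nbhsCP //|H z Az]; apply/nbhsCP; exact: H.
Qed.

Lemma closureCP (A : set C) z :
  closure A z <-> forall e, 0 < e -> exists2 w, A w & cabs (w - z) < e.
Proof.
split=> [H e e0|H B /nbhsCP[e e0 He]].
  by have [w [Aw wz]] := H _ (nbhs_disc z e0); exists w.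
by have [w Aw wz] := H _ e0; exists w; split => //; exact: He.
Qed.

(* Wrapping pointwise continuity in an inductive keeps unification from unfolding filters. *)
Variant cont_at (T U : topologicalType) (f : T -> U) (t : T) : Prop :=
  ContAt of {for t, continuous f}.

Lemma cont_atP (T U : topologicalType) (f : T -> U) t : cont_at f t <-> {for t, continuous f}.
Proof. by split=> [[]//|fc]; constructor; exact: fc. Qed.

Lemma continuous_CRP (f : C -> R) z : cont_at f z <->
  forall e, 0 < e -> exists2 d : R, 0 < d & forall w, cabs (w - z) < d -> `|f w - f z| < e.
Proof.
split=> [[H] e e0|H].
  have [d d0 Hd] := (nbhsCP z (f @^-1` ball (f z) e)).1 (H _ (nbhsx_ballx (f z) e e0)).
  by exists d => // w /Hd; rewrite /ball /= distrC.
constructor=> A /nbhs_ballP[e /= e0 He]; have [d d0 Hd] := H e e0.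
by apply/nbhsCP; exists d => // w wz; apply: He; rewrite /ball /= distrC; exact: Hd.
Qed.

Lemma cabs_continuous z : cont_at (@cabs : C -> R) z.
Proof.
apply/continuous_CRP => e e0; exists e => // w wz.
have := cabs_subr z w; have := cabs_subr w z; rewrite (cabsB z w).
by rewrite ltr_norml; lra.
Qed.

Lemma cRe_continuous z : cont_at (@complex.Re R : C -> R) z.
Proof.
apply/continuous_CRP => e e0; exists e => // w wz.
by rewrite -cReB; exact: le_lt_trans (Re_le_cabs _) _.
Qed.

Lemma cIm_continuous z : cont_at (@complex.Im R : C -> R) z.
Proof.
apply/continuous_CRP => e e0; exists e => // w wz.
by rewrite -cImB; exact: le_lt_trans (Im_le_cabs _) _.
Qed.

Lemma continuous_CP (f : C -> C) z : cont_at f z <->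
  forall e, 0 < e -> exists2 d : R, 0 < d & forall w, cabs (w - z) < d -> cabs (f w - f z) < e.
Proof.
split=> [[H] e e0|H].
  by have /nbhsCP := H _ (nbhs_disc (f z) e0).
constructor=> A /nbhsCP[e e0 He]; have [d d0 Hd] := H e e0.
by apply/nbhsCP; exists d => // w wz; apply: He; exact: Hd.
Qed.

Lemma continuous_RCP (f : R -> C) x : cont_at f x <->
  forall e, 0 < e -> exists2 d : R, 0 < d & forall y, `|y - x| < d -> cabs (f y - f x) < e.
Proof.
split=> [[H] e e0|H].
  have /nbhs_ballP[d d0 Hd] := H _ (nbhs_disc (f x) e0).
  by exists d => // y yx; apply: Hd; rewrite /ball /= distrC.
constructor=> A /nbhsCP[e e0 He]; have [d d0 Hd] := H e e0.
apply/nbhs_ballP; exists d => // y; rewrite /ball /= distrC => yx; apply: He; exact: Hd.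
Qed.

Lemma contD (T : topologicalType) (f g : T -> C) t : cont_at f t ->
  cont_at g t -> cont_at (fun u => f u + g u) t.
Proof. by move=> [fc] [gc]; constructor; apply: cvgD; [exact: fc|exact: gc]. Qed.

Lemma contN (T : topologicalType) (f : T -> C) t : cont_at f t -> cont_at (fun u => - f u) t.
Proof. by move=> [fc]; constructor; apply: cvgN; exact: fc. Qed.

Lemma contB (T : topologicalType) (f g : T -> C) t : cont_at f t ->
  cont_at g t -> cont_at (fun u => f u - g u) t.
Proof. by move=> fc gc; exact: contD fc (contN gc). Qed.

Lemma contM (T : topologicalType) (f g : T -> C) t : cont_at f t ->
  cont_at g t -> cont_at (fun u => f u * g u) t.
Proof. by move=> [fc] [gc]; constructor; apply: cvgM; [exact: fc|exact: gc]. Qed.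

Lemma contV (T : topologicalType) (f : T -> C) t : f t != 0 -> cont_at f t ->
  cont_at (fun u => (f u)^-1) t.
Proof. by move=> f0 [fc]; constructor; apply: cvgV; [exact: f0|exact: fc]. Qed.

Lemma cont_cst (T U : topologicalType) (c : U) (t : T) : cont_at (fun=> c) t.
Proof. by constructor; exact: cst_continuous. Qed.

Lemma cont_id (T : topologicalType) (t : T) : cont_at id t.
Proof. by constructor; exact: cvg_id. Qed.

Lemma contX (T : topologicalType) (f : T -> C) n t : cont_at f t -> cont_at (fun u => f u ^+ n) t.
Proof.
move=> fc; elim: n => [|n IH]; first exact: cont_cst.
have -> : (fun u => f u ^+ n.+1) = (fun u => f u * f u ^+ n) by apply/funext => u; rewrite exprS.
exact: contM fc IH.
Qed.

Lemma cont_comp (T U V : topologicalType) (f : T -> U) (g : U -> V) t : cont_at f t ->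
  cont_at g (f t) -> cont_at (fun u => g (f u)) t.
Proof. by move=> [fc] [gc]; constructor; exact: (continuous_comp fc gc). Qed.

Lemma rc_continuous x : cont_at (rc : R -> C) x.
Proof.
by apply/continuous_RCP => e e0; exists e => // y yx; rewrite -rcB cabs_rc.
Qed.

Lemma open_disc z e : open (disc z e).
Proof.
apply/openCP => w wz; exists (e - cabs (w - z)); first by rewrite subr_gt0.
move=> u uw; rewrite /disc /=; have := cabs_tri w u z; lra.
Qed.

Lemma closed_cdisc z e : closed (cdisc z e).
Proof.
move=> w /closureCP H; rewrite /cdisc /= leNgt; apply/negP => ew.
have [|u uz uw] := H (cabs (w - z) - e); first by rewrite subr_gt0.
by have := cabs_tri u w z; rewrite (cabsB w u); move: uz; rewrite /cdisc /=; lra.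
Qed.

Lemma compact_cdisc z e : compact (cdisc z e).
Proof.
pose g (p : R * R) : C := z + (rc p.1 + 'i%C * rc p.2).
have gc p : cont_at g p.
  have c1 : cont_at (fst : R * R -> R) p by constructor; case: (p) => a b; exact: cvg_fst.
  have c2 : cont_at (snd : R * R -> R) p by constructor; case: (p) => a b; exact: cvg_snd.
  apply: contD; first exact: cont_cst.
  apply: contD; first exact: (cont_comp c1 (@rc_continuous p.1)).
  exact: contM (cont_cst _ _) (cont_comp c2 (@rc_continuous p.2)).
have K : compact (g @` (`[-e, e] `*` `[-e, e])).
  apply: continuous_compact; first by apply: continuous_subspaceT => p; exact: (cont_atP g p).1 (gc p).
  by apply: compact_setX; exact: segment_compact.
apply: (subclosed_compact (@closed_cdisc z e) K) => w wz.
exists (complex.Re (w - z), complex.Im (w - z)).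
  have h1 := le_trans (Re_le_cabs (w - z)) wz.
  have h2 := le_trans (Im_le_cabs (w - z)) wz.
  by split; rewrite /= in_itv /= -ler_norml.
by rewrite /g /= -[rc _ + _]complexE addrC subrK.
Qed.

Lemma closed_bounded_compact (A : set C) z e : closed A -> A `<=` cdisc z e -> compact A.
Proof. by move=> cA; apply: (subclosed_compact cA (@compact_cdisc z e)). Qed.

Lemma compact_max (A : set C) (f : C -> R) : A !=set0 -> compact A ->
  (forall z, A z -> cont_at f z) -> exists2 c, A c & forall z, A z -> f z <= f c.
Proof.
move=> A0 cA fc.
have [|c /set_mem Ac cM] := @compact_EVT_max C R f A A0 cA.
  by apply: continuous_in_subspaceT => z /set_mem /fc[].
by exists c => // z /mem_set; exact: cM.
Qed.

Lemma compact_cabs_bounded (A : set C) : compact A -> exists M, forall z, A z -> cabs z <= M.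
Proof.
move=> cA; have [->|/set0P A0] := eqVneq A set0; first by exists 0.
have [z Az zM] := compact_max A0 cA (fun z _ => @cabs_continuous z).
by exists (cabs z).
Qed.

End Basics.

(** * Integrals *)

Section Integral.
Variable R : realType.
Local Notation C := R[i].
Implicit Types (z w : C) (x y e k : R) (f g : R -> R).

Lemma is_derive_eps (F : R -> R) x l :
  (forall e, 0 < e -> exists2 d : R, 0 < d &
     forall h, `|h| < d -> `|F (x + h) - F x - l * h| <= e * `|h|) ->
  is_derive (x : R^o) (1 : R^o) F l.
Proof.
move=> H.
have cv : h^-1 *: (F (h *: (1:R^o) + x) - F x) @[h --> (0 : R)^'] --> l.
  apply/cvgrPdist_le => e e0; have [d d0 Hd] := H e e0.
  rewrite near_withinE; apply/nbhs_ballP; exists d => // h.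
  rewrite /ball /= sub0r normrN => hd h0.
  have := Hd h hd.
  rewrite -[h *: 1]/(h * 1) mulr1 (addrC h) -[_ *: _]/(_ * _) => Hh.
  have h0' : 0 < `|h| by rewrite normr_gt0.
  rewrite distrC -(ler_pM2r h0') -normrM.
  by rewrite (_ : _ * h = F (x + h) - F x - l * h) //; field.
split; first by apply/cvg_ex; exists l.
exact: (cvg_lim (@Rhausdorff R) cv).
Qed.

Lemma is_derive_lim (F : R -> R) x l : is_derive (x : R^o) (1 : R^o) F l ->
  forall e, 0 < e -> exists2 d : R, 0 < d &
     forall h, `|h| < d -> `|F (x + h) - F x - l * h| <= e * `|h|.
Proof.
move=> [dF lE] e e0.
have : h^-1 *: (F (h *: (1:R^o) + x) - F x) @[h --> (0 : R)^'] --> l by rewrite -lE; exact: dF.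
move=> /cvgrPdist_le /(_ e e0); rewrite near_withinE => /nbhs_ballP[d /= d0 Hd].
exists d => // h hd; have [->|h0] := eqVneq h 0.
  by rewrite addr0 subrr mulr0 subr0 normr0 mulr0.
have := Hd h; rewrite /ball /= sub0r normrN => /(_ hd h0).
rewrite -[h *: 1]/(h * 1) mulr1 (addrC h) -[_ *: _]/(_ * _) => Hh.
have h0' : 0 < `|h| by rewrite normr_gt0.
rewrite -(ler_pM2r h0') -normrM mulrBl in Hh.
by move: Hh; rewrite mulrAC mulVf // mul1r distrC.
Qed.

Lemma is_derive_cont (F : R -> R) x l : is_derive (x : R^o) (1 : R^o) F l ->
  {for x, continuous F}.
Proof. by move=> [dF _]; apply/differentiable_continuous/derivable1_diffP. Qed.

(** Integration starts at -1 rather than at 0, so that the derivative at 0 is still two-sided. *)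
Lemma antiderivative (f : R -> R) : continuous f ->
  exists F : R -> R, forall x, -1 < x -> is_derive (x : R^o) (1 : R^o) F (f x).
Proof.
move=> fc; exists (fun x => \int[lebesgue_measure]_(t in `[(-1), x]) f t)%R => x x1.
have xu : x < x + 1 by lra.
have int : lebesgue_measure.-integrable `[(-1), x + 1] (EFin \o f).
  apply: continuous_compact_integrable; first exact: segment_compact.
  exact: continuous_subspaceT.
have [dF DF] := continuous_FTC1_closed xu int x1 (fc x).
by split; [exact: dF|rewrite -derive1E].
Qed.

Definition primitive01 (f F : R -> R) :=
  forall x, 0 <= x <= 1 -> is_derive (x : R^o) (1 : R^o) F (f x).

(** The integral over [0, 1] is the increment of an antiderivative picked by [xget], and 0 if there
    is none. The rules of integration then reduce to rules for derivatives. *)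
Definition rint (f : R -> R) : R :=
  let F := xget (fun=> 0) [set F | primitive01 f F] in F 1 - F 0.

Lemma primitive01_mvt (f F : R -> R) a b : 0 <= a <= 1 -> 0 <= b <= 1 -> a < b ->
  primitive01 f F -> exists2 c, a < c < b & F b - F a = f c * (b - a).
Proof.
move=> a01 b01 ab pF.
have [||c] := @MVT R F f a b ab.
- by move=> x; rewrite in_itv /= => /andP[xa xb]; apply: pF; lra.
- apply: continuous_in_subspaceT => x /set_mem /=; rewrite in_itv /= => /andP[xa xb].
  by apply: (@is_derive_cont F x (f x)); apply: pF; lra.
by rewrite in_itv /= => cab ->; exists c.
Qed.

Lemma rint_primitive f F : primitive01 f F -> rint f = F 1 - F 0.
Proof.
move=> pF; rewrite /rint; set G := xget _ _.
have pG : primitive01 f G by apply: (xgetPex (fun=> 0) (P := [set F | primitive01 f F])); exists F.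
have pD : primitive01 (fun=> 0) (F - G).
  by move=> x x01; rewrite -(subrr (f x)); apply: is_deriveB; [exact: pF|exact: pG].
have [|||c _] := @primitive01_mvt _ _ 0 1 _ _ _ pD; try lra.
by rewrite mul0r !fctE; lra.
Qed.

Lemma continuous_primitive01 f : continuous f -> exists F, primitive01 f F.
Proof.
by move=> /antiderivative[F HF]; exists F => x /andP[x0 _]; apply: HF; lra.
Qed.

Lemma rintD f g : continuous f -> continuous g ->
  rint (fun x => f x + g x) = rint f + rint g.
Proof.
move=> /continuous_primitive01[F pF] /continuous_primitive01[G pG].
rewrite (rint_primitive pF) (rint_primitive pG) (@rint_primitive _ (F + G)).
  by rewrite !fctE; lra.
by move=> x x01; apply: is_deriveD; [exact: pF|exact: pG].
Qed.

Lemma rintZ f k : continuous f -> rint (fun x => k * f x) = k * rint f.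
Proof.
move=> /continuous_primitive01[F pF].
rewrite (rint_primitive pF) (@rint_primitive _ (k *: F)).
  by rewrite -[(k *: F) 1]/(k * F 1) -[(k *: F) 0]/(k * F 0) mulrBr.
by move=> x x01; apply: is_deriveZ; exact: pF.
Qed.

Lemma rint_mean f : continuous f -> exists2 c, 0 < c < 1 & rint f = f c.
Proof.
move=> /continuous_primitive01[F pF].
have [|||c c01 E] := @primitive01_mvt _ _ 0 1 _ _ _ pF; try lra.
by exists c => //; rewrite (rint_primitive pF) E; lra.
Qed.

Lemma rint_affine f F a b : 0 <= a <= 1 -> 0 <= a + b <= 1 ->
  primitive01 f F -> b * rint (fun x => f (a + b * x)) = F (a + b) - F a.
Proof.
move=> a01 ab01 pF.
have [->|b0] := eqVneq b 0; first by rewrite mul0r addr0 subrr.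
rewrite (@rint_primitive _ (fun x => b^-1 * F (a + b * x))).
  by rewrite mulr1 mulr0 addr0 -mulrBr mulrA mulfV // mul1r.
move=> x x01; have y01 : 0 <= a + b * x <= 1 by nra.
apply: is_derive_eps => e e0.
have b0' : 0 < `|b| by rewrite normr_gt0.
have [d d0 Hd] := is_derive_lim (pF _ y01) e0.
exists (d / `|b|) => [|h]; first by rewrite divr_gt0.
rewrite ltr_pdivlMr // => hd.
have : `|b * h| < d by rewrite normrM mulrC.
move/Hd; rewrite normrM => H.
have -> : b^-1 * F (a + b * (x + h)) - b^-1 * F (a + b * x) - f (a + b * x) * h =
   b^-1 * (F (a + b * x + b * h) - F (a + b * x) - f (a + b * x) * (b * h)).
  by rewrite mulrDr addrA; field.
by rewrite normrM normfV ler_pdivrMl // (mulrCA _ e).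
Qed.

Lemma rint_split f a : 0 <= a <= 1 -> continuous f ->
  rint f = a * rint (fun x => f (a * x)) + (1 - a) * rint (fun x => f (a + (1 - a) * x)).
Proof.
move=> a01 /continuous_primitive01[F pF].
have h0 : a * rint (fun x => f (a * x)) = F a - F 0.
  have := @rint_affine f F 0 a _ _ pF; rewrite !add0r => <-; [|lra|lra].
  by congr (_ * rint _); apply/funext => x; rewrite add0r.
have h1 : (1 - a) * rint (fun x => f (a + (1 - a) * x)) = F 1 - F a.
  by rewrite (rint_affine _ _ pF); rewrite ?(addrC a) ?subrK //; lra.
by rewrite h0 h1 (rint_primitive pF); lra.
Qed.

Lemma rint_rev f : continuous f -> rint (fun x => f (1 - x)) = rint f.
Proof.
move=> /continuous_primitive01[F pF]; rewrite (rint_primitive pF).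
have := @rint_affine f F 1 (-1) _ _ pF; rewrite subrr => H.
have -> : (fun x => f (1 - x)) = (fun x => f (1 + -1 * x)) by apply/funext => x; rewrite mulN1r.
have : -1 * rint (fun x => f (1 + -1 * x)) = F 0 - F 1 by apply: H; lra.
lra.
Qed.

Definition cint (g : R -> C) : C :=
  rc (rint (fun x => complex.Re (g x))) + 'i%C * rc (rint (fun x => complex.Im (g x))).

Implicit Types (p q : R -> C).

Lemma continuous_Re p : (forall x, cont_at p x) -> continuous (fun x => complex.Re (p x)).
Proof. by move=> pc x; have [] := cont_comp (pc x) (@cRe_continuous R (p x)). Qed.

Lemma continuous_Im p : (forall x, cont_at p x) -> continuous (fun x => complex.Im (p x)).
Proof. by move=> pc x; have [] := cont_comp (pc x) (@cIm_continuous R (p x)). Qed.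

Lemma cint_Re p : complex.Re (cint p) = rint (fun x => complex.Re (p x)).
Proof. by rewrite /cint /=; lra. Qed.

Lemma cint_Im p : complex.Im (cint p) = rint (fun x => complex.Im (p x)).
Proof. by rewrite /cint /=; lra. Qed.

Lemma cintD p q : (forall x, cont_at p x) -> (forall x, cont_at q x) ->
  cint (fun x => p x + q x) = cint p + cint q.
Proof.
move=> pc qc; apply: complex_eq.
  rewrite [RHS]cReD !cint_Re -rintD; do ?exact: continuous_Re.
  by congr rint; apply/funext => x; rewrite cReD.
rewrite [RHS]cImD !cint_Im -rintD; do ?exact: continuous_Im.
by congr rint; apply/funext => x; rewrite cImD.
Qed.

Lemma cintZ z p : (forall x, cont_at p x) -> cint (fun x => z * p x) = z * cint p.
Proof.
move=> pc; have pr := continuous_Re pc; have pi := continuous_Im pc.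
have rM k f : continuous f -> continuous (fun x => k * f x).
  by move=> fc x; apply: cvgM (fc x); exact: cvg_cst.
apply: complex_eq.
  rewrite [RHS]cReM !(cint_Re, cint_Im) -mulNr -rintZ // -rintZ // -rintD; do ?exact: rM.
  by congr rint; apply/funext => x; rewrite cReM mulNr.
rewrite [RHS]cImM !(cint_Re, cint_Im) -rintZ // -rintZ // -rintD; do ?exact: rM.
by congr rint; apply/funext => x; rewrite cImM.
Qed.

(** Real and imaginary parts are bounded separately by the mean value theorem. This costs the factor
    2, which is harmless in every later estimate. *)
Lemma cint_bound p M : (forall x, cont_at p x) -> (forall x, 0 < x < 1 -> cabs (p x) <= M) ->
  cabs (cint p) <= 2 * M.
Proof.
move=> pc pM; apply: le_trans (cabs_le_ReIm _) _; rewrite cint_Re cint_Im.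
have [c c01 ->] := rint_mean (continuous_Re pc).
have [d d01 ->] := rint_mean (continuous_Im pc).
have := le_trans (Re_le_cabs _) (pM _ c01); have := le_trans (Im_le_cabs _) (pM _ d01); lra.
Qed.

Lemma cint_split p a : 0 <= a <= 1 -> (forall x, cont_at p x) ->
  cint p = rc a * cint (fun x => p (a * x)) + rc (1 - a) * cint (fun x => p (a + (1 - a) * x)).
Proof.
move=> a01 pc; apply: complex_eq.
  by rewrite [RHS]cReD !cReM !cint_Re (rint_split a01 (continuous_Re pc)) /=; lra.
by rewrite [RHS]cImD !cImM !cint_Im (rint_split a01 (continuous_Im pc)) /=; lra.
Qed.

Lemma cint_rev p : (forall x, cont_at p x) -> cint (fun x => p (1 - x)) = cint p.
Proof.
move=> pc; apply: complex_eq; rewrite !(cint_Re, cint_Im).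
  by rewrite -(rint_rev (continuous_Re pc)).
by rewrite -(rint_rev (continuous_Im pc)).
Qed.

Definition rcdiff (P : R -> C) x (l : C) := forall e, 0 < e -> exists2 d : R, 0 < d &
  forall h, `|h| < d -> cabs (P (x + h) - P x - l * rc h) <= e * `|h|.

Lemma rcdiff_Re P x l : rcdiff P x l ->
  is_derive (x : R^o) (1 : R^o) (fun y => complex.Re (P y)) (complex.Re l).
Proof.
move=> dP; apply: is_derive_eps => e e0.
have [d d0 Hd] := dP e e0; exists d => // h /Hd; apply: le_trans.
by apply: le_trans (Re_le_cabs _); rewrite !cReB cReM /= mulr0 subr0.
Qed.

Lemma rcdiff_Im P x l : rcdiff P x l ->
  is_derive (x : R^o) (1 : R^o) (fun y => complex.Im (P y)) (complex.Im l).
Proof.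
move=> dP; apply: is_derive_eps => e e0.
have [d d0 Hd] := dP e e0; exists d => // h /Hd; apply: le_trans.
by apply: le_trans (Im_le_cabs _); rewrite !cImB cImM /= mulr0 add0r.
Qed.

Lemma cint_primitive p (P : R -> C) : (forall x, 0 <= x <= 1 -> rcdiff P x (p x)) ->
  cint p = P 1 - P 0.
Proof.
move=> dP; apply: complex_eq; rewrite [RHS](cReB, cImB) (cint_Re, cint_Im).
  by apply: (@rint_primitive _ (fun x => complex.Re (P x))) => x /dP /rcdiff_Re.
by apply: (@rint_primitive _ (fun x => complex.Im (P x))) => x /dP /rcdiff_Im.
Qed.

End Integral.

(** * Complex differentiability *)

Section Differentiation.
Variable R : realType.
Local Notation C := R[i].
Implicit Types (z w a b c d : C) (x y e : R) (f g F : C -> C).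

Definition cdiff f z d := forall e, 0 < e -> exists2 r : R, 0 < r &
  forall h, cabs h < r -> cabs (f (z + h) - f z - d * h) <= e * cabs h.

(** Carathéodory's form of differentiability. Product, chain and inverse rules become identities
    between the continuous factors [q]. *)
Lemma cdiff_factor f z d q r : 0 < r -> cont_at q z -> q z = d ->
  (forall w, cabs (w - z) < r -> f w = f z + (w - z) * q w) -> cdiff f z d.
Proof.
move=> r0 /continuous_CP qc qz fq e e0; have [s s0 Hs] := qc e e0.
exists (Num.min r s); first by rewrite lt_min r0 s0.
move=> h; rewrite lt_min => /andP[hr hs].
have E : z + h - z = h by rewrite addrC addKr.
rewrite fq E //; have -> : f z + h * q (z + h) - f z - d * h = (q (z + h) - d) * h by ring.
rewrite cabsM; apply: ler_wpM2r; first exact: cabs_ge0.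
by rewrite -qz; apply/ltW/Hs; rewrite E.
Qed.

Definition quo f z d w := if w == z then d else (f w - f z) / (w - z).

Lemma quo_factor f z d w : f w = f z + (w - z) * quo f z d w.
Proof.
rewrite /quo; case: eqVneq => [->|wz]; first by rewrite subrr mul0r addr0.
by rewrite mulrC divfK ?subr_eq0 // addrC subrK.
Qed.

Lemma quo_id f z d : quo f z d z = d. Proof. by rewrite /quo eqxx. Qed.

Lemma quo_continuous f z d : cdiff f z d -> cont_at (quo f z d) z.
Proof.
move=> df; apply/continuous_CP => e e0; have e2 : 0 < e / 2 by lra.
have [r r0 Hr] := df _ e2; exists r => // w wz; rewrite quo_id /quo.
case: eqVneq => [_|wz']; first by rewrite subrr cabs0.
have h0 : 0 < cabs (w - z) by rewrite cabs_gt0 subr_eq0.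
have zw : z + (w - z) = w by ring.
have := Hr _ wz; rewrite zw => H.
apply: (@le_lt_trans _ _ (e / 2)); last lra.
by rewrite -(ler_pM2r h0) -cabsM mulrBl divfK // subr_eq0.
Qed.

Lemma cdiff_continuous f z d : cdiff f z d -> cont_at f z.
Proof.
move=> df; have -> : f = (fun w => f z + (w - z) * quo f z d w).
  by apply/funext => w; exact: quo_factor.
apply: contD; first exact: cont_cst.
apply: contM; last exact: quo_continuous.
by apply: contB; [exact: cont_id|exact: cont_cst].
Qed.

Lemma cdiff_cst c z : cdiff (fun=> c) z 0.
Proof.
by apply: (@cdiff_factor _ _ _ (fun=> 0) 1) => // [|w _]; [exact: cont_cst|rewrite mulr0 addr0].
Qed.

Lemma cdiff_id z : cdiff id z 1.
Proof.
apply: (@cdiff_factor _ _ _ (fun=> 1) 1) => // [|w _]; first exact: cont_cst.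
by rewrite mulr1 addrC subrK.
Qed.

Lemma cdiffD f g z c d : cdiff f z c -> cdiff g z d -> cdiff (fun w => f w + g w) z (c + d).
Proof.
move=> df dg; apply: (@cdiff_factor _ _ _ (fun w => quo f z c w + quo g z d w) 1) => //.
- by apply: contD; exact: quo_continuous.
- by rewrite !quo_id.
- by move=> w _; rewrite {1}(quo_factor f z c w) {1}(quo_factor g z d w); ring.
Qed.

Lemma cdiffM f g z c d : cdiff f z c -> cdiff g z d ->
  cdiff (fun w => f w * g w) z (c * g z + f z * d).
Proof.
move=> df dg; apply: (@cdiff_factor _ _ _ (fun w => quo f z c w * g w + f z * quo g z d w) 1) => //.
- apply: contD; apply: contM; do ?[exact: quo_continuous|exact: cont_cst].
  exact: cdiff_continuous dg.
- by rewrite !quo_id.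
- by move=> w _; rewrite {1}(quo_factor f z c w) {1}(quo_factor g z d w) (quo_factor g z d w); ring.
Qed.

Lemma cdiffZ f z c d : cdiff f z d -> cdiff (fun w => c * f w) z (c * d).
Proof. by move=> /(cdiffM (cdiff_cst c z)); rewrite mul0r add0r. Qed.

Lemma cdiffN f z d : cdiff f z d -> cdiff (fun w => - f w) z (- d).
Proof.
move=> /(cdiffZ (-1)); rewrite mulN1r.
by have -> : (fun w => -1 * f w) = (fun w => - f w) by apply/funext => w; rewrite mulN1r.
Qed.

Lemma cdiffB f g z c d : cdiff f z c -> cdiff g z d -> cdiff (fun w => f w - g w) z (c - d).
Proof. by move=> df /cdiffN; exact: cdiffD. Qed.

Lemma cdiff_comp f g z c d : cdiff g z d -> cdiff f (g z) c -> cdiff (fun w => f (g w)) z (c * d).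
Proof.
move=> dg df; apply: (@cdiff_factor _ _ _ (fun w => quo f (g z) c (g w) * quo g z d w) 1) => //.
- apply: contM; last exact: quo_continuous.
  by apply: (cont_comp (cdiff_continuous dg)); exact: quo_continuous.
- by rewrite !quo_id.
- by move=> w _; rewrite {1}(quo_factor f (g z) c (g w)) {1}(quo_factor g z d w); ring.
Qed.

Lemma cdiffV z : z != 0 -> cdiff GRing.inv z (- z ^- 2).
Proof.
move=> z0; apply: (@cdiff_factor _ _ _ (fun w => - (z^-1 * w^-1)) (cabs z)).
- by rewrite cabs_gt0.
- apply: contN; apply: contM; first exact: cont_cst.
  by apply: contV => //; exact: cont_id.
- by rewrite -invfM expr2.
- move=> w wz; have w0 : w != 0.
    by apply: contraTneq wz => ->; rewrite sub0r cabsN -leNgt.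
  by field; rewrite z0 w0.
Qed.

Lemma cdiff_uniq f z c d : cdiff f z c -> cdiff f z d -> c = d.
Proof.
move=> df dg; apply/eqP; rewrite -subr_eq0 -cabs_eq0 eq_le cabs_ge0 andbT.
apply/ler_addgt0Pl => e e0; rewrite addr0.
have e2 : 0 < e / 2 by lra.
have [r r0 Hr] := df _ e2; have [s s0 Hs] := dg _ e2.
have m0 : 0 < Num.min r s by rewrite lt_min r0 s0.
pose t := Num.min r s / 2; have t0 : 0 < t by rewrite divr_gt0.
have tm : t < Num.min r s by rewrite /t; lra.
move: (tm); rewrite lt_min => /andP[tr ts].
have ct : cabs (rc t) = t by rewrite cabs_rc gtr0_norm.
have := Hr (rc t); have := Hs (rc t); rewrite ct => /(_ ts) Hs' /(_ tr) Hr'.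
have : cabs ((c - d) * rc t) <= e * t.
  have -> : (c - d) * rc t = (f (z + rc t) - f z - d * rc t) - (f (z + rc t) - f z - c * rc t) by ring.
  by apply: le_trans (cabsBD _ _) _; lra.
by rewrite cabsM ct ler_pM2r.
Qed.

Definition ent f := forall z, exists d, cdiff f z d.

Definition cder f z : C := xget 0 [set d | cdiff f z d].

Lemma cderP f z : ent f -> cdiff f z (cder f z).
Proof. by move=> /(_ z) H; exact: (xgetPex 0 H). Qed.

Lemma cder_eq f z d : cdiff f z d -> cder f z = d.
Proof.
move=> df; have H : exists d, cdiff f z d by exists d.
exact: (cdiff_uniq (xgetPex 0 H) df).
Qed.

Lemma ent_continuous f : ent f -> forall z, cont_at f z.
Proof. by move=> ef z; have [d] := ef z; exact: cdiff_continuous. Qed.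

Lemma ent_comp f g : ent f -> ent g -> ent (fun z => f (g z)).
Proof. by move=> ef eg z; exists (cder f (g z) * cder g z); apply: cdiff_comp; exact: cderP. Qed.

Lemma ent_cst c : ent (fun=> c). Proof. by move=> z; exists 0; exact: cdiff_cst. Qed.
Lemma ent_id : ent id. Proof. by move=> z; exists 1; exact: cdiff_id. Qed.
Lemma entD f g : ent f -> ent g -> ent (fun z => f z + g z).
Proof. by move=> ef eg z; exists (cder f z + cder g z); apply: cdiffD; exact: cderP. Qed.
Lemma entB f g : ent f -> ent g -> ent (fun z => f z - g z).
Proof. by move=> ef eg z; exists (cder f z - cder g z); apply: cdiffB; exact: cderP. Qed.
Lemma entM f g : ent f -> ent g -> ent (fun z => f z * g z).
Proof. by move=> ef eg z; exists (cder f z * g z + f z * cder g z); apply: cdiffM; exact: cderP. Qed.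

Lemma ent_iter f n : ent f -> ent (iter n f).
Proof. by move=> ef; elim: n => [|n IH] /=; [exact: ent_id|exact: ent_comp]. Qed.

Lemma entire_ent f : entire f -> ent f.
Proof.
move=> ef z; exists ('D_1 f z) => e e0.
have dF : h^-1 *: (f (h *: (1 : C) + z) - f z) @[h --> (0 : C)^'] --> 'D_1 f z := ef z.
have /nbhsCP[r r0 Hr] := dF _ (nbhs_disc ('D_1 f z) e0).
exists r => // h hr; have [->|h0] := eqVneq h 0.
  by rewrite addr0 subrr mulr0 subr0 cabs0 mulr0.
have := Hr h; rewrite subr0 => /(_ hr h0); rewrite /disc /=.
rewrite -[h *: 1]/(h * 1) mulr1 (addrC h) -[_ *: _]/(_ * _) => Hh.
have h0' : 0 < cabs h by rewrite cabs_gt0.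
move/ltW: Hh; rewrite -(ler_pM2r h0') -cabsM.
by rewrite (_ : _ * h = f (z + h) - f z - 'D_1 f z * h) //; field.
Qed.

End Differentiation.

(** * Cauchy's theorem *)

Section Goursat.
Variable R : realType.
Local Notation C := R[i].
Implicit Types (z w : C) (a b c d : C) (x y e t : R) (f g F : C -> C).

Definition cpath a b t : C := a + rc t * (b - a).

Lemma cpath_continuous a b t : cont_at (cpath a b) t.
Proof. exact: contD (cont_cst _ _) (contM (rc_continuous t) (cont_cst _ _)). Qed.

Lemma cpath_dist a b t : 0 <= t <= 1 -> cabs (cpath a b t - a) <= cabs (b - a).
Proof.
move=> /andP[t0 t1]; rewrite /cpath addrC addKr cabsM cabs_rc ger0_norm //.
by rewrite ler_piMl // cabs_ge0.
Qed.

Definition seg f a b : C := (b - a) * cint (fun t => f (cpath a b t)).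

(** Continuity is asked at every real [t], along the whole line through [a] and [b], as in the
    lemmas on [cint]. Poles must therefore avoid the lines that carry a contour. *)
Definition seg_cont f a b := forall t, cont_at (fun t => f (cpath a b t)) t.

Lemma continuous_seg_cont f a b : (forall z, cont_at f z) -> seg_cont f a b.
Proof. by move=> fc t; exact: cont_comp (cpath_continuous a b t) (fc _). Qed.

Lemma segD f g a b : seg_cont f a b -> seg_cont g a b ->
  seg (fun z => f z + g z) a b = seg f a b + seg g a b.
Proof. by move=> fc gc; rewrite /seg cintD // mulrDr. Qed.

Lemma segZ f k a b : seg_cont f a b -> seg (fun z => k * f z) a b = k * seg f a b.
Proof. by move=> fc; rewrite /seg cintZ // mulrCA. Qed.

Lemma seg_contZ f k a b : seg_cont f a b -> seg_cont (fun z => k * f z) a b.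
Proof. by move=> fc t; exact: contM (cont_cst _ _) (fc t). Qed.

Lemma segB f g a b : seg_cont f a b -> seg_cont g a b ->
  seg (fun z => f z - g z) a b = seg f a b - seg g a b.
Proof.
move=> fc gc; have -> : (fun z => f z - g z) = (fun z => f z + (-1) * g z).
  by apply/funext => z; rewrite mulN1r.
by rewrite segD // ?segZ ?mulN1r //; exact: seg_contZ.
Qed.

Lemma seg_bound f a b M : seg_cont f a b -> (forall t, 0 < t < 1 -> cabs (f (cpath a b t)) <= M) ->
  cabs (seg f a b) <= 2 * M * cabs (b - a).
Proof.
move=> fc fM; rewrite /seg cabsM mulrC; apply: ler_wpM2r; first exact: cabs_ge0.
exact: cint_bound.
Qed.

Lemma seg_rev f a b : seg_cont f a b -> seg f b a = - seg f a b.
Proof.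
move=> fc; rewrite /seg -(cint_rev fc) -mulNr opprB; congr (_ * cint _).
by apply/funext => t; congr f; rewrite /cpath rcB rc1; ring.
Qed.

Lemma seg_mid f a b : seg_cont f a b -> seg f a b = seg f a ((a + b) / 2) + seg f ((a + b) / 2) b.
Proof.
move=> fc; rewrite /seg (@cint_split _ _ (2^-1)) //; last by lra.
have r2 : rc 2^-1 = 2^-1 :> C by rewrite rcV rc_nat.
have r2' : rc (1 - 2^-1) = 2^-1 :> C by rewrite rcB r2 rc1; field.
rewrite mulrDr !mulrA; congr (_ * cint _ + _ * cint _).
- by rewrite r2; field.
- by apply/funext => t; congr f; rewrite /cpath rcM r2; field.
- by rewrite r2'; field.
- by apply/funext => t; congr f; rewrite /cpath rcD rcM r2 r2'; field.
Qed.

Lemma rcdiff_cpath F a b t d : cdiff F (cpath a b t) d ->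
  rcdiff (fun s => F (cpath a b s)) t ((b - a) * d).
Proof.
move=> dF e e0; have [->|ab] := eqVneq b a.
  exists 1 => // h _; rewrite /cpath subrr !mulr0 !addr0 subrr !mul0r subr0 cabs0.
  by rewrite mulr_ge0 ?normr_ge0 // ltW.
have h0 : 0 < cabs (b - a) by rewrite cabs_gt0 subr_eq0.
have e1 : 0 < e / cabs (b - a) by rewrite divr_gt0.
have [r r0 Hr] := dF _ e1; exists (r / cabs (b - a)); first by rewrite divr_gt0.
move=> h; rewrite ltr_pdivlMr // => hr.
have := Hr (rc h * (b - a)); rewrite cabsM cabs_rc => /(_ hr).
have -> : e / cabs (b - a) * (`|h| * cabs (b - a)) = e * `|h| by field; rewrite gt_eqF.
move=> H.
have -> : cpath a b (t + h) = cpath a b t + rc h * (b - a) by rewrite /cpath rcD; ring.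
by have -> : (b - a) * d * rc h = d * (rc h * (b - a)) by ring.
Qed.

Lemma seg_primitive F f a b : seg_cont f a b ->
  (forall t, 0 <= t <= 1 -> cdiff F (cpath a b t) (f (cpath a b t))) -> seg f a b = F b - F a.
Proof.
move=> fc dF; rewrite /seg -cintZ // (@cint_primitive _ _ (fun t => F (cpath a b t))).
  by congr (F _ - F _); rewrite /cpath ?rc1 ?rc0; ring.
by move=> t /dF; exact: rcdiff_cpath.
Qed.

Lemma seg_ext f g a b : (forall t, f (cpath a b t) = g (cpath a b t)) -> seg f a b = seg g a b.
Proof. by move=> fg; rewrite /seg; congr (_ * cint _); apply/funext. Qed.

Definition tri f (T : C * C * C) := let: (a, b, c) := T in seg f a b + seg f b c + seg f c a.
Definition perim (T : C * C * C) : R :=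
  let: (a, b, c) := T in cabs (b - a) + cabs (c - b) + cabs (a - c).

Lemma perim_ge0 T : 0 <= perim T.
Proof. by case: T => [[a b] c] /=; rewrite !addr_ge0 ?cabs_ge0. Qed.

Lemma cabs_half z : cabs (z / 2) = cabs z / 2.
Proof. by rewrite cabsM cabsV cabs_nat. Qed.

(** Goursat's bisection: the midpoints of the sides cut out four triangles, the inner edges cancel,
    and one of the four carries at least a quarter of the integral. *)
Lemma tri_step f T : (forall z, cont_at f z) -> exists2 T' : C * C * C, cabs (tri f T) <= 4 * cabs (tri f T') &
  perim T' = perim T / 2 /\ cabs (T'.1.1 - T.1.1) <= perim T.
Proof.
move=> fc; case: T => [[a b] c].
have sc u v : seg_cont f u v := continuous_seg_cont _ _ fc.
set m1 := (a + b) / 2; set m2 := (b + c) / 2; set m3 := (c + a) / 2.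
have E : tri f (a, b, c) = tri f (a, m1, m3) + tri f (m1, b, m2) + tri f (m3, m2, c) + tri f (m2, m3, m1).
  rewrite /tri (seg_mid (sc a b)) (seg_mid (sc b c)) (seg_mid (sc c a)) -/m1 -/m2 -/m3.
  rewrite (seg_rev (sc m1 m3)) (seg_rev (sc m1 m2)) (seg_rev (sc m2 m3)); ring.
have p1 : [/\ perim (a, m1, m3) = perim (a, b, c) / 2, perim (m1, b, m2) = perim (a, b, c) / 2,
    perim (m3, m2, c) = perim (a, b, c) / 2 & perim (m2, m3, m1) = perim (a, b, c) / 2].
  rewrite /perim.
  have h u v w z : u - v = (w - z) / 2 -> cabs (u - v) = cabs (w - z) / 2.
    by move=> ->; exact: cabs_half.
  have h' u v w z : u - v = (w - z) / 2 -> cabs (u - v) = cabs (z - w) / 2.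
    by rewrite (cabsB z); exact: h.
  split.
  - rewrite (h m1 a b a) ?(h a m3 a c) ?(h m3 m1 c b) /m1 /m3; try by field.
  - rewrite (h b m1 b a) ?(h m2 b c b) ?(h m1 m2 a c) /m1 /m2; try by field.
  - rewrite (h m2 m3 b a) ?(h c m2 c b) ?(h m3 c a c) /m2 /m3; try by field.
  - rewrite (h' m3 m2 a b) ?(h' m1 m3 b c) ?(h' m2 m1 c a) /m1 /m2 /m3; try by field.
have [P1 P2 P3 P4] := p1.
have d1 : cabs (m1 - a) <= perim (a, b, c).
  have -> : m1 - a = (b - a) / 2 by rewrite /m1; field.
  rewrite cabs_half /perim.
  by have := cabs_ge0 (b - a); have := cabs_ge0 (c - b); have := cabs_ge0 (a - c); lra.
have d3 : cabs (m3 - a) <= perim (a, b, c).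
  have -> : m3 - a = (c - a) / 2 by rewrite /m3; field.
  rewrite cabs_half /perim (cabsB c a).
  by have := cabs_ge0 (b - a); have := cabs_ge0 (c - b); have := cabs_ge0 (a - c); lra.
have d2 : cabs (m2 - a) <= perim (a, b, c).
  have -> : m2 - a = (b - a) / 2 + (c - a) / 2 by rewrite /m2; field.
  apply: le_trans (cabsD _ _) _; rewrite !cabs_half /perim (cabsB c a).
  by have := cabs_ge0 (b - a); have := cabs_ge0 (c - b); have := cabs_ge0 (a - c); lra.
have S : cabs (tri f (a, b, c)) <= cabs (tri f (a, m1, m3)) + cabs (tri f (m1, b, m2)) +
   cabs (tri f (m3, m2, c)) + cabs (tri f (m2, m3, m1)).
  rewrite E; apply: le_trans (cabsD _ _) _; rewrite lerD2r.
  by apply: le_trans (cabsD _ _) _; rewrite lerD2r; exact: cabsD.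
have [l1|l1] := leP (cabs (tri f (a, b, c))) (4 * cabs (tri f (a, m1, m3))).
  by exists (a, m1, m3) => //; split=> //; rewrite [X in cabs X]subrr cabs0; exact: (perim_ge0 (a, b, c)).
have [l2|l2] := leP (cabs (tri f (a, b, c))) (4 * cabs (tri f (m1, b, m2))).
  by exists (m1, b, m2).
have [l3|l3] := leP (cabs (tri f (a, b, c))) (4 * cabs (tri f (m3, m2, c))).
  by exists (m3, m2, c).
exists (m2, m3, m1); first by lra.
by split.
Qed.

(** Cantor's intersection theorem. Below it also takes the place of finite subcovers and of
    convergent subsequences. *)
Lemma nested_compact (K : nat -> set C) : compact (K 0%N) -> (forall n, closed (K n)) ->
  (forall n, K n.+1 `<=` K n) -> (forall n, K n !=set0) -> exists z, forall n, K n z.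
Proof.
move=> cK clK sK neK.
have mono n m : (n <= m)%N -> K m `<=` K n.
  by move=> /subnK <-; elim: (m - n)%N => // k IH z; rewrite addSn => /sK /IH.
have [x Hx] := choice neK.
have [|z [Kz zc]] := cK (x @ \oo) _; first by exists 0%N => // n _; exact: (mono 0%N n) (Hx n).
exists z => n; apply: clK => B Bz.
have [|w [Kw Bw]] := zc (K n) B _ Bz; last by exists w.
by exists n => // m nm; exact: (mono n m) (Hx m).
Qed.

Lemma goursat f T : ent f -> tri f T = 0.
Proof.
move=> ef; have fc := ent_continuous ef.
have sc g u v : (forall z, cont_at g z) -> seg_cont g u v := fun gc => continuous_seg_cont _ _ gc.
have [S HS] := choice (fun T => let: ex_intro2 T' h1 h2 := tri_step T fc in
  ex_intro (fun T' => cabs (tri f T) <= 4 * cabs (tri f T') /\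
  (perim T' = perim T / 2 /\ cabs (T'.1.1 - T.1.1) <= perim T)) T' (conj h1 h2)).
pose Tn n := iter n S T; pose p n := perim (Tn n); pose u n := (Tn n).1.1.
have pn n : p n = perim T / 2 ^+ n.
  elim: n => [|n IH]; first by rewrite expr0 divr1.
  by rewrite /p /Tn /= (HS _).2.1 -/(Tn n) -/(p n) IH exprS; field; rewrite expf_neq0.
have tn n : cabs (tri f T) <= 4 ^+ n * cabs (tri f (Tn n)).
  elim: n => [|n IH]; first by rewrite expr0 mul1r.
  apply: le_trans IH _; rewrite exprSr -mulrA ler_wpM2l ?exprn_ge0 //.
  exact: (HS _).1.
have un n : cabs (u n.+1 - u n) <= p n by exact: (HS (Tn n)).2.2.
(* The first vertex moves by at most [p n] while the perimeter is halved, so discs of radius twice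
   the perimeter are nested. *)
have [z Hz] : exists z, forall n, cdisc (u n) (2 * p n) z.
  apply: nested_compact; first exact: compact_cdisc.
  - by move=> n; exact: closed_cdisc.
  - move=> n w; rewrite /cdisc /=.
    have -> : p n.+1 = p n / 2 by exact: (HS (Tn n)).2.1.
    move=> h; apply: le_trans (cabs_tri (u n.+1) w (u n)) _.
    by have := un n; lra.
  - by move=> n; exists (u n); rewrite /cdisc /= subrr cabs0 mulr_ge0 // perim_ge0.
apply/eqP; rewrite -cabs_eq0 eq_le cabs_ge0 andbT.
have P0 := perim_ge0 T.
(* The 6 is 2 from [seg_bound] times 3, as points of the triangle are within three perimeters of
   [z]. *)
suff K e : 0 < e -> cabs (tri f T) <= 6 * e * perim T ^+ 2.
  apply/ler_addgt0Pl => e e0; rewrite addr0.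
  have q0 : 0 < 6 * perim T ^+ 2 + 1 by have := sqr_ge0 (perim T); lra.
  have := K (e / (6 * perim T ^+ 2 + 1)); rewrite divr_gt0 // => /(_ isT) H.
  apply: le_trans H _; rewrite -mulrA mulrC -mulrA mulrAC ler_pdivrMr //.
  rewrite -subr_ge0; have : 0 <= e by lra. 
  have -> : e * (6 * perim T ^+ 2 + 1) - e * (perim T ^+ 2 * 6) = e by ring.
  by [].
move=> e0; have [r r0 Hr] := cderP z ef e0.
have [n Hn] : exists n, 3 * p n < r.
  exists (Num.bound (3 * perim T / r)).
  have := upper_nthrootP (leqnn (Num.bound (3 * perim T / r))).
  by rewrite pn mulrA !ltr_pdivrMr ?exprn_gt0 // (mulrC r).
set d := cder f z in Hr.
(* The affine part of [f] at [z] has the primitive [B], so its integral vanishes and only the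
   remainder counts. *)
pose A w := f z + d * (w - z).
have eA : ent A.
  by apply: entD; [exact: ent_cst|apply: entM; [exact: ent_cst|apply: entB; [exact: ent_id|exact: ent_cst]]].
have Ac := ent_continuous eA.
pose B w := f z * w + d * ((w - z) * (w - z)) / 2.
have dB w : cdiff B w (A w).
  have h : cdiff (fun v => v - z) w 1.
    by have := cdiffB (cdiff_id w) (cdiff_cst z w); rewrite subr0.
  have := cdiffD (cdiffZ (f z) (cdiff_id w)) (cdiffM (cdiffZ d (cdiffM h h)) (cdiff_cst 2^-1 w)).
  by rewrite (_ : _ + _ = A w) // /A; field.
have triA : tri A (Tn n) = 0.
  case: (Tn n) => [[a b] c] /=.
  have sp v w : seg A v w = B w - B v by apply: seg_primitive; [exact: sc|move=> t _; exact: dB].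
  by rewrite !sp; ring.
have -> : 6 * e * perim T ^+ 2 = 4 ^+ n * (6 * e * p n ^+ 2).
  rewrite pn expr_div_n -exprM mulnC exprM (_ : 2 ^+ 2 = 4) //; last by ring.
  by field; rewrite expf_neq0.
apply: le_trans (tn n) _; rewrite ler_wpM2l ?exprn_ge0 //.
have : tri f (Tn n) = tri (fun w => f w - A w) (Tn n).
  move: triA; case: (Tn n) => [[a b] c] /= triA.
  have sB v v' : seg (fun w => f w - A w) v v' = seg f v v' - seg A v v' by apply: segB; exact: sc.
  by rewrite !sB -[LHS]subr0 -triA; ring.
move=> ->; move: Hn (Hz n); rewrite /u /p; case: (Tn n) => [[a b] c] /= Hn Hzn.
move: Hn Hzn; set q := _ + _ + _ => Hn Hzn.
have q0 : 0 <= q by rewrite /q !addr_ge0 ?cabs_ge0.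
have rbound w : cabs (w - a) <= q -> cabs (f w - A w) <= 3 * e * q.
  move=> wa; have wz : cabs (w - z) <= 3 * q.
    by apply: le_trans (cabs_tri a w z) _; rewrite (cabsB a z); move: Hzn; rewrite /cdisc /= -/q; lra.
  have qr : cabs (w - z) < r by apply: le_lt_trans wz _; exact: Hn.
  have := Hr _ qr; rewrite (_ : z + (w - z) = w); last by ring.
  rewrite /A opprD addrA => H; apply: le_trans H _.
  by have := ler_wpM2l (ltW e0) wz; lra.
have side v w : (forall t, 0 <= t <= 1 -> cabs (cpath v w t - a) <= q) ->
    cabs (seg (fun w => f w - A w) v w) <= 2 * (3 * e * q) * cabs (w - v).
  move=> vw; apply: seg_bound.
    by apply: continuous_seg_cont => v1; exact: contB.
  by move=> t t01; apply/rbound/vw; lra.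
have ac : cabs (a - c) <= cabs (b - a) + cabs (c - b).
  by have := cabs_tri b a c; rewrite (cabsB a b) (cabsB b c).
have nab := cabs_ge0 (b - a); have nbc := cabs_ge0 (c - b); have nca := cabs_ge0 (a - c).
have s1 := side a b _; have s2 := side b c _; have s3 := side c a _.
apply: le_trans (cabsD _ _) _; apply: le_trans (lerD (cabsD _ _) (lexx _)) _.
have -> : 6 * e * q ^+ 2 = 2 * (3 * e * q) * cabs (b - a) + 2 * (3 * e * q) * cabs (c - b)
   + 2 * (3 * e * q) * cabs (a - c) by rewrite /q; ring.
apply: lerD; [apply: lerD; [apply: s1|apply: s2]|apply: s3] => t t01.
- by apply: le_trans (cpath_dist _ _ t01) _; rewrite /q; lra.
- apply: le_trans (cabs_tri b _ _) _; have := cpath_dist b c t01.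
  by rewrite /q; lra.
- apply: le_trans (cabs_tri c _ _) _; have := cpath_dist c a t01.
  by rewrite /q (cabsB c a); lra.
Qed.

Lemma tri_primitive f : (forall z, cont_at f z) -> (forall T, tri f T = 0) ->
  exists F, forall z, cdiff F z (f z).
Proof.
move=> fc tf; exists (seg f 0) => z e e0.
have sc g u v : (forall z, cont_at g z) -> seg_cont g u v := fun gc => continuous_seg_cont _ _ gc.
have e2 : 0 < e / 2 by lra.
have /continuous_CP /(_ _ e2)[r r0 Hr] := fc z.
exists r => // h hr.
have -> : seg f 0 (z + h) - seg f 0 z = seg f z (z + h).
  have := tf (0, z, z + h); rewrite /= (seg_rev (sc f 0 (z + h) fc)) => /eqP.
  by rewrite subr_eq0 => /eqP <-; ring.
have cc (u : C) : cont_at (fun=> f z : C) u by exact: cont_cst.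
have -> : f z * h = seg (fun=> f z) z (z + h).
  rewrite (@seg_primitive (fun w => f z * w)); [by ring|exact: sc|].
  by move=> t _; have := cdiffZ (f z) (cdiff_id (cpath z (z + h) t)); rewrite mulr1.
rewrite -segB; [|exact: sc|exact: sc].
have -> : e * cabs h = 2 * (e / 2) * cabs (z + h - z) by rewrite (addrC z) addrK; field.
apply: seg_bound; first by apply: sc => u; exact: contB.
move=> t t01; apply/ltW/Hr; apply: le_lt_trans hr.
have t01' : 0 <= t <= 1 by lra.
have := cpath_dist z (z + h) t01'.
by have -> : z + h - z = h by ring.
Qed.

Lemma ent_primitive f : ent f -> exists F, forall z, cdiff F z (f z).
Proof.
by move=> ef; apply: tri_primitive; [exact: ent_continuous|move=> T; exact: goursat].
Qed.

End Goursat.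

(** * Cauchy integrals over squares *)

Section Cauchy.
Variable R : realType.
Local Notation C := R[i].
Implicit Types (z w u h : C) (a b c d : C) (x y e t : R) (f g F : C -> C).
Local Notation I := ('i%C : C).

Lemma uniform_continuity f z M e : (forall w, cont_at f w) -> 0 < e ->
  exists2 d : R, 0 < d & forall w u, cabs (w - z) <= M -> cabs (u - w) < d -> cabs (f u - f w) < e.
Proof.
move=> fc e0; apply: contrapT => H.
have cK := @compact_cdisc R z M.
pose K n := closure [set w | cabs (w - z) <= M /\ exists2 u, cabs (u - w) < n.+1%:R^-1 & e <= cabs (f u - f w)].
have KM n : K n `<=` cdisc z M.
  rewrite [X in _ `<=` X](closure_id _).1; last exact: closed_cdisc.
  by apply: closureS => w [].
have [w Hw] : exists w, forall n, K n w.
  apply: nested_compact => [|n|n|n].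
  - exact: subclosed_compact (@closed_closure _ _) cK (KM 0%N).
  - exact: closed_closure.
  - apply: closureS => w [wM [u uw H1]]; split=> //; exists u => //.
    by apply: lt_le_trans uw _; rewrite lef_pV2 ?posrE ?ltr0n // ler_nat.
  - apply: contrapT => Kn; apply: H; exists n.+1%:R^-1; first by rewrite invr_gt0 ltr0n.
    move=> w u wM uw; rewrite ltNge; apply/negP => fe; apply: Kn; exists w.
    by apply: subset_closure; split=> //; exists u.
have e2 : 0 < e / 2 by lra.
have /continuous_CP /(_ _ e2)[r r0 Hr] := fc w.
have [n Hn] : exists n, n.+1%:R^-1 < r / 2.
  exists (Num.truncn (r / 2)^-1); rewrite invf_plt ?posrE ?ltr0n ?divr_gt0 //.
  exact: truncnS_gt.
have r2 : 0 < r / 2 by lra.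
have /closureCP /(_ _ r2)[w' [_ [u uw' fe]] w'w] := Hw n.
have h0 := lt_trans uw' Hn; have h1 := cabs_tri w' u w; have h2 := cabs_tri (f w) (f u) (f w').
have h3 : cabs (f u - f w) < e / 2 by apply: Hr; lra.
have h4 : cabs (f w' - f w) < e / 2 by apply: Hr; lra.
by move: h2; rewrite (cabsB (f w)); lra.
Qed.

(** Corners of the square of side 2 centred at [c]. Side [k] is the side [edge], on which the real
    part is 1, rotated by I ^ k. *)
Definition vtx c (k : nat) : C := c + I ^+ k * (1 - I).
Definition edge t : C := 1 + I * rc (2 * t - 1).

Lemma cpath_vtx c k t : cpath (vtx c k) (vtx c k.+1) t = c + I ^+ k * edge t.
Proof.
rewrite /cpath /vtx /edge exprS rcB rcM rc1 rc_nat.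
have I2 : I * I = -1 by rewrite -expr2 sqr_i.
have -> : c + I * I ^+ k * (1 - I) - (c + I ^+ k * (1 - I)) = I ^+ k * (I * (1 - I) - (1 - I)) by ring.
have -> : I * (1 - I) - (1 - I) = 2 * I by rewrite mulrBr I2; ring.
ring.
Qed.

Lemma cabs_Ik k : cabs (I ^+ k) = 1. Proof. by rewrite cabsX cabs_i expr1n. Qed.

Lemma edge_ge1 t : 1 <= cabs (edge t).
Proof.
apply: le_trans (Re_le_cabs _); rewrite /edge cReD cReM /= mul0r mulr0 subrr addr0.
by rewrite normr1.
Qed.

Lemma edge_le t : 0 <= t <= 1 -> cabs (edge t) <= 2.
Proof.
move=> t01; apply: le_trans (cabsD _ _) _; rewrite cabs1 cabsM cabs_i mul1r cabs_rc.
have : `|2 * t - 1| <= 1 by rewrite ler_norml; lra.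
lra.
Qed.

Lemma edge_continuous t : cont_at edge t.
Proof.
apply/continuous_RCP => e e0; exists (e / 2); first by lra.
move=> y yt; rewrite /edge (_ : _ - _ = I * rc (2 * (y - t))); last by rewrite !(rcB, rcM); ring.
by rewrite cabsM cabs_i mul1r cabs_rc normrM ger0_norm //; lra.
Qed.

Lemma contour_far c z k t : cabs (z - c) <= 1 / 4 ->
  3 / 4 <= cabs (cpath (vtx c k) (vtx c k.+1) t - z).
Proof.
move=> zc; rewrite cpath_vtx.
have := cabs_subr (I ^+ k * edge t) (z - c); rewrite cabsM cabs_Ik mul1r.
rewrite (_ : _ - (z - c) = c + I ^+ k * edge t - z); last by ring.
have := edge_ge1 t; lra.
Qed.

Definition sq g c : C := \sum_(k < 4) seg g (vtx c k) (vtx c k.+1).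
Definition sq_cont g c := forall k, seg_cont g (vtx c k) (vtx c k.+1).

Lemma vtx4 c : vtx c 4 = vtx c 0.
Proof.
rewrite /vtx expr0; congr (_ + _ * _).
by rewrite (exprM I 2 2) sqr_i sqrrN expr1n.
Qed.

Lemma sq_primitive F g c : sq_cont g c ->
  (forall k t, cdiff F (cpath (vtx c k) (vtx c k.+1) t) (g (cpath (vtx c k) (vtx c k.+1) t))) ->
  sq g c = 0.
Proof.
move=> gc dF; rewrite /sq (eq_bigr (fun k : 'I_4 => F (vtx c k.+1) - F (vtx c k))).
  by rewrite !big_ord_recr big_ord0 /= vtx4; ring.
by move=> k _; apply: seg_primitive => // t _; exact: dF.
Qed.

Lemma sqB f g c : sq_cont f c -> sq_cont g c -> sq (fun z => f z - g z) c = sq f c - sq g c.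
Proof. by move=> fc gc; rewrite /sq -sumrB; apply: eq_bigr => k _; rewrite segB. Qed.

Lemma sqZ f a c : sq_cont f c -> sq (fun z => a * f z) c = a * sq f c.
Proof. by move=> fc; rewrite /sq mulr_sumr; apply: eq_bigr => k _; rewrite segZ. Qed.

Lemma vtx_dist c k : cabs (vtx c k.+1 - vtx c k) = 2.
Proof.
rewrite /vtx exprS (_ : _ - _ = I ^+ k * (2 * I)); last first.
  have I2 : I * I = -1 by rewrite -expr2 sqr_i.
  rewrite (_ : _ - _ = I ^+ k * (2 * I + (- 1 - I * I))); last by ring.
  by rewrite I2 subrr addr0.
by rewrite !cabsM cabs_Ik cabs_i cabs_nat mul1r mulr1.
Qed.

Lemma sq_bound g c M : sq_cont g c ->
  (forall k t, 0 <= t <= 1 -> cabs (g (cpath (vtx c k) (vtx c k.+1) t)) <= M) ->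
  cabs (sq g c) <= 16 * M.
Proof.
move=> gc gM.
have b k : cabs (seg g (vtx c k) (vtx c k.+1)) <= 4 * M.
  have := @seg_bound R g (vtx c k) (vtx c k.+1) M (gc k).
  by rewrite vtx_dist => H; have := H _; rewrite (_ : 2 * M * 2 = 4 * M); [apply=> t t01; apply: gM; lra|ring].
rewrite /sq !big_ord_recr big_ord0 /= add0r.
have := b 0%N; have := b 1%N; have := b 2%N; have := b 3%N => b3 b2 b1 b0.
apply: le_trans (cabsD _ _) _; apply: le_trans (lerD (cabsD _ _) (lexx _)) _.
apply: le_trans (lerD (lerD (cabsD _ _) (lexx _)) (lexx _)) _; lra.
Qed.

Lemma sq_ext f g c : (forall k t, f (cpath (vtx c k) (vtx c k.+1) t) = g (cpath (vtx c k) (vtx c k.+1) t)) ->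
  sq f c = sq g c.
Proof. by move=> fg; apply: eq_bigr => k _; exact: seg_ext. Qed.

Definition kern f z m : C -> C := fun u => f u * (u - z)^-1 ^+ m.

Lemma contour_neq c z k t : cabs (z - c) <= 1 / 4 ->
  cpath (vtx c k) (vtx c k.+1) t - z != 0.
Proof.
by move=> zc; rewrite -cabs_gt0; apply: lt_le_trans (contour_far k t zc); lra.
Qed.

Lemma contour_continuous c k t : cont_at (cpath (vtx c k) (vtx c k.+1)) t.
Proof. exact: cpath_continuous. Qed.

Lemma kern_cont f c z m : (forall u, cont_at f u) -> cabs (z - c) <= 1 / 4 ->
  sq_cont (kern f z m) c.
Proof.
move=> fc zc k t; apply: contM; first exact: cont_comp (contour_continuous _ _ _) (fc _).
apply: contX; apply: contV; first exact: contour_neq.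
exact: contB (contour_continuous _ _ _) (cont_cst _ _).
Qed.

(** A uniform second order error, for differentiating under the contour integral. The bounds 1/2 and
    1/4 serve to keep both inverses at most 4. *)
Lemma inv_pow_taylor m : exists2 K : R, 0 <= K & forall u h, 1 / 2 <= cabs u -> 1 / 4 <= cabs (u - h) ->
  cabs ((u - h)^-1 ^+ m - u^-1 ^+ m - m%:R * h * u^-1 ^+ m.+1) <= K * cabs h ^+ 2.
Proof.
elim: m => [|m [K K0 IH]].
  by exists 0 => // u h _ _; rewrite !expr0 subrr !mul0r subr0 cabs0.
have M0 : (0 : R) <= m.+1%:R * 4 ^+ m.+3 by rewrite mulr_ge0 ?ler0n ?exprn_ge0.
exists (4 * K + m.+1%:R * 4 ^+ m.+3); first by lra.
move=> u h u1 h1.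
have u0 : u != 0 by rewrite -cabs_gt0; lra.
have uh0 : u - h != 0 by rewrite -cabs_gt0; lra.
set a := u^-1; set b := (u - h)^-1.
have ab : b - a = h * a * b by rewrite /a /b; field; rewrite u0 uh0.
have a2E : a ^+ m.+2 = a * (a * a ^+ m) by rewrite !exprS.
have a1E : a ^+ m.+1 = a * a ^+ m by rewrite exprS.
have -> : b ^+ m.+1 - a ^+ m.+1 - m.+1%:R * h * a ^+ m.+2 =
  b * (b ^+ m - a ^+ m - m%:R * h * a ^+ m.+1) + m.+1%:R * h ^+ 2 * (a ^+ m.+2 * b).
  have -> : m.+1%:R * h ^+ 2 * (a ^+ m.+2 * b) = m.+1%:R * h * a ^+ m.+1 * (b - a).
    by rewrite ab a2E a1E; ring.
  have -> : b ^+ m.+1 - a ^+ m.+1 = b * (b ^+ m - a ^+ m) + a ^+ m * (b - a).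
    by rewrite a1E exprS; ring.
  by rewrite [X in a ^+ m * X]ab a2E a1E mulrS; ring.
have a2 : cabs a <= 4 by rewrite cabsV invf_ple ?posrE //; lra.
have b2 : cabs b <= 4 by rewrite cabsV invf_ple ?posrE //; lra.
apply: le_trans (cabsD _ _) _; rewrite mulrDl; apply: lerD.
  rewrite cabsM -[X in _ <= X]mulrA; apply: ler_pM; rewrite ?cabs_ge0 //; exact: IH.
rewrite (cabsM (m.+1%:R * h ^+ 2)) (cabsM m.+1%:R) (cabsM (a ^+ m.+2)) cabs_nat (cabsX h) (cabsX a) -mulrA -[X in _ <= X]mulrA ler_wpM2l ?ler0n //.
rewrite mulrC; apply: ler_wpM2r; first by rewrite sqr_ge0.
rewrite (exprSr _ m.+2); apply: ler_pM; rewrite ?cabs_ge0 ?exprn_ge0 ?cabs_ge0 //.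
by apply: lerXn2r; rewrite ?nnegrE ?cabs_ge0.
Qed.

Lemma kern_diff f c z m : (forall u, cont_at f u) -> cabs (z - c) < 1 / 4 ->
  cdiff (fun w => sq (kern f w m) c) z (m%:R * sq (kern f z m.+1) c).
Proof.
move=> fc zc e e0; have [K K0 HK] := inv_pow_taylor m.
have [M HM] : exists M : R, forall u, cabs (u - c) <= 2 -> cabs (f u) <= M.
  have [||u uc Hu] := @compact_max R (cdisc c 2) (fun u => cabs (f u)) _ (@compact_cdisc R c 2).
  - by exists c; rewrite /cdisc /= subrr cabs0.
  - by move=> u _; exact: cont_comp (fc u) (cabs_continuous _).
  - by exists (cabs (f u)).
have M0 : 0 <= M by apply: le_trans (cabs_ge0 _) (HM c _); rewrite subrr cabs0.
(* The 16 is the loss in [sq_bound]. The other bound in [r] keeps z + h within 1/4 of [c], where the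
   contour is still at distance 3/4. *)
pose B := 16 * M * K + 1; have B0 : 0 < B by rewrite /B; have := mulr_ge0 M0 K0; lra.
pose r := Num.min (1 / 4 - cabs (z - c)) (e / B).
exists r; first by rewrite lt_min divr_gt0 // andbT; lra.
move=> h; rewrite lt_min => /andP[h1]; rewrite ltr_pdivlMr // => h2.
have zhc : cabs (z + h - c) <= 1 / 4.
  by rewrite addrAC; apply: le_trans (cabsD _ _) _; lra.
have zc' := ltW zc.
have kc w n : cabs (w - c) <= 1 / 4 -> sq_cont (kern f w n) c by exact: kern_cont.
have cA : sq_cont (fun u => kern f (z + h) m u - kern f z m u) c.
  by move=> k t; exact: contB (kc _ _ zhc k t) (kc _ _ zc' k t).
have cB : sq_cont (fun u => m%:R * h * kern f z m.+1 u) c.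
  by move=> k; exact: seg_contZ (kc _ _ zc' k).
have -> : m%:R * sq (kern f z m.+1) c * h = sq (fun u => m%:R * h * kern f z m.+1 u) c.
  by rewrite sqZ; [rewrite mulrAC|exact: kc].
rewrite -(sqB (kc _ _ zhc) (kc _ _ zc')) -(sqB cA cB).
apply: (@le_trans _ _ (16 * (M * K * cabs h ^+ 2))); last first.
  rewrite expr2 !mulrA; apply: ler_wpM2r; first exact: cabs_ge0.
  apply: ltW; apply: le_lt_trans h2; rewrite /B mulrDr mulr1 (mulrC _ (cabs h)) lerDl.
  exact: cabs_ge0.
apply: sq_bound.
  by move=> k t; exact: contB (cA k t) (cB k t).
move=> k t t01; rewrite /kern; set u := cpath _ _ _.
have uz := contour_far k t zc'; have uzh := contour_far k t zhc.
rewrite -/u in uz uzh.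
have -> : u - (z + h) = u - z - h by ring.
rewrite (_ : _ - _ = f u * ((u - z - h)^-1 ^+ m - (u - z)^-1 ^+ m - m%:R * h * (u - z)^-1 ^+ m.+1)); last by ring.
rewrite cabsM -[X in _ <= X]mulrA; apply: ler_pM; rewrite ?cabs_ge0 //.
  apply: HM; rewrite /u cpath_vtx addrC addKr cabsM cabs_Ik mul1r; exact: edge_le.
apply: HK; first lra.
have -> : u - z - h = u - (z + h) by ring.
lra.
Qed.

Lemma zero_deriv_disc F c r z : (forall w, cabs (w - c) < r -> cdiff F w 0) ->
  cabs (z - c) < r -> F z = F c.
Proof.
move=> dF zc; have := @cint_primitive R (fun=> 0) (fun t => F (cpath c z t)).
have -> : cint (fun=> 0 : C) = 0.
  by rewrite (@cint_primitive _ _ (fun=> 0)) ?subrr // => t _ e e0; exists 1 => // h _;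
    rewrite subrr mul0r subr0 cabs0 mulr_ge0 // ltW.
have -> : cpath c z 1 = z by rewrite /cpath rc1; ring.
have -> : cpath c z 0 = c by rewrite /cpath rc0; ring.
move=> H; apply/eqP; rewrite -subr_eq0 -H // => t t01.
have := @rcdiff_cpath R F c z t 0; rewrite mulr0; apply; apply: dF.
by apply: le_lt_trans zc; exact: cpath_dist.
Qed.

(** The value of this integral is not computed. The four sides contribute equally, and Re (1 / edge)
    is positive because the real part of [edge] is 1. *)
Lemma winding_neq0 c : sq (kern (fun=> 1) c 1) c != 0.
Proof.
pose p t := (edge t)^-1.
have e0 t : edge t != 0 by rewrite -cabs_gt0; apply: lt_le_trans (edge_ge1 t).
have pc t : cont_at p t by apply: contV => //; exact: edge_continuous.
have E k : seg (kern (fun=> 1) c 1) (vtx c k) (vtx c k.+1) = 2 * I * cint p.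
  rewrite /seg; have -> : vtx c k.+1 - vtx c k = I ^+ k * (2 * I).
    have I2 : I * I = -1 by rewrite -expr2 sqr_i.
    rewrite /vtx exprS (_ : _ - _ = I ^+ k * (2 * I + (- 1 - I * I))); last by ring.
    by rewrite I2 subrr addr0.
  have Ik0 : I ^+ k != 0 by rewrite -cabs_gt0 cabs_Ik.
  have -> : cint (fun t => kern (fun=> 1) c 1 (cpath (vtx c k) (vtx c k.+1) t)) =
      (I ^+ k)^-1 * cint p.
    rewrite -cintZ //; congr cint; apply/funext => t.
    by rewrite /kern cpath_vtx expr1 mul1r addrC addKr /p invfM.
  by move: Ik0; set q := I ^+ k => q0; field.
rewrite /sq (eq_bigr _ (fun (k : 'I_4) _ => E k)) sumr_const card_ord -[X in X != _]mulr_natl.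
rewrite !mulf_eq0 !negb_or !pnatr_eq0 /=; apply/andP; split; first by rewrite -cabs_gt0 cabs_i.
apply/eqP => /(congr1 (@complex.Re R)); rewrite cint_Re.
have [t _ ->] := rint_mean (continuous_Re pc).
have Re1 : complex.Re (edge t) = 1 by rewrite /edge cReD cReM /=; ring.
apply/eqP; rewrite /p; move: Re1 (e0 t); case: (edge t) => a b /= -> h.
rewrite mulf_eq0 invr_eq0 negb_or oner_neq0 /=.
by rewrite expr1n; have := sqr_ge0 b; lra.
Qed.

(** The derivative in [z] is the integral of (u - z)^-2, which has a primitive along the contour. *)
Lemma winding_const c z : cabs (z - c) < 1 / 4 ->
  sq (kern (fun=> 1) z 1) c = sq (kern (fun=> 1) c 1) c.
Proof.
pose F w := sq (kern (fun=> 1) w 1) c.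
have c1 (u : C) : cont_at (fun=> 1 : C) u by exact: cont_cst.
apply: (@zero_deriv_disc F) => w wc; have := kern_diff 1 c1 wc.
have wc' := ltW wc.
rewrite (@sq_primitive (fun u => - (u - w)^-1)) ?mulr0 //.
  exact: kern_cont.
move=> k t; set u := cpath _ _ _.
have uw : u - w != 0 by exact: contour_neq.
have dB : cdiff (fun v => v - w) u 1.
  by have := cdiffB (cdiff_id u) (cdiff_cst w u); rewrite subr0.
have := cdiffN (cdiff_comp dB (cdiffV uw)).
by rewrite mulr1 opprK /kern mul1r exprVn.
Qed.

Lemma sq_ent f c : ent f -> sq f c = 0.
Proof.
move=> ef; have [F dF] := ent_primitive ef.
by apply: (@sq_primitive F) => [k|k t]; [exact/continuous_seg_cont/ent_continuous|exact: dF].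
Qed.

Lemma riemann_sum F f z w n e : (forall u, cdiff F u (f u)) -> (forall u, cont_at f u) -> 0 <= e ->
  (forall k t, (k < n.+1)%N -> 0 <= t <= 1 ->
     cabs (f (z + rc ((k%:R + t) / n.+1%:R) * (w - z)) - f (z + rc (k%:R / n.+1%:R) * (w - z))) <= e) ->
  cabs (F w - F z - (w - z) * (n.+1%:R^-1 * \sum_(k < n.+1) f (z + rc (k%:R / n.+1%:R) * (w - z)))) <=
  2 * e * cabs (w - z).
Proof.
move=> dF fc e0 H; pose N : R := n.+1%:R; have N0 : N != 0 by rewrite pnatr_eq0.
pose v (k : nat) := z + rc (k%:R / N) * (w - z).
have vn : v n.+1 = w by rewrite /v mulfV // rc1 mul1r addrC subrK.
have v0 : v 0%N = z by rewrite /v mul0r rc0 mul0r addr0.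
have rN : rc N^-1 = n.+1%:R^-1 :> C by rewrite rcV rc_nat.
have dv k : v k.+1 - v k = rc N^-1 * (w - z).
  by rewrite /v -addn1 natrD mulrDl rcD mul1r; ring.
have sc g a b : (forall u, cont_at g u) -> seg_cont g a b by move=> gc; exact: continuous_seg_cont.
have step k : (k < n.+1)%N -> cabs (F (v k.+1) - F (v k) - (w - z) * (n.+1%:R^-1 * f (v k))) <=
    2 * e * (cabs (w - z) / N).
  move=> kn; have cc (u : C) : cont_at (fun=> f (v k)) u by exact: cont_cst.
  have -> : (w - z) * (n.+1%:R^-1 * f (v k)) = seg (fun=> f (v k)) (v k) (v k.+1).
    rewrite (@seg_primitive _ (fun u => f (v k) * u)); [|exact: sc|].
      by rewrite -mulrBr dv rN; ring.
    by move=> t _; have := cdiffZ (f (v k)) (cdiff_id (cpath (v k) (v k.+1) t)); rewrite mulr1.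
  rewrite -(@seg_primitive _ F f); [|exact: sc|by move=> t _; exact: dF].
  rewrite -segB; [|exact: sc|exact: sc].
  have -> : cabs (w - z) / N = cabs (v k.+1 - v k).
    by rewrite dv cabsM cabs_rc ger0_norm ?invr_ge0 ?ler0n // mulrC.
  apply: seg_bound; first by apply: sc => u; exact: contB.
  move=> t t01; have := H k t kn; rewrite (_ : z + rc ((k%:R + t) / n.+1%:R) * (w - z) = cpath (v k) (v k.+1) t).
    by apply; lra.
  by rewrite /cpath dv /v mulrDl rcD rcM; ring.
have -> : F w - F z - (w - z) * (n.+1%:R^-1 * \sum_(k < n.+1) f (v k)) =
  \sum_(k < n.+1) (F (v k.+1) - F (v k) - (w - z) * (n.+1%:R^-1 * f (v k))).
  rewrite sumrB -mulr_sumr -mulr_sumr; congr (_ - _).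
  by rewrite -(big_mkord xpredT (fun k => F (v k.+1) - F (v k))) telescope_sumr // vn v0.
apply: le_trans (_ : \sum_(k < n.+1) cabs (F (v k.+1) - F (v k) - (w - z) * (n.+1%:R^-1 * f (v k))) <= _).
  elim/big_ind2: _ => [|x1 y1 x2 y2 h1 h2|//]; first by rewrite cabs0.
  by apply: le_trans (cabsD _ _) _; exact: lerD.
apply: le_trans (_ : \sum_(k < n.+1) 2 * e * (cabs (w - z) / N) <= _).
  by apply: ler_sum => k _; exact: step.
by rewrite sumr_const card_ord -mulr_natl -/N le_eqVlt; apply/orP; left; apply/eqP; field.
Qed.

(** The difference quotient of [F] is the mean of [f] over the segment from [z] to [u]. Its Riemann
    sums are entire in [u], hence have integral 0, and they converge uniformly on the contour.
    Goursat's theorem with an exceptional point is thereby avoided. *)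
Lemma quotient_sq F f c z : (forall u, cdiff F u (f u)) -> ent f -> cabs (z - c) <= 1 / 4 ->
  sq (fun u => (F u - F z) * (u - z)^-1 ^+ 1) c = 0.
Proof.
move=> dF ef zc; have fc := ent_continuous ef.
have Fc u : cont_at F u by exact: cdiff_continuous (dF u).
have kc : sq_cont (fun u => (F u - F z) * (u - z)^-1 ^+ 1) c.
  by apply: (@kern_cont (fun u => F u - F z) c z 1) => // u; exact: contB (Fc u) (cont_cst _ _).
apply/eqP; rewrite -cabs_eq0 eq_le cabs_ge0 andbT.
(* 32 is 16 from [sq_bound] times 2 from [riemann_sum]. The radius 3 used next exceeds 2 + 1/4, a
   bound for the distance from [z] to the contour. *)
apply/ler_addgt0Pl => e0 e00; rewrite addr0; pose e := e0 / 32; have ep : 0 < e by rewrite /e; lra.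
have [d d0 Hd] := @uniform_continuity f z 3 e fc ep.
pose n := Num.truncn (3 / d); pose N : R := n.+1%:R.
have N0 : 0 < N by rewrite ltr0n.
have nd : 3 / N < d by rewrite ltr_pdivrMr // mulrC -ltr_pdivrMr //; exact: truncnS_gt.
pose S u := n.+1%:R^-1 * \sum_(k < n.+1) f (z + rc (k%:R / N) * (u - z)).
have eS : ent S.
  apply: entM; first exact: ent_cst.
  have -> : (fun u => \sum_(k < n.+1) f (z + rc (k%:R / N) * (u - z))) =
     \sum_(k < n.+1) (fun u => f (z + rc (k%:R / N) * (u - z))) by apply/funext => u; rewrite fct_sumE.
  elim/big_ind: _ => [|g1 g2|k _]; [exact: ent_cst|exact: entD|].
  apply: ent_comp => //; apply: entD; first exact: ent_cst.
  by apply: entM; [exact: ent_cst|apply: entB; [exact: ent_id|exact: ent_cst]].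
have Sc : sq_cont S c by move=> k; exact/continuous_seg_cont/ent_continuous.
rewrite -[sq _ c]subr0 -(sq_ent c eS) -sqB //.
have -> : e0 = 16 * (2 * e) by rewrite /e; field.
apply: sq_bound; first by move=> k t; exact: contB (kc k t) (Sc k t).
move=> k t t01; set u := cpath _ _ _.
have uz0 : u - z != 0 by exact: contour_neq.
have uz : cabs (u - z) <= 3.
  apply: le_trans (cabs_tri c _ _) _; rewrite (cabsB c).
  have -> : u - c = I ^+ k * edge t by rewrite /u cpath_vtx addrC addKr.
  by rewrite cabsM cabs_Ik mul1r; have := edge_le t01; lra.
rewrite -(ler_pM2r (_ : 0 < cabs (u - z))) ?cabs_gt0 // -cabsM.
have -> : ((F u - F z) * (u - z)^-1 ^+ 1 - S u) * (u - z) = F u - F z - (u - z) * S u.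
  by field.
apply: riemann_sum => //; first exact: ltW.
move=> j s jn s01; apply/ltW/Hd.
  rewrite (_ : _ - z = rc (j%:R / n.+1%:R) * (u - z)); last by ring.
  rewrite cabsM cabs_rc ger0_norm ?divr_ge0 ?ler0n //.
  rewrite -[3]mul1r; apply: ler_pM; rewrite ?cabs_ge0 ?divr_ge0 ?ler0n //.
  by rewrite ler_pdivrMr ?ltr0n // mul1r ler_nat ltnW.
have -> : z + rc ((j%:R + s) / n.+1%:R) * (u - z) - (z + rc (j%:R / n.+1%:R) * (u - z)) =
   rc (s / N) * (u - z) by rewrite mulrDl rcD; ring.
rewrite cabsM cabs_rc ger0_norm ?divr_ge0 ?ler0n //; last by lra.
apply: le_lt_trans nd; rewrite mulrAC; apply: ler_wpM2r; first by rewrite invr_ge0 ltW.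
by rewrite -[3]mul1r; apply: ler_pM; rewrite ?cabs_ge0 //; lra.
Qed.

End Cauchy.

(** * Cauchy's formula, higher derivatives and division by linear factors *)

Section Taylor.
Variable R : realType.
Local Notation C := R[i].
Implicit Types (z w u h : C) (a b c d : C) (x y e t r : R) (f g F : C -> C).

Lemma cdiff_local f g z d r : 0 < r -> (forall w, cabs (w - z) < r -> f w = g w) ->
  cdiff f z d -> cdiff g z d.
Proof.
move=> r0 fg df e e0; have [s s0 Hs] := df e e0.
exists (Num.min r s); first by rewrite lt_min r0 s0.
move=> h; rewrite lt_min => /andP[hr hs].
rewrite -!fg ?subrr ?cabs0 //; first exact: Hs.
by have -> : z + h - z = h by ring.
Qed.

(** The derivative of [F] is assumed entire because [quotient_sq] averages it. To reach an arbitrary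
    entire function, the formula is applied to a primitive. *)
Lemma cauchy_formula F f c z : (forall u, cdiff F u (f u)) -> ent f -> cabs (z - c) < 1 / 4 ->
  F z = (sq (kern (fun=> 1) c 1) c)^-1 * sq (kern F z 1) c.
Proof.
move=> dF ef zc; have k0 := winding_neq0 c; have zc' := ltW zc.
have c1 (u : C) : cont_at (fun=> 1 : C) u by exact: cont_cst.
have Fc u : cont_at F u by exact: cdiff_continuous (dF u).
apply: (mulfI k0); rewrite mulrA mulfV // mul1r -(winding_const zc).
have := quotient_sq dF ef zc'.
rewrite (@sq_ext _ _ (fun u => kern F z 1 u - F z * kern (fun=> 1) z 1 u)); last first.
  by move=> k t; rewrite /kern; ring.
rewrite sqB; [|exact: kern_cont|by move=> k; exact: seg_contZ (kern_cont _ c1 zc' k)].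
rewrite sqZ; last exact: kern_cont.
by move/eqP; rewrite subr_eq0 => /eqP->; rewrite mulrC.
Qed.

(** Cauchy's formula for a primitive of [f] is differentiated three times under the integral sign.
    The first two derivatives are [f] and [cder f], so the third is the one sought. *)
Lemma ent_cder f : ent f -> ent (cder f).
Proof.
move=> ef c; have [F dF] := ent_primitive ef.
set k := (sq (kern (fun=> 1) c 1) c)^-1.
have Fc u : cont_at F u by exact: cdiff_continuous (dF u).
have sub z w : cabs (z - c) < 1 / 4 -> cabs (w - z) < 1 / 4 - cabs (z - c) -> cabs (w - c) < 1 / 4.
  by have := cabs_tri z w c; lra.
have E0 z : cabs (z - c) < 1 / 4 -> F z = k * sq (kern F z 1) c by exact: cauchy_formula.
have E1 z : cabs (z - c) < 1 / 4 -> f z = k * sq (kern F z 2) c.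
  move=> zc; apply: (cdiff_uniq (dF z)).
  have := cdiffZ k (kern_diff 1 Fc zc); rewrite mul1r.
  apply: (cdiff_local (r := 1 / 4 - cabs (z - c))); first by lra.
  by move=> w wz; rewrite -E0 //; exact: sub wz.
have E2 z : cabs (z - c) < 1 / 4 -> cder f z = k * (2 * sq (kern F z 3) c).
  move=> zc; apply: cder_eq; have := cdiffZ k (kern_diff 2 Fc zc).
  apply: (cdiff_local (r := 1 / 4 - cabs (z - c))); first by lra.
  by move=> w wz; rewrite -E1 //; exact: sub wz.
have cc : cabs (c - c) < 1 / 4 by rewrite subrr cabs0.
exists (k * (2 * (3 * sq (kern F c 4) c))).
have r4 : (0 : R) < 1 / 4 by [].
apply: (cdiff_local r4 _ (cdiffZ k (cdiffZ 2 (kern_diff 3 Fc cc)))) => w wc.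
by rewrite -E2.
Qed.

Lemma taylor2 f z e : ent f -> 0 < e -> exists2 r : R, 0 < r & forall h, cabs h < r ->
  cabs (f (z + h) - f z - cder f z * h - cder (cder f) z / 2 * h ^+ 2) <= e * cabs h ^+ 2.
Proof.
move=> ef e0; have e2 : 0 < e / 2 by lra.
have ef1 := ent_cder ef.
have [r r0 Hr] := cderP z ef1 e2; exists r => // h hr.
set d := cder f z in Hr *; set d2 := cder (cder f) z in Hr *.
have sc g a b : ent g -> seg_cont g a b by move=> /ent_continuous; exact: continuous_seg_cont.
have eA : ent (fun w => d + d2 * (w - z)).
  by apply: entD; [exact: ent_cst|apply: entM; [exact: ent_cst|apply: entB; [exact: ent_id|exact: ent_cst]]].
have E : seg (fun w => d + d2 * (w - z)) z (z + h) = d * h + d2 / 2 * h ^+ 2.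
  rewrite (@seg_primitive _ (fun w => d * w + d2 * ((w - z) * (w - z)) / 2)); [|exact: sc|].
    by field.
  move=> t _; set w := cpath _ _ _.
  have hw : cdiff (fun v => v - z) w 1.
    by have := cdiffB (cdiff_id w) (cdiff_cst z w); rewrite subr0.
  have := cdiffD (cdiffZ d (cdiff_id w)) (cdiffM (cdiffZ d2 (cdiffM hw hw)) (cdiff_cst 2^-1 w)).
  by rewrite (_ : _ + _ = d + d2 * (w - z)) //; field.
rewrite -addrA -opprD -E -(@seg_primitive _ f (cder f)); [|exact: sc|by move=> t _; exact: cderP].
rewrite -segB; [|exact: sc|exact: sc].
have zh : z + h - z = h by ring.
have -> : e * cabs h ^+ 2 = 2 * (e / 2 * cabs h) * cabs (z + h - z) by rewrite zh; field.
apply: seg_bound; first by apply: sc; exact: entB.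
move=> t t01; have t01' : 0 <= t <= 1 by lra.
set w := cpath _ _ _; have wz : cabs (w - z) <= cabs h by have := cpath_dist z (z + h) t01'; rewrite zh.
have := Hr (w - z) (le_lt_trans wz hr); rewrite (_ : z + (w - z) = w); last by ring.
rewrite opprD addrA => H; apply: le_trans H _; apply: ler_wpM2l wz; exact: ltW.
Qed.

(** A removable singularity: at [z] the quotient has derivative f''(z) / 2 by [taylor2], elsewhere
    the product rule applies. All later divisions by powers of w - z rest on this. *)
Lemma quo_ent f z : ent f -> ent (quo f z (cder f z)).
Proof.
move=> ef w; have [->|wz] := eqVneq w z.
  exists (cder (cder f) z / 2) => e e0; have [r r0 Hr] := taylor2 z ef e0.
  exists r => // h hr; have [->|h0] := eqVneq h 0.
    by rewrite addr0 subrr mulr0 subr0 cabs0 mulr0.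
  have h0' : 0 < cabs h by rewrite cabs_gt0.
  rewrite quo_id /quo; case: eqVneq => [/eqP|_].
    by rewrite -subr_eq0 (_ : z + h - z = h) ?(negbTE h0) //; ring.
  have -> : z + h - z = h by ring.
  rewrite -(ler_pM2r h0') -cabsM.
  have -> : ((f (z + h) - f z) / h - cder f z - cder (cder f) z / 2 * h) * h =
    f (z + h) - f z - cder f z * h - cder (cder f) z / 2 * h ^+ 2 by field.
  by apply: le_trans (Hr h hr) _; rewrite expr2 mulrA.
have wz0 : w - z != 0 by rewrite subr_eq0.
have dB : cdiff (fun v => v - z) w 1.
  by have := cdiffB (cdiff_id w) (cdiff_cst z w); rewrite subr0.
have dN : cdiff (fun v => f v - f z) w (cder f w).
  by have := cdiffB (cderP w ef) (cdiff_cst (f z) w); rewrite subr0.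
have := cdiffM dN (cdiff_comp dB (cdiffV wz0)); set d := _ + _ => H; exists d.
move: H; apply: (cdiff_local (r := cabs (w - z))); first by rewrite cabs_gt0.
move=> v vw; rewrite /quo; case: eqVneq => // vz.
by move: vw; rewrite vz cabsB ltxx.
Qed.

Lemma ent_factor f z : ent f -> exists2 q, ent q & forall w, f w = f z + (w - z) * q w.
Proof.
by move=> ef; exists (quo f z (cder f z)); [exact: quo_ent|move=> w; exact: quo_factor].
Qed.

End Taylor.

(** * Laplacians and the minimum principle *)

Section Jets.
Variable R : realType.
Local Notation C := R[i].
Local Notation I := ('i%C : C).
Implicit Types (z w u h : C) (a b c d e t x y N : R) (p q F G : R -> R) (f g : C -> C) (v : C -> R).

(* [c] is half the second derivative at [0]. *)
Definition peano2 p a b c := forall e, 0 < e -> exists2 d : R, 0 < d &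
  forall t, `|t| < d -> `|p t - (a + b * t + c * t ^+ 2)| <= e * t ^+ 2.

Lemma peano2_local p q a b c d : 0 < d -> (forall t, `|t| < d -> p t = q t) ->
  peano2 p a b c -> peano2 q a b c.
Proof.
move=> d0 pq H e e0; have [d' d'0 Hd] := H e e0; exists (Num.min d d').
  by rewrite lt_min d0.
by move=> t; rewrite lt_min => /andP[t1 t2]; rewrite -pq //; exact: Hd.
Qed.

Lemma peano2D p q a b c a' b' c' : peano2 p a b c -> peano2 q a' b' c' ->
  peano2 (fun t => p t + q t) (a + a') (b + b') (c + c').
Proof.
move=> H H' e e0; have e2 : 0 < e / 2 by lra.
have [d d0 Hd] := H _ e2; have [d' d'0 Hd'] := H' _ e2; exists (Num.min d d').
  by rewrite lt_min d0.
move=> t; rewrite lt_min => /andP[/Hd t1 /Hd' t2].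
rewrite (_ : _ - _ = (p t - (a + b * t + c * t ^+ 2)) + (q t - (a' + b' * t + c' * t ^+ 2))); last by ring.
by apply: le_trans (ler_normD _ _) _; lra.
Qed.

Lemma peano2Z k p a b c : peano2 p a b c -> peano2 (fun t => k * p t) (k * a) (k * b) (k * c).
Proof.
move=> H e e0; have k0 : 0 < `|k| + 1 by have := normr_ge0 k; lra.
have [d d0 Hd] := H _ (divr_gt0 e0 k0); exists d => // t /Hd t1.
rewrite (_ : _ - _ = k * (p t - (a + b * t + c * t ^+ 2))); last by ring.
rewrite normrM; apply: le_trans (ler_wpM2l (normr_ge0 k) t1) _.
rewrite mulrA; apply: ler_wpM2r; first exact: sqr_ge0.
by rewrite mulrCA ler_piMr ?(ltW e0) // ler_pdivrMr //; lra.
Qed.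

Lemma peano2_affine a b : peano2 (fun t => a + b * t) a b 0.
Proof.
by move=> e e0; exists 1 => // t _; rewrite mul0r addr0 subrr normr0 mulr_ge0 ?sqr_ge0 // ltW.
Qed.

Lemma peano2_comp F p N b c (F0 F1 F2 : R) : peano2 (fun s => F (N + s)) F0 F1 F2 -> peano2 p N b c ->
  peano2 (fun t => F (p t)) F0 (F1 * b) (F1 * c + F2 * b ^+ 2).
Proof.
move=> HF Hp e e0.
pose K := `|c| + 1; have K1 : 1 <= K by rewrite /K; have := normr_ge0 c; lra.
pose B := `|b| + K; have B1 : 1 <= B by rewrite /B; have := normr_ge0 b; lra.
have B20 : 0 < 3 * B ^+ 2 by rewrite mulr_gt0 // exprn_gt0 //; lra.
have [d1 d10 H1] := HF _ (divr_gt0 e0 B20).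
have F10 : 0 < 3 * (`|F1| + 1) by have := normr_ge0 F1; lra.
have m0 : 0 < Num.min 1 (e / (3 * (`|F1| + 1))) by rewrite lt_min ltr01 divr_gt0.
have [d2 d20 H2] := Hp _ m0.
have D0 : 0 < 3 * (`|F2| * (K * (2 * `|b| + K)) + 1).
  have : 0 <= `|F2| * (K * (2 * `|b| + K)).
    by rewrite mulr_ge0 // mulr_ge0; have := normr_ge0 b; lra.
  lra.
pose d := Num.min (Num.min 1 d2) (Num.min (d1 / B) (e / (3 * (`|F2| * (K * (2 * `|b| + K)) + 1)))).
exists d; first by rewrite !lt_min ltr01 d20 !divr_gt0 //; lra.
move=> t; rewrite !lt_min => /andP[/andP[t1 t2] /andP[t3 t4]].
have t20 := sqr_ge0 t.
have tt : t ^+ 2 = `|t| * `|t| by rewrite -normrM -expr2 ger0_norm.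
have tle : t ^+ 2 <= `|t| by rewrite tt; have := normr_ge0 t; nra.
have := H2 t t2; set rho := p t - _ => Hr.
have Hr1 : `|rho| <= t ^+ 2.
  by apply: le_trans Hr _; apply: ler_piMl => //; rewrite ge_min lexx.
have Hr2 : `|rho| <= e / (3 * (`|F1| + 1)) * t ^+ 2.
  by apply: le_trans Hr _; apply: ler_wpM2r => //; rewrite ge_min lexx orbT.
pose k := c * t ^+ 2 + rho; pose s := b * t + k.
have kK : `|k| <= K * t ^+ 2.
  apply: le_trans (ler_normD _ _) _; rewrite normrM (ger0_norm t20) /K; lra.
have sB : `|s| <= B * `|t|.
  apply: le_trans (ler_normD _ _) _; rewrite normrM /B mulrDl lerD2l.
  apply: le_trans kK _; apply: ler_wpM2l tle; lra.
have ps : p t = N + s by rewrite /s /k /rho; ring.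
have sd : `|s| < d1.
  apply: le_lt_trans sB _; rewrite mulrC -ltr_pdivlMr //; lra.
have := H1 s sd; rewrite -ps => H3.
(* Three errors, each at most e / 3 * t ^ 2: the remainder of [F], the remainder of [p] times [F1],
   and what s ^ 2 has beyond (b * t) ^ 2. The bounds in [d] are made for these. *)
have E : F (p t) - (F0 + F1 * b * t + (F1 * c + F2 * b ^+ 2) * t ^+ 2) =
  (F (p t) - (F0 + F1 * s + F2 * s ^+ 2)) + F1 * rho + F2 * (k * (2 * b * t + k)).
  by rewrite /s /k; ring.
rewrite E.
have p1 : `|F (p t) - (F0 + F1 * s + F2 * s ^+ 2)| <= e / 3 * t ^+ 2.
  apply: le_trans H3 _; have -> : s ^+ 2 = `|s| ^+ 2 by rewrite real_normK ?num_real.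
  have s2 : `|s| ^+ 2 <= B ^+ 2 * t ^+ 2.
    rewrite tt -expr2 -exprMn; apply: lerXn2r => //; rewrite nnegrE // mulr_ge0 //; lra.
  apply: le_trans (ler_wpM2l (ltW (divr_gt0 e0 B20)) s2) _.
  rewrite mulrA le_eqVlt; apply/orP; left; apply/eqP; congr (_ * _); field.
  by rewrite gt_eqF //; lra.
have p2 : `|F1 * rho| <= e / 3 * t ^+ 2.
  rewrite normrM; apply: le_trans (ler_wpM2l (normr_ge0 _) Hr2) _.
  rewrite mulrA; apply: ler_wpM2r => //.
  rewrite mulrA ler_pdivrMr //; have -> : e / 3 * (3 * (`|F1| + 1)) = e * `|F1| + e by field.
  by rewrite mulrC; lra.
have p3 : `|F2 * (k * (2 * b * t + k))| <= e / 3 * t ^+ 2.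
  have h1 : `|2 * b * t + k| <= (2 * `|b| + K) * `|t|.
    apply: le_trans (ler_normD _ _) _; have -> : `|2 * b * t| = 2 * `|b| * `|t| by rewrite !normrM ger0_norm.
    rewrite (mulrDl (2 * `|b|)) lerD2l.
    by apply: le_trans kK _; apply: ler_wpM2l tle; lra.
  have h2 : `|k * (2 * b * t + k)| <= K * t ^+ 2 * ((2 * `|b| + K) * `|t|).
    by rewrite normrM; apply: ler_pM.
  rewrite normrM; apply: le_trans (ler_wpM2l (normr_ge0 _) h2) _.
  have -> : `|F2| * (K * t ^+ 2 * ((2 * `|b| + K) * `|t|)) =
    (`|F2| * (K * (2 * `|b| + K)) * `|t|) * t ^+ 2 by ring.
  apply: ler_wpM2r => //; move: t4; rewrite ltr_pdivlMr //; have := normr_ge0 t; lra.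
apply: le_trans (ler_normD _ _) _; apply: le_trans (lerD (ler_normD _ _) (lexx _)) _; lra.
Qed.

Lemma peano2_deriv F G x l d : 0 < d ->
  (forall y, `|y - x| < d -> is_derive (y : R^o) (1 : R^o) F (G y)) ->
  is_derive (x : R^o) (1 : R^o) G l -> peano2 (fun s => F (x + s)) (F x) (G x) (l / 2).
Proof.
move=> d0 dF dG e e0; have [d' d'0 Hd] := is_derive_lim dG e0.
exists (Num.min d d'); first by rewrite lt_min d0.
move=> t; rewrite lt_min => /andP[td td'].
have [->|t0] := eqVneq t 0.
  by rewrite addr0 expr0n /= !mulr0 !addr0 subrr normr0.
(* The derivative of the second order remainder [D] of [F] is the first order remainder of [G], so
   the mean value theorem bounds [D]. *)
pose D s := F (x + s) - (F x + G x * s + l / 2 * s ^+ 2).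
have dD s : `|s| < d -> is_derive (s : R^o) (1 : R^o) D (G (x + s) - G x - l * s).
  move=> sd; apply: is_derive_eps => k k0; have k2 : 0 < k / 2 by lra.
  have xs : `|x + s - x| < d by rewrite addrAC subrr add0r.
  have [r r0 Hr] := is_derive_lim (dF _ xs) k2.
  have l0 : 0 < `|l| + 1 by have := normr_ge0 l; lra.
  exists (Num.min r (k / (`|l| + 1))); first by rewrite lt_min r0 divr_gt0.
  move=> y; rewrite lt_min ltr_pdivlMr // => /andP[/Hr h1 h2].
  rewrite /D (_ : _ - _ * y = (F (x + s + y) - F (x + s) - G (x + s) * y) - l / 2 * (y * y)); last by rewrite addrA; field.
  apply: le_trans (ler_normB _ _) _; have -> : k * `|y| = k / 2 * `|y| + k / 2 * `|y| by field.
  apply: lerD => //; rewrite !normrM mulrA; apply: ler_wpM2r => //.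
  rewrite (ger0_norm (_ : 0 <= 2^-1)) //; have := normr_ge0 y; lra.
have D0 : D 0 = 0 by rewrite /D !addr0; ring.
have key s1 s2 : s1 < s2 -> `|s1| <= `|t| -> `|s2| <= `|t| -> `|D s2 - D s1| <= e * `|t| * (s2 - s1).
  move=> s12 h1 h2.
  have [||c] := @MVT R D (fun s => G (x + s) - G x - l * s) s1 s2 s12.
  - move=> s; rewrite in_itv /= => /andP[a1 a2]; apply: dD; apply: le_lt_trans td.
    by move: h1 h2; rewrite !ler_norml; lra.
  - apply: continuous_in_subspaceT => s /set_mem /=; rewrite in_itv /= => /andP[a1 a2].
    apply: is_derive_cont; apply: dD; apply: le_lt_trans td.
    by move: h1 h2; rewrite !ler_norml; lra.
  rewrite in_itv /= => /andP[a1 a2] ->; rewrite normrM (gtr0_norm (_ : 0 < s2 - s1)) ?subr_gt0 //.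
  apply: ler_wpM2r; first by lra.
  have ct : `|c| <= `|t| by move: h1 h2; rewrite !ler_norml; lra.
  apply: le_trans (Hd c (le_lt_trans ct td')) _; apply: ler_wpM2l ct; exact: ltW.
have -> : e * t ^+ 2 = e * `|t| * `|t| by rewrite -mulrA -expr2 real_normK ?num_real.
rewrite -/(D t); have [tp|tn|t00] := ltgtP t 0; last by rewrite t00 eqxx in t0.
  have := key t 0 tp (lexx _); rewrite normr0 => /(_ (normr_ge0 _)); rewrite D0 !sub0r normrN (ltr0_norm tp).
  exact.
have := key 0 t tn; rewrite normr0 => /(_ (normr_ge0 _) (lexx _)); rewrite D0 !subr0 (gtr0_norm tn); exact.
Qed.

Lemma peano2_ln x : 0 < x -> peano2 (fun s => ln (x + s)) (ln x) x^-1 (- (x ^- 2) / 2).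
Proof.
move=> x0; apply: (@peano2_deriv _ (fun y => y^-1) x _ x) => //.
  by move=> y; rewrite ltr_norml => /andP[y1 _]; apply: is_derive1_ln; lra.
have x0' : x != 0 by rewrite gt_eqF.
have := @is_deriveV R id x 1 1 x0' (is_derive_id _ _).
by rewrite -[_ *: _]/(_ * _) mulr1.
Qed.

Lemma peano2_sqrt x : 0 < x -> peano2 (fun s => Num.sqrt (x + s)) (Num.sqrt x)
  (2 * Num.sqrt x)^-1 (- (4 * Num.sqrt x ^+ 3)^-1 / 2).
Proof.
move=> x0; apply: (@peano2_deriv _ (fun y => (2 * Num.sqrt y)^-1) x _ x) => //.
  by move=> y; rewrite ltr_norml => /andP[y1 _]; apply: is_derive1_sqrt; lra.
have s0 : 0 < Num.sqrt x by rewrite sqrtr_gt0.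
have s0' : 2 * Num.sqrt x != 0 by rewrite gt_eqF //; lra.
have d1 : is_derive (x : R^o) (1 : R^o) (fun y => 2 * Num.sqrt y) (2 * (2 * Num.sqrt x)^-1).
  by apply: is_deriveZ; exact: is_derive1_sqrt.
have := @is_deriveV R (fun y => 2 * Num.sqrt y) x _ 1 s0' d1.
rewrite -[_ *: _]/(_ * _) (_ : _ * _ = - (4 * Num.sqrt x ^+ 3)^-1) //.
by field; rewrite gt_eqF.
Qed.

(** The lowest integer power of the positive part that has a second order expansion at 0 too. *)
Definition cube_pos x : R := Num.max 0 x ^+ 3.

Lemma peano2_cube_pos x : peano2 (fun s => cube_pos (x + s)) (cube_pos x)
  (3 * Num.max 0 x ^+ 2) (3 * Num.max 0 x).
Proof.
move=> e e0; rewrite /cube_pos; have [x0|x0|x0] := ltgtP x 0.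
- exists (- x); first lra.
  move=> t; rewrite ltr_norml => /andP[_ tx]; rewrite !max_l; try lra.
  by rewrite !expr0n /= !mulr0 !mul0r !addr0 subrr normr0 mulr_ge0 ?sqr_ge0 // ltW.
- exists (Num.min x e); first by rewrite lt_min x0.
  move=> t; rewrite lt_min => /andP[tx te]; have := tx; rewrite ltr_norml => /andP[t1 _].
  rewrite !max_r; try lra.
  rewrite (_ : _ - _ = t * t ^+ 2); last by ring.
  rewrite normrM (ger0_norm (sqr_ge0 t)); apply: ler_wpM2r; [exact: sqr_ge0|exact: ltW].
- exists e => // t te; rewrite x0 ?maxxx !expr0n /= !mulr0 !mul0r !addr0 subr0 add0r.
  rewrite exprS normrM (ger0_norm (sqr_ge0 _)); apply: ler_pM; rewrite ?sqr_ge0 //.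
    apply: le_trans (ltW te); rewrite ger0_norm ?le_max ?lexx // ge_max normr_ge0; exact: ler_norm.
  have [t0|t0] := leP t 0; first by rewrite expr0n sqr_ge0.
  exact: lexx.
Qed.

Lemma peano2_Re f z u : ent f -> cabs u = 1 ->
  peano2 (fun t => complex.Re (f (z + u * rc t))) (complex.Re (f z)) (complex.Re (cder f z * u))
    (complex.Re (cder (cder f) z / 2 * u ^+ 2)) /\
  peano2 (fun t => complex.Im (f (z + u * rc t))) (complex.Im (f z)) (complex.Im (cder f z * u))
    (complex.Im (cder (cder f) z / 2 * u ^+ 2)).
Proof.
move=> ef u1; have H e (e0 : 0 < e) : exists2 d : R, 0 < d & forall t, `|t| < d ->
   cabs (f (z + u * rc t) - (f z + cder f z * u * rc t + cder (cder f) z / 2 * u ^+ 2 * rc (t ^+ 2))) <= e * t ^+ 2.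
  have [d d0 Hd] := taylor2 z ef e0; exists d => // t td.
  have := Hd (u * rc t); rewrite cabsM u1 mul1r cabs_rc real_normK ?num_real // => /(_ td).
  by apply: le_trans; rewrite le_eqVlt; apply/orP; left; apply/eqP; congr cabs; rewrite rcX; ring.
have ReZ (c : C) (t : R) : complex.Re (c * rc t) = complex.Re c * t by rewrite cReM /= mulr0 subr0.
have ImZ (c : C) (t : R) : complex.Im (c * rc t) = complex.Im c * t by rewrite cImM /= mulr0 add0r.
split=> e e0; have [d d0 Hd] := H e e0; exists d => // t /Hd; apply: le_trans.
  by apply: le_trans (Re_le_cabs _); rewrite cReB !cReD !ReZ.
by apply: le_trans (Im_le_cabs _); rewrite cImB !cImD !ImZ.
Qed.

Lemma peano2_sqr p a b c : peano2 p a b c -> peano2 (fun t => p t ^+ 2) (a ^+ 2) (2 * a * b) (2 * a * c + b ^+ 2).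
Proof.
move=> H; rewrite -[b ^+ 2]mul1r; apply: (@peano2_comp (fun x => x ^+ 2)) H => e e0.
exists 1 => // t _ /=; rewrite (_ : _ - _ = 0); last by ring.
by rewrite normr0 mulr_ge0 ?sqr_ge0 // ltW.
Qed.

(* [lap2 v z L]: [v] has second order expansions at [z] along both axes, and half its
   Laplacian there is [L]. *)
Definition lap2 v z L := exists b c b' c', [/\ peano2 (fun t => v (z + rc t)) (v z) b c,
  peano2 (fun t => v (z + I * rc t)) (v z) b' c' & L = c + c'].

(** The terms with f'' carry the factor u ^ 2, which is 1 in the first direction and -1 in the
    second, so they cancel. [F2] is half the second derivative of [F]. All potentials below are
    built from functions of this shape. *)
Lemma lap2_normsq F f z (F0 F1 F2 : R) : ent f -> peano2 (fun s => F (cabs (f z) ^+ 2 + s)) F0 F1 F2 ->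
  lap2 (fun w => F (cabs (f w) ^+ 2)) z (2 * cabs (cder f z) ^+ 2 * (F1 + 2 * F2 * cabs (f z) ^+ 2)).
Proof.
move=> ef HF.
have F00 : F0 = F (cabs (f z) ^+ 2).
  have H e : 0 < e -> `|F (cabs (f z) ^+ 2) - F0| <= e * 0.
    move=> e0; have [d d0 Hd] := HF e e0; have := Hd 0; rewrite normr0 => /(_ d0).
    by rewrite expr0n /= !mulr0 !addr0.
  by have := H 1 ltr01; rewrite mulr0 normr_le0 subr_eq0 => /eqP.
rewrite {}F00 in HF.
have N u : cabs u = 1 -> peano2 (fun t => cabs (f (z + u * rc t)) ^+ 2) (cabs (f z) ^+ 2)
   (2 * complex.Re (f z) * complex.Re (cder f z * u) + 2 * complex.Im (f z) * complex.Im (cder f z * u))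
   (2 * complex.Re (f z) * complex.Re (cder (cder f) z / 2 * u ^+ 2) + complex.Re (cder f z * u) ^+ 2 +
   (2 * complex.Im (f z) * complex.Im (cder (cder f) z / 2 * u ^+ 2) + complex.Im (cder f z * u) ^+ 2)).
  move=> u1; have [h1 h2] := peano2_Re z ef u1.
  have := peano2D (peano2_sqr h1) (peano2_sqr h2); rewrite sqr_cabs.
  apply: (peano2_local (d := 1)) => // t _; by rewrite sqr_cabs.
have H1 := peano2_comp HF (N 1 (cabs1 _)).
have H2 := peano2_comp HF (N I (cabs_i _)).
have E1 : (fun t => F (cabs (f (z + 1 * rc t)) ^+ 2)) = fun t => F (cabs (f (z + rc t)) ^+ 2).
  by apply/funext => t; rewrite mul1r.
rewrite E1 in H1.
do 4 eexists; split; [exact: H1|exact: H2|].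
rewrite !sqr_cabs; move: (cder (cder f) z / 2) (cder f z) (f z) => [a2 b2] [a1 b1] [a0 b0].
rewrite sqr_i expr1n !(cReM, cImM) /=; ring.
Qed.

Lemma lap2D v1 v2 z L1 L2 : lap2 v1 z L1 -> lap2 v2 z L2 -> lap2 (fun w => v1 w + v2 w) z (L1 + L2).
Proof.
move=> [b [c [b' [c' [h1 h2 ->]]]]] [d [e [d' [e' [k1 k2 ->]]]]].
do 4 eexists; split; [exact: peano2D h1 k1|exact: peano2D h2 k2|ring].
Qed.

Lemma lap2Z k v z L : lap2 v z L -> lap2 (fun w => k * v w) z (k * L).
Proof.
move=> [b [c [b' [c' [h1 h2 ->]]]]].
do 4 eexists; split; [exact: peano2Z h1|exact: peano2Z h2|ring].
Qed.

Lemma lap2_cst k z : lap2 (fun=> k) z 0.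
Proof.
have h : peano2 (fun=> k) k 0 0.
  by move=> e e0; exists 1 => // t _; rewrite !mul0r !addr0 subrr normr0 mulr_ge0 ?sqr_ge0 // ltW.
by exists 0, 0, 0, 0; split=> //; rewrite addr0.
Qed.

Lemma lap2_sum (J : Type) (s : seq J) (v : J -> C -> R) (L : J -> R) z :
  (forall j, lap2 (v j) z (L j)) -> lap2 (fun w => \sum_(j <- s) v j w) z (\sum_(j <- s) L j).
Proof.
move=> H; elim: s => [|j s IH].
  rewrite big_nil; have -> : (fun w => \sum_(j <- [::]) v j w) = fun=> 0 by apply/funext => w; rewrite big_nil.
  exact: lap2_cst.
rewrite big_cons; have -> : (fun w => \sum_(k <- j :: s) v k w) = fun w => v j w + \sum_(k <- s) v k w.
  by apply/funext => w; rewrite big_cons.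
exact: lap2D.
Qed.

Lemma lap2_local v1 v2 z L r : 0 < r -> (forall w, cabs (w - z) < r -> v1 w = v2 w) ->
  lap2 v1 z L -> lap2 v2 z L.
Proof.
move=> r0 H [b [c [b' [c' [h1 h2 ->]]]]]; exists b, c, b', c'.
rewrite -(H z) ?subrr ?cabs0 //; split => //.
  by apply: peano2_local r0 _ h1 => t tr; apply: H; rewrite addrC addKr cabs_rc.
by apply: peano2_local r0 _ h2 => t tr; apply: H; rewrite addrC addKr cabsM cabs_i mul1r cabs_rc.
Qed.

Lemma peano2_min p b c d : 0 < d -> peano2 p (p 0) b c -> (forall t, `|t| < d -> p 0 <= p t) -> 0 <= c.
Proof.
move=> d0 H pm; apply/ler_addgt0Pl => e e0.
have [r r0 Hr] := H e e0; pose t := Num.min d r / 2.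
have m0 : 0 < Num.min d r by rewrite lt_min d0.
have t0 : 0 < t by rewrite divr_gt0.
have : t < Num.min d r by rewrite /t; lra.
rewrite lt_min => /andP[td tr].
have t20 : 0 < t ^+ 2 by rewrite exprn_gt0.
have nt : `|t| = t by rewrite gtr0_norm.
have := Hr t; have := Hr (- t); have := pm t; have := pm (- t).
rewrite normrN nt => /(_ td) h1 /(_ td) h2 /(_ tr) h3 /(_ tr) h4.
rewrite -(pmulr_lge0 _ t20); move: h3 h4; rewrite sqrrN !ler_norml; lra.
Qed.

Lemma lap2_min v z L r : 0 < r -> lap2 v z L -> (forall w, cabs (w - z) < r -> v z <= v w) -> 0 <= L.
Proof.
move=> r0 [b [c [b' [c' [h1 h2 ->]]]]] vm; apply: addr_ge0.
  apply: (@peano2_min (fun t => v (z + rc t)) b c r) => //; rewrite rc0 addr0 //.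
  by move=> t tr; apply: vm; rewrite addrC addKr cabs_rc.
apply: (@peano2_min (fun t => v (z + I * rc t)) b' c' r) => //; rewrite rc0 mulr0 addr0 //.
by move=> t tr; apply: vm; rewrite addrC addKr cabsM cabs_i mul1r cabs_rc.
Qed.

End Jets.

(** * Minimum and maximum principles, isolated zeros, open mapping *)

Section Principles.
Variable R : realType.
Local Notation C := R[i].
Implicit Types (z w u h c : C) (e t r m M : R) (f g : C -> C) (v : C -> R) (K : set C).

Lemma cont_real_opp (T : topologicalType) (v : T -> R) (t : T) : cont_at v t -> cont_at (fun y => - v y) t.
Proof. by move=> [vc]; constructor; apply: cvgN; exact: vc. Qed.

Lemma cont_realD (T : topologicalType) (v1 v2 : T -> R) (t : T) : cont_at v1 t -> cont_at v2 t ->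
  cont_at (fun y => v1 y + v2 y) t.
Proof. by move=> [vc] [wc]; constructor; apply: cvgD; [exact: vc|exact: wc]. Qed.

Lemma cont_realM (T : topologicalType) (v1 v2 : T -> R) (t : T) : cont_at v1 t -> cont_at v2 t ->
  cont_at (fun y => v1 y * v2 y) t.
Proof. by move=> [vc] [wc]; constructor; apply: cvgM; [exact: vc|exact: wc]. Qed.

Lemma cont_realV (T : topologicalType) (v : T -> R) (t : T) : v t != 0 -> cont_at v t ->
  cont_at (fun y => (v y)^-1) t.
Proof. by move=> v0 [vc]; constructor; apply: cvgV; [exact: v0|exact: vc]. Qed.

Lemma cont_realX (T : topologicalType) (v : T -> R) n (t : T) : cont_at v t -> cont_at (fun y => v y ^+ n) t.
Proof.
move=> vc; elim: n => [|n IH]; first exact: cont_cst.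
have -> : (fun y => v y ^+ n.+1) = (fun y => v y * v y ^+ n) by apply/funext => y; rewrite exprS.
exact: cont_realM vc IH.
Qed.

Lemma cont_cabs (T : topologicalType) (f : T -> C) (t : T) : cont_at f t -> cont_at (fun y => cabs (f y)) t.
Proof. by move=> fc; exact: cont_comp fc (cabs_continuous _). Qed.

Lemma compact_min K v : K !=set0 -> compact K -> (forall z, K z -> cont_at v z) ->
  exists2 c, K c & forall z, K z -> v c <= v z.
Proof.
move=> K0 cK vc; have [c Kc cM] := compact_max K0 cK (fun z Kz => cont_real_opp (vc z Kz)).
by exists c => // z /cM; rewrite lerN2.
Qed.

Lemma lap2_normsq_id f z : ent f -> lap2 (fun w => cabs (f w) ^+ 2) z (2 * cabs (cder f z) ^+ 2).
Proof.
move=> ef.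
have E : (fun s : R => id (cabs (f z) ^+ 2 + s)) = fun s => cabs (f z) ^+ 2 + 1 * s.
  by apply/funext => s; rewrite mul1r.
have H : peano2 (fun s : R => id (cabs (f z) ^+ 2 + s)) (cabs (f z) ^+ 2) 1 0.
  by rewrite E; exact: peano2_affine.
have := @lap2_normsq R (fun y => y) f z _ _ _ ef H.
by rewrite mulr0 mul0r addr0 mulr1.
Qed.

(** At an interior minimum the half Laplacian is nonnegative; subtracting [e] times |w| ^ 2 makes it
    negative. On [K] this correction stays below the gap m - v z0 by the choice of [e]. Expansions
    at single points are enough, with no regularity in between. *)
Lemma lap_min_principle K v m : compact K -> (forall z, K z -> cont_at v z) ->
  (forall z, K z -> m <= v z \/
     exists2 r : R, 0 < r & disc z r `<=` K /\ exists2 L, lap2 v z L & L <= 0) ->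
  forall z, K z -> m <= v z.
Proof.
move=> cK vc H z0 Kz0; rewrite leNgt; apply/negP => vm.
have [T HT] := compact_cabs_bounded cK.
have T0 : 0 <= T by apply: le_trans (HT _ Kz0); exact: cabs_ge0.
pose e := (m - v z0) / (T ^+ 2 + 1).
have T1 : 0 < T ^+ 2 + 1 by have := sqr_ge0 T; lra.
have e0 : 0 < e by rewrite divr_gt0 //; lra.
have eT : e * (T ^+ 2 + 1) = m - v z0 by rewrite divfK // gt_eqF.
pose p w := v w + (- e) * cabs w ^+ 2.
have pc w : K w -> cont_at p w.
  move=> Kw; apply: cont_realD; first exact: vc.
  by apply: cont_realM; [exact: cont_cst|apply: cont_realX; exact: cabs_continuous].
have [c Kc cm] := compact_min (ex_intro _ z0 Kz0) cK pc.
have cT : cabs c ^+ 2 <= T ^+ 2 by apply: lerXn2r; rewrite ?nnegrE ?cabs_ge0 //; exact: HT.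
have pz : p z0 <= v z0 by rewrite /p; have := mulr_ge0 (ltW e0) (sqr_ge0 (cabs z0)); lra.
have [mc|[r r0 [Dr [L HL L0]]]] := H c Kc.
  have := cm _ Kz0; rewrite /p in pz *; have := ler_wpM2l (ltW e0) cT; lra.
have l1 := lap2D HL (lap2Z (- e) (lap2_normsq_id c (@ent_id R))).
have := lap2_min r0 l1 (fun w wr => cm w (Dr w wr)).
by rewrite (cder_eq (cdiff_id c)) cabs1 expr1n; lra.
Qed.

Lemma max_principle K f M : ent f -> compact K ->
  (forall z, K z -> cabs (f z) <= M \/ exists2 r : R, 0 < r & disc z r `<=` K) ->
  forall z, K z -> cabs (f z) <= M.
Proof.
move=> ef cK H.
have vc z : cont_at (fun w => -1 * cabs (f w) ^+ 2) z.
  by apply: cont_realM; [exact: cont_cst|apply/cont_realX/cont_cabs; exact: ent_continuous].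
pose M' := Num.max M 0.
have H1 z : K z -> cabs (f z) <= M'.
  move=> Kz; suff : - M' ^+ 2 <= -1 * cabs (f z) ^+ 2.
    rewrite mulN1r lerN2 ler_pXn2r // nnegrE ?cabs_ge0 // /M' le_max lexx orbT //.
  apply: (lap_min_principle cK (fun w _ => vc w)) Kz => w Kw.
  have [fM|[r r0 Dr]] := H w Kw; [left|right].
    rewrite mulN1r lerN2; apply: lerXn2r; rewrite ?nnegrE ?cabs_ge0 // /M' le_max ?lexx ?orbT // fM //.
  exists r => //; split=> //; exists (-1 * (2 * cabs (cder f w) ^+ 2)).
    by apply: lap2Z; exact: lap2_normsq_id.
  by have := sqr_ge0 (cabs (cder f w)); lra.
have [M0|M0] := leP 0 M; first by move=> z /H1; rewrite /M' max_l.
(* for negative [M] every point of [K] would be interior *)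
move=> z Kz; exfalso.
have cabsz0 w : K w -> exists2 r : R, 0 < r & disc w r `<=` K.
  by move=> /H[|//]; have := cabs_ge0 (f w); lra.
have [c Kc cM] := compact_max (ex_intro _ z Kz) cK (fun w _ => @cRe_continuous R w).
have [r r0 Dr] := cabsz0 c Kc.
have := cM (c + rc (r / 2)); rewrite cReD /= => H2.
suff : complex.Re c + r / 2 <= complex.Re c by lra.
apply: H2; apply: Dr; rewrite /disc /= addrC addKr cabs_rc ger0_norm; lra.
Qed.

(** Where [f] has no zero, ln |f| ^ 2 is harmonic. *)
Lemma min_principle K f m : ent f -> compact K -> 0 < m -> (forall z, K z -> f z != 0) ->
  (forall z, K z -> m <= cabs (f z) \/ exists2 r : R, 0 < r & disc z r `<=` K) ->
  forall z, K z -> m <= cabs (f z).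
Proof.
move=> ef cK m0 f0 H z Kz.
have N0 w : K w -> 0 < cabs (f w) ^+ 2 by move=> Kw; rewrite exprn_gt0 // cabs_gt0 f0.
have m2 : 0 < m ^+ 2 by rewrite exprn_gt0.
have m2N w : K w -> (ln (m ^+ 2) <= ln (cabs (f w) ^+ 2)) = (m <= cabs (f w)).
  move=> Kw; rewrite ler_ln ?posrE ?N0 //.
  by rewrite ler_pXn2r // nnegrE ?cabs_ge0 // ltW.
rewrite -m2N //; apply: (@lap_min_principle K (fun u => ln (cabs (f u) ^+ 2)) _ cK _ _ z Kz) => w Kw.
  apply: (@cont_comp _ _ _ (fun u => cabs (f u) ^+ 2) (@ln R)).
    by apply/cont_realX/cont_cabs; exact: ent_continuous.
  by constructor; apply: continuous_ln; exact: N0.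
have [fM|[r r0 Dr]] := H w Kw; [left; rewrite m2N //|right].
exists r => //; split=> //; exists 0 => //.
have := lap2_normsq ef (peano2_ln (N0 w Kw)).
have -> // : 2 * cabs (cder f w) ^+ 2 * ((cabs (f w) ^+ 2)^-1 + 2 * (- (cabs (f w) ^+ 2) ^- 2 / 2) * cabs (f w) ^+ 2) = 0.
by field; rewrite cabs_eq0 f0.
Qed.

Lemma cdisc_interior z r w : cabs (w - z) < r -> exists2 s : R, 0 < s & disc w s `<=` cdisc z r.
Proof.
move=> wr; exists (r - cabs (w - z)); first by rewrite subr_gt0.
by move=> u; rewrite /disc /cdisc /=; have := cabs_tri w u z; lra.
Qed.

Lemma max_disc f z r M : ent f -> (forall w, cabs (w - z) = r -> cabs (f w) <= M) ->
  forall w, cabs (w - z) <= r -> cabs (f w) <= M.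
Proof.
move=> ef H w wr; apply: (max_principle ef (@compact_cdisc R z r)) wr => u.
rewrite /cdisc /= le_eqVlt => /orP[/eqP/H|ur]; [by left|right; exact: cdisc_interior].
Qed.

Lemma ent_pow_factor f z : ent f ->
  (exists (m : nat) q, [/\ ent q, forall w, f w = (w - z) ^+ m * q w & q z != 0]) \/
  (forall m : nat, exists2 q, ent q & forall w, f w = (w - z) ^+ m * q w).
Proof.
move=> ef; have [H|H] := pselect (exists (m : nat) q, [/\ ent q, forall w, f w = (w - z) ^+ m * q w & q z != 0]).
  by left.
right; elim=> [|m [q eq fq]]; first by exists f => // w; rewrite expr0 mul1r.
have [p ep qp] := ent_factor z eq; exists p => // w.
have q0 : q z = 0 by apply: contrapT => /eqP qz; apply: H; exists m, q.
by rewrite fq qp q0 add0r exprSr mulrA.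
Qed.

(** A zero of infinite order is excluded without power series: f / (w - z) ^ m is entire for every
    [m], and the maximum principle on a radius at least 2 |w0 - z| gives |f w0| * 2 ^ m <= B. *)
Lemma isolated_zero f z : ent f -> (exists w, f w != 0) ->
  exists2 r : R, 0 < r & forall w, w != z -> cabs (w - z) < r -> f w != 0.
Proof.
move=> ef [w0 fw0]; have [[m [q [eq fq qz]]]|H] := ent_pow_factor z ef.
  have /continuous_CP /(_ (cabs (q z))) := ent_continuous eq z.
  rewrite cabs_gt0 => /(_ qz)[r r0 Hr]; exists r => // w wz /Hr h.
  rewrite fq mulf_neq0 ?expf_neq0 ?subr_eq0 //.
  by apply: contraTneq h => ->; rewrite sub0r cabsN ltxx.
pose r := 2 * cabs (w0 - z) + 1; have r0 : 0 < r by rewrite /r; have := cabs_ge0 (w0 - z); lra.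
have [B HB] : exists B, forall w, cabs (w - z) <= r -> cabs (f w) <= B.
  have [||u _ Hu] := @compact_max R (cdisc z r) (fun w => cabs (f w)) _ (@compact_cdisc R z r).
  - by exists z; rewrite /cdisc /= subrr cabs0 ltW.
  - by move=> w _; apply: cont_cabs; exact: ent_continuous.
  - by exists (cabs (f u)).
have bound (m : nat) : cabs (f w0) * 2 ^+ m <= B.
  have [q eq fq] := H m.
  have w0r : cabs (w0 - z) <= r by rewrite /r; have := cabs_ge0 (w0 - z); lra.
  have rm : 0 < r ^+ m by rewrite exprn_gt0.
  have := @max_disc q z r (B / r ^+ m) eq _ w0 w0r.
  have h w : cabs (w - z) = r -> cabs (q w) <= B / r ^+ m.
    move=> wr; rewrite ler_pdivlMr //; have := HB w; rewrite wr lexx => /(_ isT).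
    by rewrite fq cabsM cabsX wr mulrC.
  move=> /(_ h); rewrite ler_pdivlMr // => h2; apply: le_trans h2.
  rewrite fq cabsM mulrAC mulrC; apply: ler_wpM2l; first exact: cabs_ge0.
  rewrite cabsX -exprMn; apply: lerXn2r; rewrite ?nnegrE ?mulr_ge0 ?cabs_ge0 // ?ltW //.
  by rewrite /r; lra.
have f0 : 0 < cabs (f w0) by rewrite cabs_gt0.
have := upper_nthrootP (leqnn (Num.bound (B / cabs (f w0)))); rewrite ltr_pdivrMr // mulrC.
by have := bound (Num.bound (B / cabs (f w0))); lra.
Qed.

(** If [w] were omitted, f - w would have no zero in a small closed disc. With [d] half the minimum
    of |f - f z| on the circle, |f - w| is at least [d] there but smaller at the centre, against the
    minimum principle. *)
Lemma open_mapping f z r : ent f -> (exists w, f w != f z) -> 0 < r ->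
  exists2 d : R, 0 < d & forall w, cabs (w - f z) < d -> exists2 u, cabs (u - z) < r & f u = w.
Proof.
move=> ef [w0 fw0] r0.
have eg : ent (fun w => f w - f z) by apply: entB => //; exact: ent_cst.
have [|s s0 Hs] := isolated_zero z eg; first by exists w0; rewrite subr_eq0.
pose t := Num.min r s / 2; have m0 : 0 < Num.min r s by rewrite lt_min r0.
have t0 : 0 < t by rewrite divr_gt0.
have : t < Num.min r s by rewrite /t; lra.
rewrite lt_min => /andP[tr ts].
pose K : set C := [set w | cabs (w - z) = t].
have cK : compact K.
  apply: (@closed_bounded_compact R K z t); last by move=> w; rewrite /K /cdisc /= => ->.
  move=> w /closureCP Hw; apply/eqP; rewrite -subr_eq0 -normr_le0; apply/ler_addgt0Pl => e e0.
  have [u uK uw] := Hw e e0; rewrite addr0 -[t]uK ler_norml.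
  by have := cabs_tri u w z; have := cabs_tri w u z; rewrite (cabsB w u); lra.
have K0 : K !=set0.
  by exists (z + rc t); rewrite /K /= addrC addKr cabs_rc gtr0_norm.
have [c Kc cm] := compact_min K0 cK (fun w _ => cont_cabs (ent_continuous eg w)).
pose d := cabs (f c - f z) / 2.
have d0 : 0 < d.
  rewrite divr_gt0 // cabs_gt0; apply: Hs; last by rewrite Kc.
  by rewrite -subr_eq0 -cabs_eq0 Kc gt_eqF.
exists d => // w wd; apply: contrapT => H.
have ew : ent (fun u => f u - w) by apply: entB => //; exact: ent_cst.
have nz u : cdisc z t u -> f u - w != 0.
  move=> ut; apply/eqP => /eqP; rewrite subr_eq0 => /eqP fu; apply: H; exists u => //.
  exact: le_lt_trans tr.
have := min_principle ew (@compact_cdisc R z t) d0 nz.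
move=> /(_ _ z) H1; have : d <= cabs (f z - w).
  apply: H1; last by rewrite /cdisc /= subrr cabs0 ltW.
  move=> u; rewrite /cdisc /= le_eqVlt => /orP[/eqP ut|ut]; [left|right; exact: cdisc_interior].
  have := cm u ut; have := cabs_tri w (f u) (f z); rewrite /d; move: wd; rewrite /d; lra.
by rewrite cabsB; lra.
Qed.

End Principles.

(** * A theorem of Landau type *)

Section Landau.
Variable R : realType.
Local Notation C := R[i].
Implicit Types (z w u a p c : C) (e t r B N K : R) (f g F : C -> C).

Lemma peano2_ln_sub B N : N < B ->
  peano2 (fun h => ln (B - (N + h))) (ln (B - N)) (- (B - N)^-1) (- ((B - N) ^+ 2)^-1 / 2).
Proof.
move=> NB; have BN : 0 < B - N by rewrite subr_gt0.
have H : peano2 (fun h => B - (N + h)) (B - N) (- 1) 0.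
  have := @peano2_affine R (B - N) (-1); apply: (peano2_local (d := 1)) => // h _; ring.
have := peano2_comp (peano2_ln BN) H.
have -> : (B - N)^-1 * -1 = - (B - N)^-1 by ring.
have -> // : (B - N)^-1 * 0 + - (B - N) ^- 2 / 2 * (-1) ^+ 2 = - ((B - N) ^+ 2)^-1 / 2 by ring.
Qed.

Lemma peano2_ln1sqrt N (s := Num.sqrt N) : 0 < N ->
  peano2 (fun h => ln (1 + Num.sqrt (N + h))) (ln (1 + s)) ((1 + s)^-1 * (2 * s)^-1)
    ((1 + s)^-1 * (- (4 * s ^+ 3)^-1 / 2) + - (1 + s) ^- 2 / 2 * (2 * s)^-1 ^+ 2).
Proof.
move=> N0; have s0 : 0 < s by rewrite sqrtr_gt0.
have H : peano2 (fun h => 1 + Num.sqrt (N + h)) (1 + s) (2 * s)^-1 (- (4 * s ^+ 3)^-1 / 2).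
  have c1 : peano2 (fun=> 1 : R) 1 0 0.
    by have := @peano2_affine R 1 0; apply: (peano2_local (d := 1)) => // h _; ring.
  have := peano2D c1 (peano2_sqrt N0); by rewrite !add0r.
by apply: (peano2_comp (F := @ln R) (peano2_ln _) H); lra.
Qed.

Lemma lap2_ln_dist f z : ent f -> f z != 0 -> lap2 (fun w => ln (cabs (f w) ^+ 2)) z 0.
Proof.
move=> ef fz; have N0 : 0 < cabs (f z) ^+ 2 by rewrite exprn_gt0 // cabs_gt0.
have := lap2_normsq ef (peano2_ln N0).
have -> // : 2 * cabs (cder f z) ^+ 2 * ((cabs (f z) ^+ 2)^-1 + 2 * (- (cabs (f z) ^+ 2) ^- 2 / 2) * cabs (f z) ^+ 2) = 0.
by field; rewrite cabs_eq0.
Qed.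

Lemma lap2_ln_one_dist f z : ent f -> f z != 0 ->
  lap2 (fun w => ln (1 + cabs (f w))) z
    (cabs (cder f z) ^+ 2 / (2 * (cabs (f z) * (1 + cabs (f z)) ^+ 2))).
Proof.
move=> ef fz; have s0 : 0 < cabs (f z) by rewrite cabs_gt0.
have N0 : 0 < cabs (f z) ^+ 2 by rewrite exprn_gt0.
have sq w : Num.sqrt (cabs (f w) ^+ 2) = cabs (f w) by rewrite sqrtr_sqr ger0_norm // cabs_ge0.
have := @lap2_normsq R (fun N => ln (1 + Num.sqrt N)) f z _ _ _ ef (peano2_ln1sqrt N0); rewrite sq.
set L := _ * _; set L' := _ / _; have -> : L = L'.
  by rewrite /L /L'; field; rewrite !gt_eqF //; lra.
by apply: (lap2_local (r := 1)) => // w _; rewrite sq.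
Qed.

Lemma lap2_ln_sub z c B : cabs (c - z) ^+ 2 < B ->
  lap2 (fun w => ln (B - cabs (w - z) ^+ 2)) c (- (2 * B) / (B - cabs (c - z) ^+ 2) ^+ 2).
Proof.
move=> cB; have eB : ent (fun w : C => w - z) by apply: entB; [exact: ent_id|exact: ent_cst].
have := @lap2_normsq R (fun N => ln (B - N)) _ c _ _ _ eB (peano2_ln_sub cB).
have -> : cder (fun w => w - z) c = 1.
  by apply: cder_eq; have := cdiffB (cdiff_id c) (cdiff_cst z c); rewrite subr0.
set L := _ * _; set L' := _ / _; have -> // : L = L'.
by rewrite /L /L' cabs1; field; rewrite gt_eqF // subr_gt0.
Qed.

(** Only the smallest s_m can be below 1/2; each other factor is at most 9 / (1 + s_m). With five
    others the product is at most 9 ^ 5 / (s_m ^ 2 * (1 + s_m) ^ 4), exactly 9 ^ 5 times the square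
    of one term of the sum. This match is the reason for six points. *)
Lemma prod_sum_bound (s : 'I_6 -> R) : (forall j, 0 < s j) -> (forall i j, i != j -> 1 <= s i + s j) ->
  \prod_j ((1 + s j) / s j ^+ 2) <= 9 ^+ 5 * (\sum_j (s j * (1 + s j) ^+ 2)^-1) ^+ 2.
Proof.
move=> s0 sep; pose m := [arg min_(i < ord0) s i]%O.
have mP j : s m <= s j by rewrite /m; case: arg_minP => // i _; apply.
have q0 j : 0 < (s j * (1 + s j) ^+ 2)^-1.
  by rewrite invr_gt0 mulr_gt0 // exprn_gt0 //; have := s0 j; lra.
apply: (@le_trans _ _ (9 ^+ 5 * ((s m * (1 + s m) ^+ 2)^-1) ^+ 2)); last first.
  apply: ler_wpM2l; first by rewrite exprn_ge0.
  apply: lerXn2r; rewrite ?nnegrE ?(ltW (q0 m)) //; first by apply: sumr_ge0 => j _; exact: ltW.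
  by rewrite (bigD1 m) //= lerDl sumr_ge0 // => j _; exact: ltW.
rewrite (bigD1 m) //=.
have sm := s0 m; have sm1 : 0 < 1 + s m by lra.
have H j : j != m -> (1 + s j) / s j ^+ 2 <= 9 / (1 + s m).
  move=> jm; have sj := s0 j; have := sep _ _ jm; have := mP j => h1 h2.
  rewrite ler_pdivrMr ?exprn_gt0 // mulrAC ler_pdivlMr //.
  have : (1 + s j) * (1 + s m) <= (1 + s j) * (1 + s j) by apply: ler_wpM2l; lra.
  have : (1 + s j) * (1 + s j) <= (3 * s j) * (3 * s j) by apply: ler_pM; lra.
  nra.
have -> : 9 ^+ 5 * (s m * (1 + s m) ^+ 2)^-1 ^+ 2 = (1 + s m) / s m ^+ 2 * (9 / (1 + s m)) ^+ 5.
  by field; rewrite !gt_eqF.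
apply: ler_wpM2l; first by rewrite divr_ge0 ?sqr_ge0 // ltW.
have -> : (9 / (1 + s m)) ^+ 5 = \prod_(j | j != m) (9 / (1 + s m)).
  rewrite prodr_const; congr (_ ^+ _).
  by transitivity #|predC1 m|; [rewrite cardC1 card_ord|apply: eq_card].
by apply: ler_prod => j jm; rewrite H // divr_ge0 ?sqr_ge0 //; have := s0 j; lra.
Qed.

Lemma ln_prod_pos (J : finType) (x : J -> R) : (forall j, 0 < x j) ->
  0 < \prod_j x j /\ ln (\prod_j x j) = \sum_j ln (x j).
Proof.
move=> x0; elim/big_rec2: _ => [|j y1 y2 _ [h1 h2]]; first by rewrite ln1.
by split; [rewrite mulr_gt0|rewrite lnM ?posrE // h2].
Qed.

(* Ahlfors' method for the metric of density [(prod_j (1 + s_j) / s_j ^ 2) ^ (1/4)],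
   [s_j = |w - b_j|]: the maximum of [E] is estimated through the Laplacian of [ln E]. *)
Lemma ahlfors K F z1 (b : 'I_6 -> C) r : 0 <= K -> 36 ^+ 6 * 9 ^+ 5 * 256 <= K ^+ 4 ->
  ent F -> 0 < r -> (forall j : 'I_6, cabs (b j) = j%:R) ->
  (forall z j, cabs (z - z1) <= r -> F z != b j) -> cabs (F z1) = 1 ->
  cabs (cder F z1) <= K / r.
Proof.
move=> K0 K4 eF r0 bj Fb F1; have eF' := ent_cder eF.
pose s j z := cabs (F z - b j).
have s0 j z : cabs (z - z1) <= r -> 0 < s j z by move=> h; rewrite cabs_gt0 subr_eq0 Fb.
have ej j : ent (fun z => F z - b j) by apply: entB => //; exact: ent_cst.
have dj j z : cder (fun z => F z - b j) z = cder F z.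
  by apply: cder_eq; have := cdiffB (cderP z eF) (cdiff_cst (b j) z); rewrite subr0.
pose B := r ^+ 2; have B0 : 0 < B by rewrite exprn_gt0.
pose P z := \prod_j ((1 + s j z) / s j z ^+ 2).
(* Up to a constant, the fourth power of the ratio between the pulled back metric and the hyperbolic
   metric of the disc; the power 4 removes the root. *)
pose E z := (B - cabs (z - z1) ^+ 2) ^+ 4 * P z * cabs (cder F z) ^+ 4.
have fac0 j z : cabs (z - z1) <= r -> 0 < (1 + s j z) / s j z ^+ 2.
  by move=> /(s0 j) h; rewrite divr_gt0 ?exprn_gt0 //; lra.
have P0 z : cabs (z - z1) <= r -> 0 < P z by move=> zr; apply: prodr_gt0 => j _; exact: fac0.
have sc j z : cont_at (s j) z by apply: cont_cabs; exact: ent_continuous (ej j) z.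
have Pc z : cabs (z - z1) <= r -> cont_at P z.
  move=> zr; rewrite /P.
  have H (l : seq 'I_6) : cont_at (fun w => \prod_(j <- l) ((1 + s j w) / s j w ^+ 2)) z.
    elim: l => [|j l IH].
      have -> : (fun w => \prod_(j <- [::]) ((1 + s j w) / s j w ^+ 2)) = fun=> 1.
        by apply/funext => w; rewrite big_nil.
      exact: cont_cst.
    have -> : (fun w => \prod_(k <- j :: l) ((1 + s k w) / s k w ^+ 2)) =
        fun w => (1 + s j w) / s j w ^+ 2 * \prod_(k <- l) ((1 + s k w) / s k w ^+ 2).
      by apply/funext => w; rewrite big_cons.
    apply: cont_realM IH; apply: cont_realM; first exact: cont_realD (cont_cst _ _) (sc _ _).
    apply: cont_realV; first by rewrite expf_neq0 // gt_eqF // s0.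
    exact: cont_realX (sc _ _).
  exact: H.
have Ec z : cdisc z1 r z -> cont_at E z.
  move=> zr; apply: cont_realM.
    apply: cont_realM (Pc z zr); apply/cont_realX/cont_realD; first exact: cont_cst.
    apply/cont_real_opp/cont_realX/cont_cabs; exact: contB (cont_id _) (cont_cst _ _).
  by apply/cont_realX/cont_cabs; exact: ent_continuous.
have z1r : cabs (z1 - z1) <= r by rewrite subrr cabs0 ltW.
have [|c cr cM] := @compact_max R (cdisc z1 r) E _ (@compact_cdisc R z1 r) Ec.
  by exists z1.
(* At [z1] all s_j are at most 1 + 5, so each factor of [P] is at least 1/36. In the bound, 9 ^ 5
   comes from [prod_sum_bound] and 256 is 16 ^ 2, from [H2] below. *)
suff Ecle : E c <= 9 ^+ 5 * 256 * B ^+ 2.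
  have P1 : (36 ^+ 6)^-1 <= P z1.
    rewrite /P -exprVn; have -> : (36^-1 : R) ^+ 6 = \prod_(j < 6) 36^-1 by rewrite prodr_const card_ord.
    apply: ler_prod => j _; rewrite invr_ge0 ler0n /=.
    have h := s0 j z1 z1r; rewrite ler_pdivlMr ?exprn_gt0 //.
    have h6 : s j z1 <= 6.
      apply: le_trans (cabsBD _ _) _; rewrite F1 bj.
      have : (j%:R : R) <= 5%:R by rewrite ler_nat -ltnS.
      lra.
    have : s j z1 ^+ 2 <= 6 ^+ 2 by apply: lerXn2r; rewrite ?nnegrE // ltW.
    lra.
  have := le_trans (cM z1 z1r) Ecle; rewrite /E subrr cabs0 expr0n subr0.
  move=> H; have {}H : B ^+ 4 * (36 ^+ 6)^-1 * cabs (cder F z1) ^+ 4 <= 9 ^+ 5 * 256 * B ^+ 2.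
    apply: le_trans H; apply: ler_wpM2r; first by rewrite exprn_ge0 // cabs_ge0.
    by apply: ler_wpM2l => //; rewrite exprn_ge0 // ltW.
  have {}H : (cabs (cder F z1) * r) ^+ 4 <= K ^+ 4.
    have B2 : 0 < B ^+ 2 by rewrite exprn_gt0.
    rewrite -(ler_pM2l B2).
    have -> : B ^+ 2 * (cabs (cder F z1) * r) ^+ 4 = 36 ^+ 6 * (B ^+ 4 * (36 ^+ 6)^-1 * cabs (cder F z1) ^+ 4).
      by rewrite /B; field.
    apply: le_trans (ler_wpM2l _ H) _; first by rewrite exprn_ge0.
    have -> : 36 ^+ 6 * (9 ^+ 5 * 256 * B ^+ 2) = (36 ^+ 6 * 9 ^+ 5 * 256) * B ^+ 2 by ring.
    rewrite mulrC; apply: ler_wpM2l; first exact: ltW.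
    exact: K4.
  have cr0 : 0 <= cabs (cder F z1) * r by rewrite mulr_ge0 ?cabs_ge0 // ltW.
  by rewrite ler_pdivlMr //; move: H; rewrite ler_pXn2r // nnegrE.
clear K4.
have D0 : 0 <= 9 ^+ 5 * 256 * B ^+ 2.
  by apply: mulr_ge0; [apply: mulr_ge0; [exact: exprn_ge0|exact: ler0n]|exact: sqr_ge0].
have [E0|E0] := leP (E c) 0; first exact: le_trans D0.
clear D0.
pose Nc := cabs (c - z1) ^+ 2.
have NB : Nc < B.
  rewrite lt_neqAle /Nc /B; apply/andP; split; last by apply: lerXn2r; rewrite ?nnegrE ?cabs_ge0 ?(ltW r0) //.
  by apply: contraTneq E0 => h; rewrite /E h subrr expr0n /= !mul0r ltxx.
have Fc : cder F c != 0.
  by apply: contraTneq E0 => h; rewrite /E h cabs0 expr0n /= mulr0 ltxx.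
have [d d0 Hd] : exists2 d : R, 0 < d & forall z, cabs (z - c) < d ->
    [/\ cabs (z - z1) <= r, 0 < B - cabs (z - z1) ^+ 2 & cder F z != 0].
  have cz : cabs (c - z1) < r by move: NB; rewrite /Nc /B ltr_pXn2r // nnegrE ?cabs_ge0 // ltW.
  have /continuous_CP /(_ (cabs (cder F c))) := ent_continuous eF' c.
  rewrite cabs_gt0 => /(_ Fc)[d d0 Hd]; exists (Num.min d (r - cabs (c - z1))).
    by rewrite lt_min d0 subr_gt0.
  move=> z; rewrite lt_min => /andP[zd zr].
  have zz : cabs (z - z1) < r by have := cabs_tri c z z1; lra.
  split; first exact: ltW.
    by rewrite subr_gt0 /B ltr_pXn2r // nnegrE ?cabs_ge0 // ltW.
  by apply: contraTneq (Hd z zd) => ->; rewrite sub0r cabsN ltxx.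
pose v z := 4 * ln (B - cabs (z - z1) ^+ 2) +
   (\sum_j (ln (1 + s j z) + (-1) * ln (s j z ^+ 2)) + 2 * ln (cabs (cder F z) ^+ 2)).
have lnE z : cabs (z - c) < d -> 0 < E z /\ ln (E z) = v z.
  move=> /Hd[zr zB zF].
  have [p1 p2] := ln_prod_pos (fun j => fac0 j z zr).
  have f0 : 0 < cabs (cder F z) by rewrite cabs_gt0.
  split; first by rewrite /E !mulr_gt0 // exprn_gt0.
  rewrite /E lnM ?posrE ?mulr_gt0 ?exprn_gt0 // lnM ?posrE ?exprn_gt0 // /P p2 /v.
  have -> : ln ((B - cabs (z - z1) ^+ 2) ^+ 4) = 4 * ln (B - cabs (z - z1) ^+ 2).
    by rewrite lnXn // mulr_natl.
  have -> : ln (cabs (cder F z) ^+ 4) = 2 * ln (cabs (cder F z) ^+ 2).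
    by rewrite !lnXn // mulr_natl -mulrnA.
  rewrite -addrA; congr (_ + (_ + _)); apply: eq_bigr => j _; have h := s0 j z zr.
  have h1 : 0 < 1 + s j z by lra.
  by rewrite ln_div ?posrE ?exprn_gt0 // mulN1r.
have cd : cabs (c - c) < d by rewrite subrr cabs0.
pose q j := (s j c * (1 + s j c) ^+ 2)^-1.
have lapv : lap2 v c (4 * (- (2 * B) / (B - Nc) ^+ 2) +
   (\sum_j (cabs (cder F c) ^+ 2 / (2 * (s j c * (1 + s j c) ^+ 2)) + -1 * 0) + 2 * 0)).
  apply: lap2D; first by apply: lap2Z; exact: lap2_ln_sub.
  apply: lap2D; last by apply: lap2Z; exact: lap2_ln_dist.
  apply: lap2_sum => j; have nz : F c - b j != 0 by rewrite subr_eq0 Fb.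
  apply: lap2D; last by apply: lap2Z; exact: lap2_ln_dist (ej j) nz.
  by have := lap2_ln_one_dist (ej j) nz; rewrite dj.
(* At a maximum of [E] the half Laplacian of ln E is at most 0. The logarithms of s_j and of |F'|
   are harmonic, so only ln (1 + s_j) is left to balance the term of the disc. *)
have := lap2_min (v := fun w => -1 * v w) d0 (lap2Z (-1) lapv).
have vmin w : cabs (w - c) < d -> -1 * v c <= -1 * v w.
  move=> wd; have [[e1 e2] [e3 e4]] := (lnE w wd, lnE c cd).
  have EE : E w <= E c by apply: cM; have [] := Hd w wd.
  have VV : v w <= v c by move: EE; rewrite -(ler_ln e1 e3) e2 e4.
  by rewrite !mulN1r lerN2.
move=> /(_ vmin).
have -> : \sum_j (cabs (cder F c) ^+ 2 / (2 * (s j c * (1 + s j c) ^+ 2)) + -1 * 0) =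
   cabs (cder F c) ^+ 2 / 2 * \sum_j q j.
  rewrite mulr_sumr; apply: eq_bigr => j _; rewrite /q; field.
  by rewrite !gt_eqF //; have := s0 j c cr; lra.
set Q := \sum_j q j => H.
have BN : 0 < B - Nc by rewrite subr_gt0.
have H2 : cabs (cder F c) ^+ 2 * Q * (B - Nc) ^+ 2 <= 16 * B.
  have : cabs (cder F c) ^+ 2 * Q <= 16 * B / (B - Nc) ^+ 2 by lra.
  by rewrite ler_pdivlMr // exprn_gt0.
have PQ : P c <= 9 ^+ 5 * Q ^+ 2.
  apply: prod_sum_bound => [j|i j ij]; first exact: s0.
  have h : cabs (b i - b j) <= s i c + s j c.
    have := cabs_tri (F c) (b i) (b j); rewrite (cabsB (b i) (F c)) //.
  apply: le_trans h; have h1 := cabs_subr (b i) (b j); have h2 := cabs_subr (b j) (b i).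
  move: h1 h2; rewrite (cabsB (b j)) !bj => h1 h2.
  have : (i != j :> nat) by [].
  have lt1 (m n : nat) : (m < n)%N -> 1 <= (n%:R : R) - m%:R.
    by move=> mn; rewrite lerBrDr nat1r ler_nat.
  by rewrite neq_ltn => /orP[] /lt1 h3; lra.
have Q0 : 0 <= Q by apply: sumr_ge0 => j _; rewrite invr_ge0 mulr_ge0 ?exprn_ge0 ?cabs_ge0 // addr_ge0 ?cabs_ge0.
rewrite /E -/Nc.
apply: (@le_trans _ _ (9 ^+ 5 * (cabs (cder F c) ^+ 2 * Q * (B - Nc) ^+ 2) ^+ 2)).
  have -> : 9 ^+ 5 * (cabs (cder F c) ^+ 2 * Q * (B - Nc) ^+ 2) ^+ 2 =
     (B - Nc) ^+ 4 * (9 ^+ 5 * Q ^+ 2) * cabs (cder F c) ^+ 4 by ring.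
  apply: ler_wpM2r; first by rewrite exprn_ge0 // cabs_ge0.
  by apply: ler_wpM2l => //; rewrite exprn_ge0 // ltW.
have -> : 9 ^+ 5 * 256 * B ^+ 2 = 9 ^+ 5 * (16 * B) ^+ 2 by ring.
apply: ler_wpM2l; first by rewrite exprn_ge0.
apply: lerXn2r => //; rewrite nnegrE.
  by rewrite mulr_ge0 ?sqr_ge0 // mulr_ge0 // sqr_ge0.
lra.
Qed.

(** Radius 0 is allowed, so a set containing no such circle misses [p] itself as well. *)
Definition has_circle (S : set C) p := exists2 t : R, 0 <= t & forall w, cabs (w - p) = t -> S w.

(** On each circle of radius j |g z1| with j = 0, ..., 5 some value is omitted. After division by |g
    z1| these values have moduli 0, ..., 5, hence mutual distances at least 1, and [ahlfors] applies
    on the disc of radius r / 4 around [z1]. *)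
Lemma landau_deriv : exists2 K : R, 0 <= K & forall g a r, ent g -> 0 < r ->
  ~ has_circle (g @` disc a r) 0 ->
  forall z, cabs (z - a) <= r / 2 -> cabs (cder g z) <= K / r * cabs (g z).
Proof.
have [K0 K00 K4] : exists2 K : R, 0 <= K & 36 ^+ 6 * 9 ^+ 5 * 256 <= K ^+ 4.
  pose k : R := 36 ^+ 6 * 9 ^+ 5 * 256.
  have k0 : 0 <= k by apply: mulr_ge0; [apply: mulr_ge0; exact: exprn_ge0|exact: ler0n].
  exists (1 + k); first by lra.
  apply: (@le_trans _ _ (1 + k)); first by rewrite /k in k0 *; lra.
  have h1 : 1 <= 1 + k by lra.
  by apply: ler_eXnr.
exists (4 * K0) => [|g a r eg r0 nc z1 z1a]; first by lra.
have omit (t : R) : 0 <= t -> exists2 w : C, cabs w = t & forall z, cabs (z - a) < r -> g z != w.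
  move=> t0; apply: contrapT => H; apply: nc; exists t => // w; rewrite subr0 => wt.
  apply: contrapT => H1; apply: H; exists w => // z za; apply/eqP => gz; apply: H1.
  by exists z.
have gz1 : 0 < cabs (g z1).
  have [w] := omit 0 (lexx 0); move=> /eqP; rewrite cabs_eq0 => /eqP-> H.
  by rewrite cabs_gt0 H //; lra.
set T := cabs (g z1) in gz1 *.
have /choice[b Hb] : forall j : 'I_6, exists w : C, cabs w = j%:R * T /\ forall z, cabs (z - a) < r -> g z != w.
  move=> j; have jT : 0 <= j%:R * T by rewrite mulr_ge0 ?ler0n // ltW.
  by have [w h1 h2] := omit _ jT; exists w.
have T0 : rc T != 0 by rewrite rc_eq0 gt_eqF.
have cT : cabs (rc T)^-1 = T^-1 by rewrite cabsV cabs_rc gtr0_norm.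
pose F z := (rc T)^-1 * g z.
have eF : ent F by apply: entM => //; exact: ent_cst.
have dF : cder F z1 = (rc T)^-1 * cder g z1.
  by apply: cder_eq; apply: cdiffZ; exact: cderP.
have r4 : 0 < r / 4 by lra.
have := @ahlfors K0 F z1 (fun j => (rc T)^-1 * b j) (r / 4) K00 K4 eF r4.
have H1 (j : 'I_6) : cabs ((rc T)^-1 * b j) = j%:R.
  by rewrite cabsM cT (Hb j).1 mulrCA mulVf ?mulr1 // gt_eqF.
have H2 z (j : 'I_6) : cabs (z - z1) <= r / 4 -> F z != (rc T)^-1 * b j.
  move=> zz; apply/negP => /eqP /(mulfI (_ : (rc T)^-1 != 0)); rewrite invr_eq0 => /(_ T0) /eqP.
  by apply/negP/(Hb j).2; have := cabs_tri z1 z a; lra.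
have H3 : cabs (F z1) = 1 by rewrite cabsM cT mulVf // gt_eqF.
move=> /(_ H1 H2 H3); rewrite dF cabsM cT mulrC ler_pdivrMr // => H4.
apply: le_trans H4 _; rewrite le_eqVlt; apply/orP; left; apply/eqP; field.
by rewrite gt_eqF.
Qed.

(* The two inequalities say that [log (g - p)] is Lipschitz on the half disc, with a
   universal constant. *)
Lemma landau : exists2 L : R, 1 <= L & forall g p a r, ent g -> 0 < r ->
  ~ has_circle (g @` disc a r) p -> forall z, cabs (z - a) <= r / 2 ->
  cabs (g z - p) <= L * cabs (g a - p) /\ cabs (g a - p) <= L * cabs (g z - p).
Proof.
have [K K0 HK] := landau_deriv; exists (expR K) => [|g0 p a r eg0 r0 nc z za].
  by have := expR_ge1Dx K; lra.
pose g w := g0 w - p.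
have eg : ent g by apply: entB => //; exact: ent_cst.
have ncg : ~ has_circle (g @` disc a r) 0.
  move=> [t t0 Ht]; apply: nc; exists t => // w wt.
  have := Ht (w - p); rewrite subr0 => /(_ wt)[u ua]; rewrite /g => /(congr1 (fun v => v + p)).
  by rewrite !subrK => gu; exists u.
have Hd := HK g a r eg r0 ncg.
have gn0 w : cabs (w - a) < r -> g w != 0.
  move=> wa; apply/eqP => gw; apply: ncg; exists 0 => // u /eqP; rewrite subr0 cabs_eq0 => /eqP->.
  by exists w.
pose P t := g (cpath a z t).
have Pa t : 0 <= t <= 1 -> cabs (cpath a z t - a) <= r / 2.
  by move=> t01; apply: le_trans za; exact: cpath_dist.
(* [N] is |P| ^ 2 in real terms. The derivative of ln N along the segment is at most [K], since 2
   |P| |l| <= K |P| ^ 2. *)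
pose N t := complex.Re (P t) * complex.Re (P t) + complex.Im (P t) * complex.Im (P t).
have NE t : N t = cabs (P t) ^+ 2 by rewrite sqr_cabs /N; ring.
have N0 t : 0 <= t <= 1 -> 0 < N t.
  by move=> /Pa h; rewrite NE exprn_gt0 // cabs_gt0 gn0 //; lra.
pose l t := (z - a) * cder g (cpath a z t).
have dP t : rcdiff P t (l t) by apply: rcdiff_cpath; exact: cderP.
pose dN t := complex.Re (P t) *: complex.Re (l t) + complex.Re (P t) *: complex.Re (l t) +
  (complex.Im (P t) *: complex.Im (l t) + complex.Im (P t) *: complex.Im (l t)) : R^o.
have dNP t : is_derive (t : R^o) (1 : R^o) N (dN t).
  have h1 := rcdiff_Re (dP t); have h2 := rcdiff_Im (dP t).
  exact: (is_deriveD (is_deriveM h1 h1) (is_deriveM h2 h2)).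
have dNle t : 0 <= t <= 1 -> `|dN t| <= K * N t.
  move=> t01; have -> : dN t = 2 * complex.Re (P t) * complex.Re (l t) + 2 * complex.Im (P t) * complex.Im (l t).
    by rewrite /dN -![_ *: _]/(_ * _); ring.
  have lb : cabs (l t) <= K / 2 * cabs (P t).
    rewrite cabsM; apply: (@le_trans _ _ (r / 2 * (K / r * cabs (P t)))).
      by apply: ler_pM; rewrite ?cabs_ge0 //; apply: Hd; exact: Pa.
    by rewrite le_eqVlt; apply/orP; left; apply/eqP; field; rewrite gt_eqF.
  have E : complex.Re (P t) * complex.Re (l t) + complex.Im (P t) * complex.Im (l t) =
      complex.Re (P t * (l t)^*%C).
    by rewrite cReM; case: (l t) => x y /=; ring.
  have -> : 2 * complex.Re (P t) * complex.Re (l t) + 2 * complex.Im (P t) * complex.Im (l t) =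
      2 * complex.Re (P t * (l t)^*%C) by rewrite -E; ring.
  rewrite normrM ger0_norm //.
  have := Re_le_cabs (P t * (l t)^*%C); rewrite cabsM => h.
  have lJ : cabs (l t)^*%C = cabs (l t) by rewrite /cabs; case: (l t) => x y /=; rewrite sqrrN.
  rewrite lJ in h; have := ler_wpM2l (cabs_ge0 (P t)) lb; rewrite NE; lra.
have [||c] := @MVT R (fun t => ln (N t)) (fun t => (N t)^-1 * dN t) 0 1 ltr01.
- move=> t; rewrite in_itv /= => /andP[t0 t1].
  have h : 0 < N t by apply: N0; lra.
  exact: (is_derive1_comp (is_derive1_ln h) (dNP t)).
- apply: continuous_in_subspaceT => t /set_mem /=; rewrite in_itv /= => t01.
  apply: is_derive_cont; exact: (is_derive1_comp (is_derive1_ln (N0 t t01)) (dNP t)).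
rewrite in_itv /= subr0 mulr1 => /andP[c0 c1] E.
have c01 : 0 <= c <= 1 by lra.
have : `|ln (N 1) - ln (N 0)| <= K.
  have -> : ln (N 1) - ln (N 0) = (N c)^-1 * dN c by exact: E.
  rewrite normrM normfV (gtr0_norm (N0 c c01)) mulrC ler_pdivrMr ?N0 //; exact: dNle.
have P1 : P 1 = g0 z - p by rewrite /P /cpath rc1 mul1r addrC subrK.
have P00 : P 0 = g0 a - p by rewrite /P /cpath rc0 mul0r addr0.
have key x y : 0 < x -> 0 < y -> ln (x ^+ 2) <= ln (y ^+ 2) + K -> x <= expR K * y.
  move=> x0 y0; rewrite -{1}(expRK K) -lnM ?posrE ?exprn_gt0 ?expR_gt0 // ler_ln ?posrE ?mulr_gt0 ?exprn_gt0 ?expR_gt0 //.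
  move=> h; have e1 : 1 <= expR K by have := expR_ge1Dx K; lra.
  have : x ^+ 2 <= (expR K * y) ^+ 2.
    apply: le_trans h _; rewrite mulrC exprMn; apply: ler_wpM2r; first exact: sqr_ge0.
    by apply: ler_eXnr.
  by rewrite ler_pXn2r // nnegrE ?mulr_ge0 ?expR_ge0 // ltW.
have i0 : 0 <= (0:R) <= 1 by lra.
have i1 : 0 <= (1:R) <= 1 by lra.
have p0 : 0 < cabs (P 0) by move: (N0 0 i0); rewrite NE exprn_even_gt0 //= cabs_eq0 cabs_gt0.
have p1 : 0 < cabs (P 1) by move: (N0 1 i1); rewrite NE exprn_even_gt0 //= cabs_eq0 cabs_gt0.
rewrite !NE ler_norml => /andP[h1 h2]; rewrite -P1 -P00.
by split; apply: key => //; lra.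
Qed.

End Landau.

(** * Growth of the maximum modulus *)

Section Growth.
Variable R : realType.
Local Notation C := R[i].
Implicit Types (z w u a c : C) (e t r s K : R) (f g h : C -> C).

Definition maxmod f s : R :=
  cabs (f (xget 0 [set c | cdisc 0 s c /\ forall z, cdisc 0 s z -> cabs (f z) <= cabs (f c)])).

Lemma maxmodP f s : (forall z, cont_at f z) -> 0 <= s ->
  (forall z, cabs z <= s -> cabs (f z) <= maxmod f s) /\ exists2 c, cabs c <= s & cabs (f c) = maxmod f s.
Proof.
move=> fc s0; have [||c cs cM] := @compact_max R (cdisc 0 s) (fun z => cabs (f z)) _ (@compact_cdisc R 0 s).
- by exists 0; rewrite /cdisc /= subrr cabs0.
- by move=> z _; exact: cont_cabs.
have H : exists c, [set c | cdisc 0 s c /\ forall z, cdisc 0 s z -> cabs (f z) <= cabs (f c)] c by exists c.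
have [h1 h2] := xgetPex 0 H; split.
  by move=> z zs; apply: h2; rewrite /cdisc /= subr0.
by eexists; [move: h1; rewrite /cdisc /= subr0; apply|].
Qed.

Lemma maxmod_ge f s z : (forall z, cont_at f z) -> cabs z <= s -> cabs (f z) <= maxmod f s.
Proof. by move=> fc zs; apply: (maxmodP fc _).1 => //; apply: le_trans zs; exact: cabs_ge0. Qed.

Lemma maxmod_ge0 f s : 0 <= maxmod f s. Proof. exact: cabs_ge0. Qed.

Lemma taylor_factor f (k : nat) : ent f -> exists p : {poly C}, exists h, exists2 c : R, 0 <= c &
  [/\ ent h, forall z, f z = p.[z] + z ^+ k.+1 * h z &
     forall s z, 1 <= s -> cabs z <= s -> cabs p.[z] <= c * s ^+ k].
Proof.
move=> ef; elim: k => [|k [p [h [c c0 [eh fE pc]]]]].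
  have [q eq fq] := ent_factor 0 ef; exists (f 0)%:P, q, (cabs (f 0)); first exact: cabs_ge0.
  split=> // [z|s z _ _]; first by rewrite hornerC fq subr0 expr1.
  by rewrite hornerC expr0 mulr1.
have [q eq hq] := ent_factor 0 eh.
exists (p + (h 0)%:P * 'X^(k.+1)), q, (c + cabs (h 0)); first by rewrite addr_ge0 ?cabs_ge0.
split=> // [z|s z s1 zs]; rewrite !hornerE; first by rewrite fE hq subr0 (exprSr z k.+1); ring.
apply: le_trans (cabsD _ _) _; rewrite mulrDl; apply: lerD.
  apply: le_trans (pc s z s1 zs) _; apply: ler_wpM2l => //.
  by rewrite exprS ler_peMl // exprn_ge0 //; lra.
rewrite cabsM cabsX; apply: ler_wpM2l; first exact: cabs_ge0.
by apply: lerXn2r; rewrite ?nnegrE ?cabs_ge0 //; lra.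
Qed.

(** As [f] is not a polynomial, each Taylor remainder z ^ (k+1) * h has h nonzero. By the maximum
    principle for [h], its maximum modulus grows by 2 ^ (k+1) when the radius doubles, while the
    polynomial part is at most half of it. *)
Lemma growth f K : ent f -> ~ polynomial_fun f -> exists2 s0 : R, 1 <= s0 & forall s, s0 <= s ->
  K * maxmod f s <= maxmod f (2 * s) /\ K * s <= maxmod f s.
Proof.
move=> ef npf; pose k := (Num.bound (2 * `|K|)).+1.
have kK : 2 * `|K| <= 2 ^+ k by apply/ltW/upper_nthrootP/leqnSn.
have [p [h [C0 C00 [eh fE pc]]]] := taylor_factor k ef.
have [z1 hz1] : exists z1, h z1 != 0.
  apply: contrapT => H; apply: npf; exists p => z; rewrite fE.
  have -> : h z = 0 by apply: contrapT => /eqP hz; apply: H; exists z.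
  by rewrite mulr0 addr0.
pose c := cabs (h z1); have c0 : 0 < c by rewrite cabs_gt0.
pose P z := z ^+ k.+1 * h z.
have eX n : ent (fun z : C => z ^+ n).
  elim: n => [|n IH]; first exact: ent_cst.
  have -> : (fun z : C => z ^+ n.+1) = fun z => z * z ^+ n by apply/funext => z; rewrite exprS.
  exact: entM (@ent_id R) IH.
have eP : ent P by exact: entM.
have Pc := ent_continuous eP; have fc := ent_continuous ef.
have hb r z : 0 < r -> cabs z <= r -> cabs (h z) <= maxmod P r / r ^+ k.+1.
  move=> r0 zr; have := @max_disc R h 0 r (maxmod P r / r ^+ k.+1) eh _ z; rewrite subr0; apply=> // w.
  rewrite subr0 => wr; rewrite ler_pdivlMr ?exprn_gt0 // mulrC -{1}wr -cabsX -cabsM.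
  by apply: (@maxmod_ge P r w Pc); rewrite wr.
(* The terms provide in turn s >= 1, a disc containing [z1], a remainder twice as large as the
   polynomial part, and the bound K * s. *)
pose s0 := 1 + cabs z1 + 2 * C0 / c + 2 * `|K| / c.
have d1 : 0 <= 2 * C0 / c by apply: divr_ge0; [rewrite mulr_ge0|exact: ltW].
have d2 : 0 <= 2 * `|K| / c by apply: divr_ge0; [rewrite mulr_ge0|exact: ltW].
have z10 := cabs_ge0 z1.
exists s0; first by rewrite /s0; lra.
move=> s s0s; have s1 : 1 <= s by rewrite /s0 in s0s; lra.
have sp : 0 < s by lra.
pose mP := maxmod P s.
have mPc : c * s ^+ k.+1 <= mP.
  by rewrite -ler_pdivlMr ?exprn_gt0 //; apply: hb => //; rewrite /s0 in s0s; lra.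
have mP2 : 2 ^+ k.+1 * mP <= maxmod P (2 * s).
  have [z zs E] := (maxmodP Pc (ltW sp)).2; rewrite /mP -E.
  have s20 : 0 < 2 * s by lra.
  have := hb (2 * s) z s20 (_ : cabs z <= 2 * s); rewrite ler_pdivlMr ?exprn_gt0 // => H.
  apply: le_trans (H _); last by lra.
  rewrite /P cabsM cabsX exprMn mulrCA mulrA mulrC; apply: ler_wpM2l; first exact: cabs_ge0.
  rewrite mulrC; apply: ler_wpM2l; first by rewrite exprn_ge0.
  by apply: lerXn2r; rewrite ?nnegrE ?cabs_ge0 // ltW.
have Cs : 2 * (C0 * s ^+ k) <= mP.
  apply: le_trans mPc; rewrite (exprS s k) (mulrA c) (mulrA 2); apply: ler_wpM2r.
    by apply: exprn_ge0; exact: ltW.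
  by rewrite mulrC -ler_pdivrMl // mulrC; rewrite /s0 in s0s; lra.
have f2 : maxmod P (2 * s) - C0 * (2 * s) ^+ k <= maxmod f (2 * s).
  have s20 : 0 <= 2 * s by lra.
  have [z zs <-] := (maxmodP Pc s20).2; rewrite lerBlDr.
  have -> : P z = f z - p.[z] by rewrite fE /P; ring.
  apply: le_trans (cabsBD _ _) _; apply: lerD; first exact: (@maxmod_ge f (2 * s) z fc).
  by apply: pc => //; lra.
have f1 : maxmod f s <= mP + C0 * s ^+ k.
  have [z zs <-] := (maxmodP fc (ltW sp)).2; rewrite fE addrC.
  apply: le_trans (cabsD _ _) _; apply: lerD; last exact: pc.
  exact: (@maxmod_ge P s z Pc).
have f1' : mP - C0 * s ^+ k <= maxmod f s.
  have [z zs E] := (maxmodP Pc (ltW sp)).2; rewrite /mP -E lerBlDr.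
  have -> : P z = f z - p.[z] by rewrite fE /P; ring.
  apply: le_trans (cabsBD _ _) _; apply: lerD; first exact: (@maxmod_ge f s z fc).
  exact: pc.
have mP0 : 0 <= mP by exact: maxmod_ge0.
have mf0 := maxmod_ge0 f s.
split.
  have h1 : 2 ^+ k * (2 * (C0 * s ^+ k)) <= 2 ^+ k * mP by apply: ler_wpM2l => //; rewrite exprn_ge0.
  have h2 : 2 ^+ k.+1 * mP = 2 * (2 ^+ k * mP) by rewrite exprS mulrA.
  have h3 : C0 * (2 * s) ^+ k = 2 ^+ k * (C0 * s ^+ k) by rewrite exprMn; ring.
  have h4 : 2 * `|K| * mP <= 2 ^+ k * mP by apply: ler_wpM2r.
  have h5 : K * maxmod f s <= `|K| * maxmod f s by apply: ler_wpM2r => //; exact: ler_norm.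
  have h6 : `|K| * maxmod f s <= `|K| * (mP + C0 * s ^+ k) by apply: ler_wpM2l.
  have h7 : `|K| * (2 * (C0 * s ^+ k)) <= `|K| * mP by apply: ler_wpM2l.
  have h8 : 0 <= `|K| * mP by rewrite mulr_ge0.
  have h9 : `|K| * (mP + C0 * s ^+ k) = `|K| * mP + `|K| * (2 * (C0 * s ^+ k)) / 2 by field.
  lra.
have sk : s * s <= s ^+ k.+1.
  rewrite /k !exprS mulrA; apply: ler_peMr; [by rewrite mulr_ge0 // ltW|rewrite -exprS; exact: exprn_ege1].
have h1 : c * (s * s) <= c * s ^+ k.+1 by apply: ler_wpM2l => //; exact: ltW.
have h2 : 2 * `|K| <= c * s.
  by rewrite mulrC -ler_pdivrMl // mulrC; rewrite /s0 in s0s; lra.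
have h3 : 2 * `|K| * s <= c * s * s by apply: ler_wpM2r => //; exact: ltW.
have h4 : K * s <= `|K| * s by apply: ler_wpM2r; [exact: ltW|exact: ler_norm].
lra.
Qed.

End Growth.

(** * Plane topology *)

Section Topology.
Variable R : realType.
Local Notation C := R[i].
Implicit Types (z w u a p c : C) (e t r d M : R) (A S K : set C).

Definition unb S := forall M, exists2 z, S z & M < cabs z.

Lemma bounded_setCP S : bounded_set S <-> exists M, forall z, S z -> cabs z <= M.
Proof.
split.
  move=> [M [Mr HM]]; exists (complex.Re M + 1) => z Sz.
  have := HM (rc (complex.Re M + 1)) _ z Sz.
  rewrite /= norm_cabs rc_ler; apply.
  by rewrite -(RRe_real Mr) ltcR ltrDl.
move=> [M HM]; exists (rc M); split; first by apply/complex_realP; exists M.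
by move=> x Mx z /HM zM /=; rewrite norm_cabs; apply: le_trans (ltW Mx); rewrite rc_ler.
Qed.

Lemma unbP S : unb S <-> ~ bounded_set S.
Proof.
rewrite bounded_setCP; split=> [US [M HM]|H M].
  by have [z /HM] := US M; rewrite leNgt => /negbTE ->.
apply: contrapT => H1; apply: H; exists M => z Sz; rewrite leNgt; apply/negP => Mz.
by apply: H1; exists z.
Qed.

Lemma unb_sub S S' : S `<=` S' -> unb S -> unb S'.
Proof. by move=> SS US M; have [z Sz zM] := US M; exists z => //; exact: SS. Qed.

Lemma connected_circle S p x y t : connected S -> S x -> S y -> cabs (x - p) <= t <= cabs (y - p) ->
  exists2 z, S z & cabs (z - p) = t.
Proof.
move=> cS Sx Sy /andP[xt ty]; pose v z := cabs (z - p).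
have vc z : cont_at v z by apply: cont_cabs; exact: contB (cont_id _) (cont_cst _ _).
have : connected (v @` S).
  by apply: connected_continuous_connected => //; apply: continuous_subspaceT => z; have [] := vc z.
move=> /connected_intervalP H.
have vx : (v @` S) (v x) by exists x.
have vy : (v @` S) (v y) by exists y.
have [|z Sz zt] := H _ _ vx vy t; first by rewrite xt ty.
by exists z.
Qed.

Lemma connected_path a b (D : set R) : connected D -> connected (cpath a b @` D).
Proof.
move=> cD; apply: connected_continuous_connected => //; apply: continuous_subspaceT => t.
by have [] := cpath_continuous a b t.
Qed.

Lemma connected_disc a r : connected (disc a r).
Proof.
have [r0|r0] := leP r 0.
  have -> : disc a r = set0; last exact: connected0.
  by apply/seteqP; split=> // z; rewrite /disc /=; have := cabs_ge0 (z - a); lra.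
have -> : disc a r = \bigcup_(z in disc a r) (cpath a z @` `[0, 1]).
  apply/seteqP; split=> z.
    move=> zr; exists z => //; exists 1; first by rewrite /= in_itv /= ler01 lexx.
    by rewrite /cpath rc1; ring.
  move=> [w wr [t]]; rewrite /= in_itv /= => t01 <-.
  by apply: le_lt_trans wr; exact: cpath_dist.
apply: bigcup_connected.
  exists a => z _; exists 0; first by rewrite /= in_itv /= ler01 lexx.
  by rewrite /cpath rc0; ring.
by move=> z _; apply: connected_path; apply/connected_intervalP; exact: interval_is_interval.
Qed.

Lemma connected_ray a b : connected (cpath a b @` `[0, +oo[).
Proof. by apply: connected_path; apply/connected_intervalP; exact: interval_is_interval. Qed.

Lemma directed_compact (FF : set (set C)) K : compact K -> FF !=set0 ->
  (forall H, FF H -> closed H) -> (forall H1 H2, FF H1 -> FF H2 -> FF (H1 `&` H2)) ->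
  (forall H, FF H -> H `&` K !=set0) -> exists2 z, K z & forall H, FF H -> H z.
Proof.
move=> cK [H0 FH0] Hc HI Hne.
pose F : set_system C := fun P => exists2 H, FF H & H `&` K `<=` P.
have PF : ProperFilter F.
  constructor; first by move=> [H /Hne[z Hz] HP]; exact: HP Hz.
  constructor; first by exists H0.
    move=> P Q [H1 F1 P1] [H2 F2 P2]; exists (H1 `&` H2); first exact: HI.
    by move=> z [[h1 h2] Kz]; split; [exact: P1|exact: P2].
  by move=> P Q PQ [H FH HP]; exists H => // z /HP /PQ.
have [|z [Kz zc]] := cK F PF; first by exists H0 => // z [].
exists z => // H FH; apply: (Hc _ FH) => B Bz.
have [|w [[Hw _] Bw]] := zc (H `&` K) B _ Bz; first by exists H.
by exists w.
Qed.

Lemma compact_separation S K : compact S -> closed K -> S `&` K = set0 ->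
  exists2 d, 0 < d & forall x y, S x -> K y -> d <= cabs (x - y).
Proof.
move=> cS cK SK; apply: contrapT => H.
have clS : closed S by exact: compact_closed (@norm_hausdorff _ _) cS.
pose D n := closure [set x | S x /\ exists2 y, K y & cabs (x - y) < n.+1%:R^-1].
have DS n : D n `<=` S.
  by rewrite [X in _ `<=` X](closure_id _).1 //; apply: closureS => x [].
have [z Hz] : exists z, forall n, D n z.
  apply: nested_compact => [|n|n|n].
  - exact: subclosed_compact (@closed_closure _ _) cS (DS 0%N).
  - exact: closed_closure.
  - apply: closureS => x [Sx [y Ky xy]]; split=> //; exists y => //.
    by apply: lt_le_trans xy _; rewrite lef_pV2 ?posrE ?ltr0n // ler_nat.
  - apply: contrapT => Dn; apply: H; exists n.+1%:R^-1; first by rewrite invr_gt0 ltr0n.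
    move=> x y Sx Ky; rewrite leNgt; apply/negP => xy; apply: Dn; exists x.
    by apply: subset_closure; split=> //; exists y.
have : (S `&` K) z; last by rewrite SK.
split; first exact: (DS 0%N).
apply: cK; apply/closureCP => e e0; have e2 : 0 < e / 2 by lra.
have [n Hn] : exists n, n.+1%:R^-1 < e / 2.
  exists (Num.truncn (e / 2)^-1); rewrite invf_plt ?posrE ?ltr0n ?divr_gt0 //.
  exact: truncnS_gt.
have /closureCP /(_ _ e2)[x [Sx [y Ky xy]] xz] := Hz n.
exists y => //; have xy' := lt_trans xy Hn.
by have := cabs_tri x y z; rewrite (cabsB y x); lra.
Qed.

(* Components of compact sets are intersections of relatively clopen sets. *)
Lemma clopen_piece A z : compact A -> A z -> forall K, closed K -> 
  (forall w, connected_component A z w -> ~ K w) ->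
  exists H, [/\ closed H, closed (A `\` H), H `<=` A, H z & H `&` K = set0].
Proof.
move=> cA Az K cK compK; apply: contrapT => noH.
have clA : closed A by exact: compact_closed (@norm_hausdorff _ _) cA.
pose FF : set (set C) := [set H | [/\ closed H, closed (A `\` H), H `<=` A & H z]].
have FA : FF A by split=> //; rewrite setDv; exact: closed0.
have FI H1 H2 : FF H1 -> FF H2 -> FF (H1 `&` H2).
  move=> [a1 b1 c1 d1] [a2 b2 c2 d2]; split=> //; first exact: closedI.
    by rewrite setDIr; exact: closedU.
  by move=> w [/c1].
have dir L : compact L -> (forall H, FF H -> H `&` L !=set0) -> exists2 w, L w & forall H, FF H -> H w.
  by move=> cL HL; apply: directed_compact => //; [exists A|move=> H []].
(* [Q] is the quasi-component of [z]. Once it is known to be connected, it lies in the component and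
   misses [K]; by compactness some single clopen piece then misses [K]. *)
pose Q := [set w | forall H, FF H -> H w].
have QA : Q `<=` A by move=> w; apply.
have Qz : Q z by move=> H [].
have cQ : closed Q.
  move=> w Hw H FH; have [h1 _ _ _] := FH; apply: h1 => B /Hw[u [Qu Bu]].
  by exists u; split=> //; exact: Qu.
have conQ : connected Q.
  apply/connectedP => E [Ene QE [sE1 sE2]].
  wlog Ez : E Ene QE sE1 sE2 / E false z.
    move=> W; have : (E false `|` E true) z by rewrite -QE.
    move=> [|Et]; first exact: W.
    apply: (W (fun b => E (~~ b))) => //; [by rewrite setUC|by rewrite setIC|by rewrite setIC].
  have EQ b : E b `<=` Q by move=> w Ew; rewrite QE; case: b Ew; [right|left].
  have cE b : closed (E b).
    move=> w Hw; have : Q w by apply: cQ; exact: closureS (EQ b) _ Hw.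
    rewrite QE; case: b Hw => Hw [] // Ew; exfalso.
      by have : (E false `&` closure (E true)) w by []; rewrite sE2.
    by have : (closure (E false) `&` E true) w by []; rewrite sE1.
  have kE b : compact (E b) by apply: (subclosed_compact (cE b) cA); exact: subset_trans (EQ b) QA.
  have E0 : E false `&` E true = set0.
    by apply/seteqP; split=> // w [h1 h2]; rewrite -sE1; split=> //; exact: subset_closure.
  have [d d0 Hd] := compact_separation (kE false) (cE true) E0.
  (* Disjoint open neighbourhoods of the two halves. By compactness a member of [FF] lies in their
     union; cut down to [V false] it is still in [FF], yet it excludes the other half of [Q]. *)
  pose V b := [set w | exists2 u, E b u & cabs (w - u) < d / 2].
  have oV b : open (V b).
    apply/openCP => w [u Eu wu]; exists (d / 2 - cabs (w - u)); first by rewrite subr_gt0.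
    by move=> v vw; exists u => //; have := cabs_tri w v u; lra.
  have EV b : E b `<=` V b by move=> w Ew; exists w => //; rewrite subrr cabs0; lra.
  have VV : V false `&` V true = set0.
    apply/seteqP; split=> // w [[u Eu wu] [v Ev wv]]; have := Hd u v Eu Ev.
    by have := cabs_tri w u v; rewrite (cabsB u w); lra.
  have [H FH HV] : exists2 H, FF H & H `<=` V false `|` V true.
    apply: contrapT => noV.
    have [||w [Aw nVw] Hw] := dir (A `\` (V false `|` V true)).
    - apply: (subclosed_compact _ cA); last by move=> w [].
      by apply: closedI => //; apply: open_closedC; exact: openU.
    - move=> H FH; apply: contrapT => emp; apply: noV; exists H => // w Hw.
      apply: contrapT => nV; apply: emp; exists w; split=> //; split=> //.
      by have [_ _ h _] := FH; exact: h.
    - apply: nVw; have : Q w by []. by rewrite QE => -[/EV|/EV]; [left|right].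
  have [h1 h2 h3 h4] := FH.
  have [w Ew] := Ene true.
  have FH' : FF (H `&` V false).
    split.
    - have -> : H `&` V false = H `&` ~` V true.
        apply/seteqP; split=> u [Hu Vu]; split=> //.
          by move=> Vu'; have : (V false `&` V true) u by []; rewrite VV.
        by have [] := HV u Hu.
      by apply: closedI => //; exact: open_closedC.
    - have -> : A `\` (H `&` V false) = (A `\` H) `|` (A `&` ~` V false) by rewrite setDIr.
      by apply: closedU => //; apply: closedI => //; exact: open_closedC.
    - by move=> u [/h3].
    - by split=> //; exact: EV.
  have [_ Vw] := EQ true w Ew _ FH'.
  have : (V false `&` V true) w by split=> //; exact: EV.
  by rewrite VV.
have [||w Kw Hw] := dir (A `&` K).
- by apply: (subclosed_compact _ cA); [exact: closedI|move=> w []].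
- move=> H [h1 h2 h3 h4]; apply: contrapT => emp; apply: noH; exists H; split=> //.
  apply/seteqP; split=> // w [Hw Kw]; apply: emp; exists w; split=> //; split=> //; exact: h3.
- apply: (compK w) Kw.2; exact: (connected_component_max Qz QA conQ).
Qed.

(* The last clause says that the frontier of [K] avoids [A]. *)
Lemma enclose_component A z : closed A -> A z -> ~ unb (connected_component A z) ->
  exists K, [/\ compact K, K z & forall w, K w -> ~ A w \/ exists2 r : R, 0 < r & disc w r `<=` K].
Proof.
move=> cA Az nU.
have [M HM] : exists M, forall w, connected_component A z w -> cabs w <= M.
  by apply/bounded_setCP; apply: contrapT => /unbP.
pose T := M + 1; pose X := A `&` cdisc 0 T.
have cX : compact X.
  apply: (@closed_bounded_compact R X 0 T); last by move=> w [].
  by apply: closedI => //; exact: closed_cdisc.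
have Xz : X z.
  split=> //; rewrite /cdisc /= subr0; have := HM z (connected_component_refl Az).
  by rewrite /T; lra.
pose K0 := ~` disc (0 : C) T.
have [||H [h1 h2 h3 h4 h5]] := @clopen_piece X z cX Xz K0.
- by apply: open_closedC; exact: open_disc.
- move=> w [S [Sz SX cS] Sw] Kw; apply: Kw.
  have : connected_component A z w by exists S => //; split=> //; move=> u /SX[].
  by move=> /HM; rewrite /disc /= subr0 /T; lra.
have cH : compact H by exact: subclosed_compact h1 cX h3.
have HX : H `&` (X `\` H) = set0 by apply/seteqP; split=> // w [Hw []].
have [d d0 Hd] := compact_separation cH h2 HX.
have cK0 : closed K0 by apply: open_closedC; exact: open_disc.
have [d' d'0 Hd'] := compact_separation cH cK0 h5.
pose e := Num.min d d' / 2; have m0 : 0 < Num.min d d' by rewrite lt_min d0.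
have e0 : 0 < e by rewrite divr_gt0.
have : e < Num.min d d' by rewrite /e; lra.
rewrite lt_min => /andP[ed ed'].
(* The closed neighbourhood of [H] of width [e]. A point at distance exactly [e] from [H] is too
   close to lie in X minus [H] or outside the large disc, hence is not in [A]; all other points are
   interior. *)
pose K := [set w | exists2 u, H u & cabs (w - u) <= e].
exists K; split.
- have KT : K `<=` cdisc 0 (T + e).
    move=> w [u Hu wu]; have [_] := h3 u Hu; rewrite /cdisc /= !subr0 => uT.
    by have := cabs_tri u w 0; rewrite !subr0; lra.
  apply: (@closed_bounded_compact R K 0 (T + e)) => // w /closureCP Hw.
  have [u Hu um] := @compact_min R H (fun u => cabs (w - u)) (ex_intro _ z h4) cH
    (fun u _ => cont_cabs (contB (cont_cst _ _) (cont_id _))).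
  exists u => //; apply/ler_addgt0Pl => k k0; have [v [x Hx vx] vw] := Hw k k0.
  by have := um x Hx; have := cabs_tri v w x; rewrite (cabsB w v); lra.
- by exists z => //; rewrite subrr cabs0 ltW.
- move=> w [u Hu]; rewrite le_eqVlt => /orP[/eqP wu|wu]; last first.
    right; exists (e - cabs (w - u)); first by rewrite subr_gt0.
    by move=> v; rewrite /disc /= => vw; exists u => //; have := cabs_tri w v u; lra.
  have [Hw|nHw] := pselect (H w).
    right; exists e => // v vw; exists w => //; exact: ltW.
  left=> Aw; have [Xw|nXw] := pselect (cdisc 0 T w).
    have := Hd u w Hu; rewrite (cabsB u) wu => /(_ _); have : (X `\` H) w by []. 
    by move=> h /(_ h); lra.
  have : K0 w by move=> wT; apply: nXw; rewrite /cdisc /=; exact: ltW.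
  by move=> /(Hd' u w Hu); rewrite (cabsB u) wu; lra.
Qed.

End Topology.

(** * Fast escaping points *)

Section Fast.
Variable R : realType.
Local Notation C := R[i].
Implicit Types (z w u a p c : C) (e t r s d M D L : R) (A S K G : set C) (f g : C -> C).

(** The factor 2 makes the inequality in [fast_step] strict and yields the doubling in
    [sseq_double]. *)
Definition sseq f r (n : nat) : R := iter n (fun s => 2 * maxmod f s) r.

Lemma closed_norm_ge f s : (forall z, cont_at f z) -> closed [set z | s <= cabs (f z)].
Proof.
move=> fc z /closureCP Hz; rewrite /= leNgt; apply/negP => fs.
have e0 : 0 < s - cabs (f z) by rewrite subr_gt0.
have /continuous_CP /(_ _ e0)[d d0 Hd] := fc z.
have [w /= sw /Hd] := Hz d d0; have := cabs_subr (f w) (f z); lra.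
Qed.

Lemma compact_image f K : (forall z, cont_at f z) -> compact K -> compact (f @` K).
Proof.
move=> fc cK; apply: continuous_compact => //; apply: continuous_subspaceT => z.
by have [] := fc z.
Qed.

Lemma ent_nonconstant f : ~ polynomial_fun f -> forall a, exists w, f w != f a.
Proof.
move=> npf a; apply: contrapT => H; apply: npf; exists (f a)%:P => z; rewrite hornerC.
by apply: contrapT => /eqP fz; apply: H; exists z.
Qed.

Section Seq.
Variables (f : C -> C) (r : R).
Hypotheses (r1 : 1 <= r) (fr : forall s, r <= s -> s <= maxmod f s).

Lemma sseq_ge n : r <= sseq f r n.
Proof.
have h1 := r1; elim: n => [|n IH] /=; first exact: lexx.
have := fr IH; have := IH; rewrite /sseq /=; lra.
Qed.

Lemma sseq_double n : 2 * sseq f r n <= sseq f r n.+1.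
Proof. by have h1 := r1; have := fr (sseq_ge n); rewrite /sseq /= -/(sseq f r n); lra. Qed.

Lemma sseq_mono n m : (n <= m)%N -> sseq f r n <= sseq f r m.
Proof.
have h1 := r1; move=> /subnK <-; elim: (m - n)%N => [|k IH]; first exact: lexx.
rewrite addSn; apply: le_trans IH _; have := sseq_double (k + n); have := sseq_ge (k + n); lra.
Qed.

Lemma sseq_unbounded M : exists n, M <= sseq f r n.
Proof.
have h1 := r1; have H n : 2 ^+ n <= sseq f r n.
  elim: n => [|n IH]; first by rewrite expr0.
  by rewrite exprS; have := sseq_double n; lra.
exists (Num.bound M); apply: le_trans (H _); exact/ltW/upper_nthrootP.
Qed.

(** From some index on, each step multiplies by at least 2 (|L| + 1). The surplus 2 ^ m absorbs [D]
    and the first [N1] steps. *)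
Lemma sseq_super L D n0 : (forall K : R, exists2 s0 : R, 1 <= s0 & forall s, s0 <= s -> K * s <= maxmod f s) ->
  exists m, D * L ^+ m < sseq f r (n0 + m).
Proof.
have h1 := r1; move=> gr; pose l := `|L| + 1; have l1 : 1 <= l by rewrite /l; have := normr_ge0 L; lra.
have [s0 s01 Hs] := gr l.
have [N1 HN1] := sseq_unbounded s0; pose N := (n0 + N1)%N.
have sN : s0 <= sseq f r N by apply: le_trans HN1 _; apply: sseq_mono; rewrite /N leq_addl.
have step m : (2 * l) ^+ m <= sseq f r (N + m).
  elim: m => [|m IH]; first by rewrite addn0 expr0; lra.
  have h : s0 <= sseq f r (N + m) by apply: le_trans sN _; apply: sseq_mono; rewrite leq_addr.
  rewrite addnS exprS /sseq /= -/(sseq f r (N + m)).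
  have := Hs _ h; have := ler_wpM2l (_ : 0 <= 2 * l) IH; lra.
pose m := Num.bound (`|D| * l ^+ N1); exists (N1 + m)%N; rewrite addnA -/N.
apply: lt_le_trans (step m).
have D1 : `|D| * l ^+ N1 < 2 ^+ m by apply: upper_nthrootP; exact: leqnn.
apply: le_lt_trans (ler_norm _) _; rewrite normrM normrX exprD mulrA exprMn.
have lm : `|L| ^+ m <= l ^+ m by apply: lerXn2r; rewrite ?nnegrE ?normr_ge0 // /l; have := normr_ge0 L; lra.
have lN : `|L| ^+ N1 <= l ^+ N1 by apply: lerXn2r; rewrite ?nnegrE ?normr_ge0 // /l; have := normr_ge0 L; lra.
have l0 : 0 < l ^+ m by rewrite exprn_gt0 //; lra.
apply: (@le_lt_trans _ _ (`|D| * l ^+ N1 * l ^+ m)).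
  by apply: ler_pM; rewrite ?mulr_ge0 ?exprn_ge0 ?normr_ge0 //; apply: ler_wpM2l.
by rewrite ltr_pM2r.
Qed.

Definition fast_set (l : nat) : set C := [set z | forall n, sseq f r n <= cabs (iter (n + l) f z)].

Hypothesis ef : ent f.

Lemma iter_cont n z : cont_at (iter n f) z.
Proof. exact: ent_continuous (ent_iter n ef) z. Qed.

Lemma closed_fast_set l : closed (fast_set l).
Proof.
move=> z Hz n; have := @closed_norm_ge _ (sseq f r n) (iter_cont (n + l)).
apply; apply: closureS Hz => w; exact.
Qed.

(** A point that is too slow once remains so. The sets of points not yet too slow at time [n] thus
    decrease, as [nested_compact] requires. *)
Lemma fast_step l n z : cabs (iter (n + l) f z) < sseq f r n -> cabs (iter (n.+1 + l) f z) < sseq f r n.+1.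
Proof.
have h1 := r1; move=> h; rewrite addSn /= {1}/sseq /= -/(sseq f r n).
have := maxmod_ge (ent_continuous ef) (ltW h); have := fr (sseq_ge n); have := sseq_ge n; lra.
Qed.

(* Otherwise the maximum principle fails on a compact neighbourhood of the component. *)
Lemma fast_component l z : fast_set l z -> unb (connected_component (fast_set l) z).
Proof.
have h1 := r1; move=> Az; apply: contrapT => nU.
have [K [cK Kz HK]] := enclose_component (@closed_fast_set l) Az nU.
pose Fr : set C := [set w | K w /\ forall e, 0 < e -> ~ (disc w e `<=` K)].
have clK : closed K by exact: compact_closed (@norm_hausdorff _ _) cK.
have clFr : closed Fr.
  move=> w Hw; split; first by apply: clK; apply: closureS Hw => u [].
  move=> e e0 wK; have e2 : 0 < e / 2 by lra.
  move/closureCP: Hw => /(_ _ e2)[u [_ nu] uw]; apply: (nu (e / 2)) => // v vu; apply: wK.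
  by rewrite /disc /= in vu *; have := cabs_tri u v w; lra.
have cFr : compact Fr by apply: (subclosed_compact clFr cK) => w [].
have FrA w : Fr w -> ~ fast_set l w.
  by move=> [Kw nw]; have [//|[e e0 /nw]] := HK w Kw; move=> /(_ e0).
have int w : K w -> Fr w \/ exists2 e : R, 0 < e & disc w e `<=` K.
  move=> Kw; have [H|H] := pselect (exists2 e : R, 0 < e & disc w e `<=` K); first by right.
  by left; split=> // e e0 He; apply: H; exists e.
(* No frontier point is fast, so each fails at some time; by compactness one [n] serves them all,
   and with a margin [M] below s_n. The maximum principle carries [M] to [z], which is fast. *)
have [n Hn] : exists n, forall w, Fr w -> cabs (iter (n + l) f w) < sseq f r n.
  apply: contrapT => H.
  have [w Hw] : exists w, forall n, (Fr `&` [set w | sseq f r n <= cabs (iter (n + l) f w)]) w.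
    apply: nested_compact => [|n|n|n].
    - apply: (subclosed_compact _ cFr); last by move=> w [].
      by apply: closedI => //; apply: closed_norm_ge => w; exact: iter_cont.
    - by apply: closedI => //; apply: closed_norm_ge => w; exact: iter_cont.
    - move=> w [Fw h]; split=> //=; rewrite leNgt; apply/negP => h2.
      by move: h; rewrite /= leNgt => /negP; apply; exact: fast_step.
    - apply: contrapT => em; apply: H; exists n => w Fw; rewrite ltNge; apply/negP => h.
      by apply: em; exists w.
  by apply: (FrA w); [have [] := Hw 0%N|move=> n; have [] := Hw n].
have [M Ms HM] : exists2 M, M < sseq f r n & forall w, Fr w -> cabs (iter (n + l) f w) <= M.
  have [Fr0|/set0P Fr0] := eqVneq Fr set0.
    by exists (sseq f r n - 1); [lra|rewrite Fr0].
  have [c Fc cM] := compact_max Fr0 cFr (fun w _ => cont_cabs (iter_cont (n + l) w)).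
  by exists (cabs (iter (n + l) f c)); [exact: Hn|].
have := @max_principle R K _ M (ent_iter (n + l) ef) cK _ z Kz.
have H : forall w, K w -> cabs (iter (n + l) f w) <= M \/ exists2 e : R, 0 < e & disc w e `<=` K.
  by move=> w /int[/HM|]; [left|right].
by move=> /(_ H); have := Az n; lra.
Qed.

End Seq.

(** [K] with the bounded components of its complement filled in, phrased so that a point surrounded
    by a circle in [K] belongs to it at once. *)
Definition hull K : set C := [set w | forall G, connected G -> unb G -> G w -> G `&` K !=set0].

Lemma hull_sub K : K `<=` hull K. Proof. by move=> w Kw G _ _ Gw; exists w. Qed.

Lemma hull_interior K w : closed K -> hull K w -> ~ K w -> exists2 e : R, 0 < e & disc w e `<=` hull K.
Proof.
move=> cK Hw nKw; have oK : open (~` K) by exact: closed_openC.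
have [e e0 He] := (openCP _).1 oK w nKw; exists e => // v vw G cG uG Gv.
apply: contrapT => em; have cU : connected (G `|` disc w e).
  by apply: connectedU => //; [exists v|exact: connected_disc].
have [|u [[Gu|uw] Ku]] := Hw _ cU (unb_sub (@subsetUl _ _ _) uG).
- by right; rewrite /disc /= subrr cabs0.
- by apply: em; exists u.
- exact: He Ku.
Qed.

Lemma hull_closed K : closed K -> closed (hull K).
Proof.
move=> cK w Hw; apply: contrapT => nw.
have [G [cG uG Gw GK]] : exists G, [/\ connected G, unb G, G w & G `&` K = set0].
  apply: contrapT => H; apply: nw => G cG uG Gw; apply: contrapT => em; apply: H; exists G; split=> //.
  by apply/seteqP; split=> // u Hu; apply: em; exists u.
have nKw : (~` K) w by move=> Kw; have : (G `&` K) w by []; rewrite GK.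
have [e e0 He] := (openCP _).1 (closed_openC cK) w nKw.
have [v Hv vw] := (closureCP _ _).1 Hw e e0.
have cU : connected (G `|` disc w e).
  by apply: connectedU => //; [exists w; split=> //; rewrite /disc /= subrr cabs0|exact: connected_disc].
have [|u [[Gu|uw] Ku]] := Hv _ cU (unb_sub (@subsetUl _ _ _) uG); first by right.
- by have : (G `&` K) u by []; rewrite GK.
- exact: He Ku.
Qed.

Lemma hull_bounded K M : 0 <= M -> (forall z, K z -> cabs z <= M) -> forall z, hull K z -> cabs z <= M.
Proof.
move=> M0 KM z Hz; rewrite leNgt; apply/negP => Mz.
have z0 : 0 < cabs z by lra.
have [||_ [[t + <-] /KM]] := Hz _ (@connected_ray R z (2 * z)).
- move=> B; exists (cpath z (2 * z) (`|B| / cabs z)).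
    by exists (`|B| / cabs z) => //; rewrite /= in_itv /= andbT divr_ge0 // ltW.
  rewrite /cpath (_ : _ + _ = rc (1 + `|B| / cabs z) * z); last by rewrite rcD rc1; ring.
  have h : 0 <= `|B| / cabs z by rewrite divr_ge0 // ltW.
  rewrite cabsM cabs_rc ger0_norm; last by lra.
  by rewrite mulrDl divfK ?gt_eqF // mul1r; have := ler_norm B; lra.
- by exists 0; [rewrite /= in_itv /= lexx|rewrite /cpath rc0; ring].
rewrite /= in_itv /= andbT => t0.
rewrite /cpath (_ : _ + _ = rc (1 + t) * z); last by rewrite rcD rc1; ring.
rewrite cabsM cabs_rc ger0_norm; last by lra.
have := mulr_ge0 t0 (ltW z0); lra.
Qed.

Lemma circle_hull K S w : has_circle S w -> S `<=` K -> hull K w.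
Proof.
move=> [t t0 Ht] SK G cG uG Gw.
have [y Gy yt] := uG (t + cabs w).
have [|z Gz zt] := @connected_circle R G w w y t cG Gw Gy.
  by rewrite subrr cabs0 t0 /=; have := cabs_subr y w; lra.
by exists z; split=> //; apply/SK/Ht.
Qed.

Definition frontier K : set C := [set w | K w /\ forall e, 0 < e -> ~ (disc w e `<=` K)].

Lemma frontier_exists K : compact K -> (exists2 w, K w & w != 0) -> frontier K !=set0.
Proof.
move=> cK [w0 Kw0 w00].
have [c Kc cM] := @compact_max R K (@cabs R) (ex_intro _ w0 Kw0) cK (fun w _ => cabs_continuous w).
have c0 : 0 < cabs c by apply: lt_le_trans (cM _ Kw0); rewrite cabs_gt0.
exists c; split=> // e e0 eK.
have t0 : 0 < e / 2 / cabs c by rewrite !divr_gt0.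
have := cM (c + rc (e / 2 / cabs c) * c); have E : c + rc (e / 2 / cabs c) * c - c = rc (e / 2 / cabs c) * c by ring.
have N : cabs (rc (e / 2 / cabs c) * c) = e / 2.
  by rewrite cabsM cabs_rc gtr0_norm // divfK // gt_eqF.
have N2 : cabs (c + rc (e / 2 / cabs c) * c) = cabs c + e / 2.
  rewrite (_ : c + _ = rc (1 + e / 2 / cabs c) * c); last by rewrite rcD rc1; ring.
  rewrite cabsM cabs_rc ger0_norm; last by lra.
  by rewrite mulrDl mul1r divfK // gt_eqF.
rewrite N2 => H; suff : cabs c + e / 2 <= cabs c by lra.
by apply/H/eK; rewrite /disc /= E N; lra.
Qed.

(** Filling holes creates no frontier points, and an open map sends no interior point to a frontier
    point. *)
Lemma frontier_hull_image f K : ent f -> ~ polynomial_fun f -> compact K ->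
  frontier (hull (f @` K)) `<=` f @` frontier K.
Proof.
move=> ef npf cK w [Hw nint]; have cfK := compact_image (ent_continuous ef) cK.
have clfK : closed (f @` K) by exact: compact_closed (@norm_hausdorff _ _) cfK.
have [z Kz fz] : (f @` K) w.
  apply: contrapT => nw; have [e e0 He] := hull_interior clfK Hw nw; exact: nint He.
exists z => //; split=> // e e0 eK.
have [d d0 Hd] := open_mapping ef (ent_nonconstant npf z) e0.
apply: (nint d) => // v vw; apply: hull_sub; have [|u uz fu] := Hd v; first by rewrite fz.
by exists u => //; exact: eK.
Qed.

(* Dominguez' construction of a fast escaping point: the iterated hulls [Kn] of images of a
   disc contain large discs by [landau], and frontier points can be pulled back to the
   first circle. *)
Lemma fast_point f : ent f -> ~ polynomial_fun f -> exists2 r : R, 1 <= r &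
  (forall s, r <= s -> s <= maxmod f s) /\ exists z, fast_set f r 0 z.
Proof.
move=> ef npf; have [L L1 HL] := @landau R.
(* A point [w] with |w| < 4 s_(n+1) = 8 maxmod f s_n not surrounded by the image of the disc of
   radius 4 s_n would give, by [landau] on the half disc, |f| <= |w| + L (|f 0| + |w|) up to radius
   2 s_n. The constant makes [growth] forbid this. *)
have [r1 r11 Hr] := growth (8 * (1 + L) + L * cabs (f 0) + 1) ef npf.
have gr s : r1 <= s -> s <= maxmod f s.
  move=> rs; have [_] := Hr s rs.
  have h : 0 <= 8 * (1 + L) + L * cabs (f 0) by rewrite addr_ge0 ?mulr_ge0 ?cabs_ge0 //; lra.
  have := mulr_ge0 h (_ : 0 <= s); lra.
exists r1 => //; split=> //.
pose s := sseq f r1; have sr n : r1 <= s n by exact: sseq_ge.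
have smax n : s n <= maxmod f (s n) by exact: gr.
pose Kn n := iter n (fun K => hull (f @` K)) (cdisc 0 (4 * r1)).
have cKn n : compact (Kn n).
  elim: n => [|n IH]; first exact: compact_cdisc.
  have cfK := compact_image (ent_continuous ef) IH.
  have clfK : closed (f @` Kn n) by exact: compact_closed (@norm_hausdorff _ _) cfK.
  have [M HM] := compact_cabs_bounded cfK.
  apply: (@closed_bounded_compact R _ 0 (Num.max 0 M)); first exact: hull_closed.
  move=> z; rewrite /cdisc /= subr0; apply: hull_bounded; first by rewrite le_max lexx.
  by move=> u /HM; rewrite le_max orbC => ->.
have dKn n : disc 0 (4 * s n) `<=` Kn n.
  elim: n => [|n IH]; first by move=> w; rewrite /disc /cdisc /= => /ltW.
  move=> w; rewrite /disc /= subr0 => wn.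
  have s4 : 0 < 4 * s n by have := sr n; lra.
  apply: (@circle_hull _ (f @` disc 0 (4 * s n))); last by move=> u [v /IH Kv <-]; exists v.
  apply: contrapT => nc.
  have H z : cabs z <= 2 * s n -> cabs (f z) <= cabs w + L * (cabs (f 0) + cabs w).
    move=> zs; have [|h _] := HL f w 0 _ ef s4 nc z; first by rewrite subr0; lra.
    have h1 := cabs_subr (f z) w; have := ler_wpM2l (_ : 0 <= L) (cabsBD (f 0) w); lra.
  have s20 : 0 <= 2 * s n by lra.
  have [z zs E] := (maxmodP (ent_continuous ef) s20).2.
  have := H z zs; rewrite E; have [h1 _] := Hr (s n) (sr n).
  move: wn; rewrite {1}/s /sseq /= -/(sseq f r1 n) -/(s n) => wn.
  have f0 := cabs_ge0 (f 0); have m1 : 1 <= maxmod f (s n) by have := smax n; have := sr n; lra.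
  have h2 : L * cabs w <= L * (8 * maxmod f (s n)) by apply: ler_wpM2l; lra.
  have h3 : L * cabs (f 0) * 1 <= L * cabs (f 0) * maxmod f (s n).
    by apply: ler_wpM2l => //; rewrite mulr_ge0 //; lra.
  nra.
have frn n w : frontier (Kn n) w -> s n <= cabs w.
  move=> [_ nint]; rewrite leNgt; apply/negP => ws.
  have := sr n => srn; apply: (nint (s n)); first by lra.
  move=> v vw; apply: dKn; rewrite /disc /= subr0; rewrite /disc /= in vw.
  by have := cabs_subr v w; lra.
have back n w : frontier (Kn n) w -> exists z, [/\ cdisc 0 (4 * r1) z, iter n f z = w &
    forall k, (k <= n)%N -> s k <= cabs (iter k f z)].
  elim: n w => [|n IH] w Fw.
    exists w; split=> //; first by have [] := Fw.
    by move=> k; rewrite leqn0 => /eqP->; exact: frn Fw.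
  have [u Fu fu] := frontier_hull_image ef npf (cKn n) Fw.
  have [z [zr zn Hz]] := IH u Fu; exists z; split=> //; first by rewrite /= zn.
  by move=> k; rewrite leq_eqVlt => /orP[/eqP->|/Hz//]; rewrite /= zn fu; exact: frn Fw.
(* Frontier points of [Kn n] give starting points that are fast up to time [n]; compactness of the
   first disc yields one that is fast for ever. *)
have [z Hz] : exists z, forall n, (cdisc 0 (4 * r1) `&` [set z | forall k, (k <= n)%N -> s k <= cabs (iter k f z)]) z.
  have cl n : closed [set z | forall k, (k <= n)%N -> s k <= cabs (iter k f z)].
    move=> z Hz k kn; have := @closed_norm_ge _ (s k) (iter_cont ef k).
    by apply; apply: closureS Hz => w /(_ k kn).
  apply: nested_compact => [|n|n|n].
  - apply: (subclosed_compact _ (@compact_cdisc R 0 (4 * r1))); last by move=> w [].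
    by apply: closedI => //; exact: closed_cdisc.
  - by apply: closedI => //; exact: closed_cdisc.
  - by move=> z [zr Hz]; split=> // k kn; apply: Hz; exact: leqW.
  - have s0 := sr n.
    have [w Fw] : frontier (Kn n) !=set0.
      apply: frontier_exists => //; exists 1; last by rewrite oner_neq0.
      by apply: dKn; rewrite /disc /= subr0 cabs1; lra.
    by have [z [zr _ Hz]] := back n w Fw; exists z.
by exists z => n; rewrite addn0; have [_] := Hz n; apply.
Qed.

End Fast.

(** * Potentials of disjoint images *)

Section Grid.
Variable R : realType.
Local Notation C := R[i].
Local Notation I := ('i%C : C).
Implicit Types (z w u c o : C) (e t r s d B V : R) (S : set C) (k i j n N : nat).

(** One partial sum comes within [e] of the supremum of all of them. By monotonicity in the second
    index it stays there for larger [k], and smaller [k] are dominated. *)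
Lemma monotone_tail (a : nat -> nat -> R) V e : (forall n k, 0 <= a n k) ->
  (forall n k, a n k <= a n k.+1) -> (forall N k, \sum_(0 <= n < N) a n k <= V) -> 0 < e ->
  exists N0, forall N k, \sum_(N0 <= n < N) a n k <= e.
Proof.
move=> a0 am aV e0.
have mono n k k' : (k <= k')%N -> a n k <= a n k'.
  by move=> /subnK <-; elim: (k' - k)%N => // l IH; exact: le_trans IH (am _ _).
pose E : set R := [set x | exists N k, x = \sum_(0 <= n < N) a n k].
have supE : has_sup E.
  split; first by exists (\sum_(0 <= n < 0) a n 0%N); exists 0%N, 0%N.
  by exists V => x [N [k ->]].
have [x [N0 [k0 xE]] xs] := sup_adherent e0 supE.
exists N0 => N k; have [NN|NN] := leqP N N0; first by rewrite big_geq // ltW.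
pose k' := maxn k k0.
have h1 : \sum_(0 <= n < N) a n k' <= sup E by apply: sup_upper_bound => //; exists N, k'.
rewrite (@big_cat_nat _ _ _ N0) //= in h1; last exact: ltnW.
have h2 : x <= \sum_(0 <= n < N0) a n k'.
  by rewrite xE; apply: ler_sum => n _; apply: mono; exact: leq_maxr.
have h3 : \sum_(N0 <= n < N) a n k <= \sum_(N0 <= n < N) a n k'.
  by apply: ler_sum => n _; apply: mono; exact: leq_maxl.
lra.
Qed.

Definition mesh k : R := 2 ^- k.

Lemma mesh_gt0 k : 0 < mesh k. Proof. by rewrite invr_gt0 exprn_gt0. Qed.

Lemma mesh_le1 k : mesh k <= 1.
Proof. by rewrite invf_le1 ?exprn_gt0 // exprn_ege1 // ler1n. Qed.

Lemma mesh_half k : mesh k = 2 * mesh k.+1.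
Proof. by rewrite /mesh exprS invfM mulrA mulfV // mul1r. Qed.

Lemma mesh_small e : 0 < e -> exists k, mesh k < e.
Proof.
move=> e0; exists (Num.bound e^-1); rewrite /mesh invf_plt ?posrE ?exprn_gt0 //.
exact: upper_nthrootP.
Qed.

Definition square o k i j : set C := [set w |
  i%:R * mesh k <= complex.Re (w - o) <= i.+1%:R * mesh k /\
  j%:R * mesh k <= complex.Im (w - o) <= j.+1%:R * mesh k].

Definition corner o k i j : C := o + (rc (i%:R * mesh k) + I * rc (j%:R * mesh k)).

Lemma corner_square o k i j : square o k i j (corner o k i j).
Proof.
have m0 := mesh_gt0 k.
rewrite /square /=.
have -> : corner o k i j - o = rc (i%:R * mesh k) + I * rc (j%:R * mesh k) by rewrite /corner; ring.
rewrite cReD cImD cReM cImM /= !(mul0r, mul1r, mulr0, subr0, addr0, add0r) -!natr1 !mulrDl.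
by split; lra.
Qed.

Lemma square_dist o k i j w u : square o k i j w -> square o k i j u -> cabs (w - u) <= 2 * mesh k.
Proof.
move=> [w1 w2] [u1 u2]; apply: le_trans (cabs_le_ReIm _) _.
move: w1 w2 u1 u2; rewrite !(cReB, cImB) -!natr1 !mulrDl => w1 w2 u1 u2.
have h1 : `|complex.Re w - complex.Re u| <= mesh k by rewrite ler_norml; lra.
have h2 : `|complex.Im w - complex.Im u| <= mesh k by rewrite ler_norml; lra.
lra.
Qed.

Lemma square_sub o k i j (b c : bool) : square o k.+1 (i.*2 + b) (j.*2 + c) `<=` square o k i j.
Proof.
move=> w [w1 w2]; move: w1 w2; rewrite /square /= (mesh_half k) -!natr1 !natrD -!mul2n !natrM.
have m0 := mesh_gt0 k.+1.
have bm (x : bool) : 0 <= x%:R * mesh k.+1 <= mesh k.+1.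
  by case: x; rewrite ?mul0r ?mul1r ?lexx ?(ltW m0).
have := bm b; have := bm c; move: (mesh k.+1) => m b1 c1 w1 w2.
by rewrite !mulrDl in w1 w2 *; split; lra.
Qed.

Lemma square_mem o k (n : nat) w : 0 <= complex.Re (w - o) < n%:R -> 0 <= complex.Im (w - o) < n%:R ->
  exists i j, [/\ (i < n * 2 ^ k)%N, (j < n * 2 ^ k)%N & square o k i j w].
Proof.
have H x : 0 <= x < n%:R -> exists2 i, (i < n * 2 ^ k)%N & i%:R * mesh k <= x <= i.+1%:R * mesh k.
  move=> /andP[x0 xn]; have p0 : (0 : R) < 2 ^+ k by rewrite exprn_gt0.
  have y0 : 0 <= x * 2 ^+ k by rewrite mulr_ge0 // ltW.
  have := truncn_itv y0 => /andP[h1 h2]; exists (Num.truncn (x * 2 ^+ k)).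
    rewrite -(ltr_nat R) natrM natrX; apply: le_lt_trans h1 _.
    by rewrite ltr_pM2r.
  by rewrite /mesh ler_pdivrMr // ler_pdivlMr // h1 ltW.
by move=> /H[i i1 i2] /H[j j1 j2]; exists i, j.
Qed.

Definition ind (P : Prop) : R := (`[< P >])%:R.

Lemma ind_ge0 (P : Prop) : 0 <= ind P. Proof. exact: ler0n. Qed.

Lemma ind1 (P : Prop) : P -> ind P = 1.
Proof. by move=> p; rewrite /ind asboolT. Qed.

Lemma ind0 (P : Prop) : ~ P -> ind P = 0.
Proof. by move=> p; rewrite /ind asboolF. Qed.

Lemma ind_le (P Q : Prop) : (P -> Q) -> ind P <= ind Q.
Proof.
move=> PQ; have [p|np] := pselect P; first by rewrite !ind1 //; exact: PQ.
by rewrite (ind0 np) ind_ge0.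
Qed.

Lemma sum_ind_le1 (P : nat -> Prop) N : (forall n m, P n -> P m -> n = m) ->
  \sum_(0 <= n < N) ind (P n) <= 1.
Proof.
move=> uP; elim: N => [|N IH]; first by rewrite big_geq.
rewrite big_nat_recr //=; have [p|np] := pselect (P N); last by rewrite (ind0 np) addr0.
rewrite big_nat big1 ?add0r ?ind1 // => n /andP[_ nN]; apply: ind0 => pn.
by rewrite (uP _ _ pn p) ltnn in nN.
Qed.

Definition count o (n : nat) S k : R :=
  \sum_(0 <= i < n * 2 ^ k) \sum_(0 <= j < n * 2 ^ k) ind (square o k i j `<=` S).

Lemma big_double (g : nat -> R) n :
  \sum_(0 <= i < n.*2) g i = \sum_(0 <= i < n) (g (i.*2 + false)%N + g (i.*2 + true)%N).
Proof.
elim: n => [|n IH]; first by rewrite !big_geq.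
by rewrite doubleS !big_nat_recr //= IH addn0 addn1 addrA.
Qed.

(** Inner Jordan content inside the grid. It only grows when the mesh is halved, and stands in for
    Lebesgue measure. *)
Definition area o n S k : R := count o n S k * mesh k ^+ 2.

Lemma area_ge0 o n S k : 0 <= area o n S k.
Proof.
apply: mulr_ge0; last exact: sqr_ge0.
by apply: sumr_ge0 => i _; apply: sumr_ge0 => j _; exact: ind_ge0.
Qed.

Lemma area_mono o n S k : area o n S k <= area o n S k.+1.
Proof.
rewrite /area (mesh_half k) exprMn mulrA; apply: ler_wpM2r; first exact: sqr_ge0.
rewrite /count expnS mulnCA mul2n big_double mulr_suml; apply: ler_sum => i _.
rewrite !big_double -big_split mulr_suml; apply: ler_sum => j _ /=.
have h (b c : bool) : ind (square o k i j `<=` S) <= ind (square o k.+1 (i.*2 + b) (j.*2 + c) `<=` S).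
  by apply: ind_le => H; exact: subset_trans (@square_sub _ _ _ _ b c) H.
have := h false false; have := h false true; have := h true false; have := h true true; lra.
Qed.

(** Each square lies in at most one of the disjoint sets, as its corner shows. *)
Lemma area_sum o n (S : nat -> set C) k N : (forall m m' w, S m w -> S m' w -> m = m') ->
  \sum_(0 <= m < N) area o n (S m) k <= n%:R ^+ 2.
Proof.
move=> disj; rewrite /area -mulr_suml /count exchange_big /=.
have H i : \sum_(0 <= m < N) \sum_(0 <= j < n * 2 ^ k) ind (square o k i j `<=` S m) <= (n * 2 ^ k)%:R.
  rewrite exchange_big /=; apply: (@le_trans _ _ (\sum_(0 <= j < n * 2 ^ k) 1)); last first.
    by rewrite sumr_const_nat subn0.
  apply: ler_sum => j _; apply: sum_ind_le1 => m m' h h'.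
  by apply: (disj _ _ (corner o k i j)); [apply: h|apply: h']; exact: corner_square.
have {}H : \sum_(0 <= i < n * 2 ^ k) \sum_(0 <= m < N) \sum_(0 <= j < n * 2 ^ k) ind (square o k i j `<=` S m)
    <= (n * 2 ^ k)%:R * (n * 2 ^ k)%:R.
  apply: (@le_trans _ _ (\sum_(0 <= i < n * 2 ^ k) (n * 2 ^ k)%:R)); first by apply: ler_sum.
  by rewrite sumr_const_nat subn0 -[X in X <= _]mulr_natl lexx.
have p0 : (0 : R) < 2 ^+ k by rewrite exprn_gt0.
apply: (@le_trans _ _ ((n * 2 ^ k)%:R * (n * 2 ^ k)%:R * mesh k ^+ 2)).
  by apply: ler_wpM2r => //; exact: sqr_ge0.
by rewrite natrM natrX /mesh le_eqVlt; apply/orP; left; apply/eqP; field; rewrite gt_eqF.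
Qed.

End Grid.

(** * Superharmonic cut-offs *)

Section Potential.
Variable R : realType.
Local Notation C := R[i].
Local Notation I := ('i%C : C).
Implicit Types (z w u c o b : C) (e t r s d A B K lam : R) (S : set C) (k i j n m q : nat) (g : C -> C).

Lemma le_sum_nat (y : nat -> R) n i : (forall j, 0 <= y j) -> (i < n)%N -> y i <= \sum_(0 <= j < n) y j.
Proof.
move=> y0; elim: n => // n IH; rewrite ltnS leq_eqVlt => /orP[/eqP->|/IH h].
  by rewrite big_nat_recr //= lerDr; apply: sumr_ge0 => j _.
by rewrite big_nat_recr //=; apply: le_trans h _; rewrite lerDl.
Qed.

Definition superharmonic_at (v : C -> R) z := exists2 L, lap2 v z L & L <= 0.

Lemma superharmonic_sum (s : seq nat) (v : nat -> C -> R) z :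
  (forall j, j \in s -> superharmonic_at (v j) z) -> superharmonic_at (fun w => \sum_(j <- s) v j w) z.
Proof.
elim: s => [|j s IH] H.
  exists 0 => //; have -> : (fun w => \sum_(j <- [::]) v j w) = fun=> 0 by apply/funext => w; rewrite big_nil.
  exact: lap2_cst.
have -> : (fun w => \sum_(l <- j :: s) v l w) = fun w => v j w + \sum_(l <- s) v l w.
  by apply/funext => w; rewrite big_cons.
have [|L1 h1 l1] := H j; first by rewrite inE eqxx.
have [|L2 h2 l2] := IH; first by move=> l ls; apply: H; rewrite inE ls orbT.
by exists (L1 + L2); [exact: lap2D|lra].
Qed.

Lemma cont_sum (s : seq nat) (v : nat -> C -> R) z :
  (forall j, j \in s -> cont_at (v j) z) -> cont_at (fun w => \sum_(j <- s) v j w) z.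
Proof.
elim: s => [|j s IH] H.
  have -> : (fun w => \sum_(j <- [::]) v j w) = fun=> 0 by apply/funext => w; rewrite big_nil.
  exact: cont_cst.
have -> : (fun w => \sum_(l <- j :: s) v l w) = fun w => v j w + \sum_(l <- s) v l w.
  by apply/funext => w; rewrite big_cons.
apply: cont_realD; first by apply: H; rewrite inE eqxx.
by apply: IH => l ls; apply: H; rewrite inE ls orbT.
Qed.

(** The logarithmic potential of one square, with mass proportional to its area and smoothed at the
    scale 2 [mesh], which bounds distances inside the square. The term ln |w - b| ^ 2, harmonic off
    [b], keeps it bounded at infinity. *)
Definition log_term b K o k i j w : R :=
  (2 * mesh R k) ^+ 2 * (ln K + (ln (cabs (w - b) ^+ 2) +
     -1 * ln (cabs (w - corner o k i j) ^+ 2 + (2 * mesh R k) ^+ 2))).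

(* A cut-off [cube_pos] made superharmonic on [S] by adding logarithmic potentials of the
   grid squares contained in [S]; the factor [|w - b| ^ 2] keeps it nonnegative away from [b]. *)
Definition hpot b B K o k n S w : R := cube_pos (B - cabs (w - b) ^+ 2) + 24 * B ^+ 2 *
  \sum_(0 <= i < n * 2 ^ k) \sum_(0 <= j < n * 2 ^ k) ind R (square o k i j `<=` S) * log_term b K o k i j w.

Lemma ent_shift g b : ent g -> ent (fun z => g z - b).
Proof. by move=> eg; apply: entB => //; exact: ent_cst. Qed.

Lemma cder_shift g b z : ent g -> cder (fun z => g z - b) z = cder g z.
Proof. by move=> eg; apply: cder_eq; have := cdiffB (cderP z eg) (cdiff_cst b z); rewrite subr0. Qed.

Lemma lap2_ln_plus g z e : ent g -> 0 < e -> lap2 (fun w => ln (cabs (g w) ^+ 2 + e)) z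
  (2 * cabs (cder g z) ^+ 2 * (e / (cabs (g z) ^+ 2 + e) ^+ 2)).
Proof.
move=> eg e0; set N := cabs (g z) ^+ 2; have N0 : 0 < N + e by have := sqr_ge0 (cabs (g z)); rewrite -/N; lra.
have H : peano2 (fun h => ln (N + h + e)) (ln (N + e)) (N + e)^-1 (- (N + e) ^- 2 / 2).
  by have := peano2_ln N0; apply: (peano2_local (d := 1)) => // h _; rewrite addrAC.
have := @lap2_normsq R (fun x => ln (x + e)) g z _ _ _ eg H.
rewrite -/N; set L := _ * _; set L' := _ * _; have -> // : L = L'.
by rewrite /L /L'; congr (_ * _); field; rewrite gt_eqF.
Qed.

Lemma lap2_term g b K o k i j z : ent g -> g z != b -> lap2 (fun w => log_term b K o k i j (g w)) z
  ((2 * mesh R k) ^+ 2 * (0 + (0 + -1 * (2 * cabs (cder g z) ^+ 2 *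
    ((2 * mesh R k) ^+ 2 / (cabs (g z - corner o k i j) ^+ 2 + (2 * mesh R k) ^+ 2) ^+ 2))))).
Proof.
move=> eg gb; have m0 := mesh_gt0 R k.
apply: lap2Z; apply: lap2D; first exact: lap2_cst.
apply: lap2D.
  by apply: (lap2_ln_dist (ent_shift b eg)); rewrite subr_eq0.
apply: lap2Z; have e0 : 0 < (2 * mesh R k) ^+ 2 by rewrite exprn_gt0 //; lra.
by have := lap2_ln_plus z (ent_shift (corner o k i j) eg) e0; rewrite cder_shift.
Qed.

Lemma lap2_cube g b B z (s := Num.max 0 (B - cabs (g z - b) ^+ 2)) : ent g ->
  lap2 (fun w => cube_pos (B - cabs (g w - b) ^+ 2)) z
    (2 * cabs (cder g z) ^+ 2 * (3 * s ^+ 2 * -1 + 2 * (3 * s) * cabs (g z - b) ^+ 2)).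
Proof.
move=> eg; set N := cabs (g z - b) ^+ 2.
have Hp : peano2 (fun h => B - (N + h)) (B - N) (- 1) 0.
  by have := @peano2_affine R (B - N) (-1); apply: (peano2_local (d := 1)) => // h _; ring.
have := peano2_comp (F := @cube_pos R) (@peano2_cube_pos R (B - N)) Hp.
have -> : 3 * Num.max 0 (B - N) ^+ 2 * 0 + 3 * Num.max 0 (B - N) * (-1) ^+ 2 = 3 * s by rewrite /s -/N; ring.
move=> H; have := @lap2_normsq R (fun x => cube_pos (B - x)) _ z _ _ _ (ent_shift b eg) H.
by rewrite cder_shift.
Qed.

(** The cut-off contributes at most 12 G s N <= 12 G B ^ 2. The one square containing [g z]
    contributes at least G / 2 in the opposite direction, whence the factor 24 B ^ 2. Where N >= B
    the cut-off contributes nothing. *)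
Lemma hpot_superharmonic g b B K o k n S z : ent g -> g z != b ->
  (cabs (g z - b) ^+ 2 < B -> exists i j, [/\ (i < n * 2 ^ k)%N, (j < n * 2 ^ k)%N,
     square o k i j (g z) & square o k i j `<=` S]) ->
  superharmonic_at (fun w => hpot b B K o k n S (g w)) z.
Proof.
move=> eg gb cover; set G := cabs (cder g z) ^+ 2; set N := cabs (g z - b) ^+ 2.
have G0 : 0 <= G by exact: sqr_ge0.
have m0 := mesh_gt0 R k; pose eta : R := (2 * mesh R k) ^+ 2.
have eta0 : 0 < eta by rewrite exprn_gt0 //; lra.
pose y i j : R := ind R (square o k i j `<=` S) * (eta * (2 * G * (eta / (cabs (g z - corner o k i j) ^+ 2 + eta) ^+ 2))).
have Nc0 i j : 0 < cabs (g z - corner o k i j) ^+ 2 + eta.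
  by have := sqr_ge0 (cabs (g z - corner o k i j)); lra.
have y0 i j : 0 <= y i j.
  rewrite /y; apply: mulr_ge0; first exact: ind_ge0.
  by apply: mulr_ge0; [exact: ltW|apply: mulr_ge0; [lra|apply: divr_ge0; [exact: ltW|exact: sqr_ge0]]].
have H1 := lap2_cube b B z eg; rewrite -/G -/N in H1.
set s := Num.max 0 (B - N) in H1.
have s0 : 0 <= s by rewrite /s le_max lexx.
pose T : R := \sum_(0 <= i < n * 2 ^ k) \sum_(0 <= j < n * 2 ^ k) y i j.
have H2 : lap2 (fun w => \sum_(0 <= i < n * 2 ^ k) \sum_(0 <= j < n * 2 ^ k) ind R (square o k i j `<=` S) * log_term b K o k i j (g w)) z (- T).
  have -> : - T = \sum_(0 <= i < n * 2 ^ k) \sum_(0 <= j < n * 2 ^ k) ind R (square o k i j `<=` S) *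
     (eta * (0 + (0 + -1 * (2 * G * (eta / (cabs (g z - corner o k i j) ^+ 2 + eta) ^+ 2))))).
    rewrite -sumrN; apply: eq_bigr => i _; rewrite -sumrN; apply: eq_bigr => j _.
    by rewrite /y !add0r; ring.
  apply: lap2_sum => i; apply: lap2_sum => j; apply: lap2Z; exact: lap2_term.
eexists; first exact: lap2D H1 (lap2Z (24 * B ^+ 2) H2).
have T0 : 0 <= T by apply: sumr_ge0 => i _; apply: sumr_ge0 => j _; exact: y0.
have [NB|NB] := ltP N B; last first.
  have -> : s = 0 by rewrite /s max_l //; lra.
  have := mulr_ge0 (mulr_ge0 (_ : 0 <= 24) (sqr_ge0 B)) T0; rewrite expr0n /= !mulr0 !mul0r addr0 mulr0; lra.
have N0 : 0 <= N by exact: sqr_ge0.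
have sB : s <= B by rewrite /s ge_max; lra.
have [i [j [ik jk sq sS]]] := cover NB.
have yT : G / 2 <= T.
  apply: (@le_trans _ _ (y i j)); last first.
    apply: le_trans (le_sum_nat (y0 i) jk) _.
    apply: (@le_sum_nat (fun i => \sum_(0 <= j < n * 2 ^ k) y i j)) => // l.
    by apply: sumr_ge0 => l' _; exact: y0.
  rewrite /y ind1 // mul1r; set X := cabs _ ^+ 2.
  have XE : X <= eta.
    apply: lerXn2r; rewrite ?nnegrE ?cabs_ge0 //; first lra.
    exact: square_dist sq (corner_square _ _ _ _).
  have X0 : 0 <= X by exact: sqr_ge0.
  have -> : eta * (2 * G * (eta / (X + eta) ^+ 2)) = G * (2 * eta ^+ 2 / (X + eta) ^+ 2).
    by field; rewrite gt_eqF //; lra.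
  apply: ler_wpM2l => //; rewrite ler_pdivlMr; last by rewrite exprn_gt0 //; lra.
  have : (X + eta) ^+ 2 <= (2 * eta) ^+ 2 by apply: lerXn2r; rewrite ?nnegrE; lra.
  lra.
have h1 : 24 * B ^+ 2 * (G / 2) <= 24 * B ^+ 2 * T by apply: ler_wpM2l => //; rewrite mulr_ge0 // sqr_ge0.
have h2 : s * N <= B * B by apply: ler_pM; lra.
have h3 : G * (s * N) <= G * (B * B) by apply: ler_wpM2l.
have h4 : 0 <= G * s ^+ 2 by rewrite mulr_ge0 // sqr_ge0.
lra.
Qed.

Lemma log_term_cont b K o k i j w : w != b -> cont_at (log_term b K o k i j) w.
Proof.
move=> wb; have m0 := mesh_gt0 R k; have sc c : cont_at (fun u : C => cabs (u - c) ^+ 2) w.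
  by apply/cont_realX/cont_cabs; exact: contB (cont_id _) (cont_cst _ _).
apply: cont_realM; first exact: cont_cst.
apply: cont_realD; first exact: cont_cst.
apply: cont_realD.
  apply: (cont_comp (sc b)); constructor; apply: continuous_ln.
  by rewrite exprn_gt0 // cabs_gt0 subr_eq0.
apply: cont_realM; first exact: cont_cst.
apply: (@cont_comp _ _ _ (fun u => cabs (u - corner o k i j) ^+ 2 + (2 * mesh R k) ^+ 2) (@ln R)).
  exact: cont_realD (sc _) (cont_cst _ _).
constructor; apply: continuous_ln; apply: ltr_wpDl; first exact: sqr_ge0.
by rewrite exprn_gt0 //; lra.
Qed.

Lemma hpot_cont b B K o k n S w : w != b -> cont_at (hpot b B K o k n S) w.
Proof.
move=> wb; apply: cont_realD.
  have c1 : cont_at (fun u : C => B - cabs (u - b) ^+ 2) w.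
    apply: cont_realD; first exact: cont_cst.
    apply: cont_real_opp; apply/cont_realX/cont_cabs; exact: contB (cont_id _) (cont_cst _ _).
  apply: cont_realX; constructor; have [c2] := c1.
  apply: (@continuous_max R C (fun=> 0) (fun u : C => B - cabs (u - b) ^+ 2)); last exact: c2.
  exact: cst_continuous.
apply: cont_realM; first exact: cont_cst.
apply: cont_sum => i _; apply: cont_sum => j _; apply: cont_realM; first exact: cont_cst.
exact: log_term_cont.
Qed.

Section Scale.
Variables (b : C) (d : R) (q : nat).
(* [spot] bounds from above the indicator of the disc of radius [q] around [b]; the grid of side
   [spot_side] covers that disc, and [spot_const] makes the logarithmic terms nonnegative at
   distance at least [d] from [b]. *)
Definition spot_radius : R := q.+1%:R.
Definition spot_level : R := q%:R ^+ 2 + 1.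
Definition spot_origin : C := b - (rc spot_radius + I * rc spot_radius).
Definition spot_side : nat := q.+1.*2.
Definition spot_const : R := 2 + (8 * spot_radius ^+ 2 + 4) / d ^+ 2.
Definition spot k S := hpot b spot_level spot_const spot_origin k spot_side S.

Lemma spot_side_eq : spot_side%:R = 2 * spot_radius. Proof. by rewrite /spot_side /spot_radius -muln2 natrM mulrC. Qed.

Lemma spot_level_le : spot_level <= spot_radius ^+ 2 /\ 1 <= spot_radius.
Proof.
rewrite /spot_level /spot_radius -natr1; have : (0 : R) <= q%:R by [].
by move: (q%:R : R) => x x0; split; [nra|lra].
Qed.

Lemma corner_dist k i j : (i < spot_side * 2 ^ k)%N -> (j < spot_side * 2 ^ k)%N -> cabs (corner spot_origin k i j - b) <= 2 * spot_radius.
Proof.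
have H l : (l < spot_side * 2 ^ k)%N -> `|l%:R * mesh R k - spot_radius| <= spot_radius.
  move=> lk; have : l%:R * mesh R k <= spot_side%:R.
    rewrite /mesh ler_pdivrMr ?exprn_gt0 // -natrX -natrM ler_nat; exact: ltnW.
  have : 0 <= l%:R * mesh R k by rewrite mulr_ge0 ?ler0n // ltW // mesh_gt0.
  by rewrite spot_side_eq ler_norml; lra.
move=> /H ik /H jk.
have -> : corner spot_origin k i j - b = rc (i%:R * mesh R k - spot_radius) + I * rc (j%:R * mesh R k - spot_radius).
  by rewrite /corner /spot_origin !rcB; ring.
by apply: le_trans (cabsD _ _) _; rewrite cabsM cabs_i mul1r !cabs_rc; lra.
Qed.

Lemma spot_cover k w : cabs (w - b) ^+ 2 < spot_level -> exists i j,
  [/\ (i < spot_side * 2 ^ k)%N, (j < spot_side * 2 ^ k)%N & square spot_origin k i j w].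
Proof.
have [h1 h2] := spot_level_le => wB; have A0 : 0 < spot_radius by lra.
have wA : cabs (w - b) < spot_radius.
  have : cabs (w - b) ^+ 2 < spot_radius ^+ 2 by lra.
  by rewrite ltr_pXn2r // nnegrE ?cabs_ge0 // ltW.
have Re1 := le_lt_trans (Re_le_cabs _) wA; have Im1 := le_lt_trans (Im_le_cabs _) wA.
have eR : complex.Re (w - spot_origin) = complex.Re (w - b) + spot_radius by rewrite /spot_origin !(cReB, cReD, cReM) /=; ring.
have eI : complex.Im (w - spot_origin) = complex.Im (w - b) + spot_radius by rewrite /spot_origin !(cImB, cImD, cImM) /=; ring.
apply: square_mem; rewrite spot_side_eq ?eR ?eI.
  by move: Re1; rewrite ltr_norml; lra.
by move: Im1; rewrite ltr_norml; lra.
Qed.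

Lemma log_term_ge0 k i j w : 0 < d -> d <= cabs (w - b) -> (i < spot_side * 2 ^ k)%N -> (j < spot_side * 2 ^ k)%N ->
  0 <= log_term b spot_const spot_origin k i j w.
Proof.
move=> d0 dw ik jk; have m0 := mesh_gt0 R k; have m1 := mesh_le1 R k.
have [h1 A1] := spot_level_le; have cd := corner_dist ik jk.
have d2 : 0 < d ^+ 2 by rewrite exprn_gt0.
apply: mulr_ge0; first exact: sqr_ge0.
set N := cabs (w - b) ^+ 2; have N0 : d ^+ 2 <= N by apply: lerXn2r; rewrite ?nnegrE ?cabs_ge0 // ltW.
set eta := (2 * mesh R k) ^+ 2.
have eta0 : 0 < eta by rewrite exprn_gt0 //; lra.
have eta4 : eta <= 4 by rewrite /eta; nra.
set Nc := cabs (w - corner spot_origin k i j) ^+ 2.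
have Nc0 : 0 <= Nc by exact: sqr_ge0.
have K0 : 0 < spot_const.
  by rewrite /spot_const; apply: ltr_wpDr => //; apply: divr_ge0; [have := sqr_ge0 spot_radius; lra|exact: ltW].
(* Here Nc <= 2 N + 8 [spot_radius] ^ 2 and eta <= 4, and the constants are absorbed by N >= d ^ 2.
   This is the origin of [spot_const]. *)
have E : Nc + eta <= spot_const * N.
  have NcN : Nc <= 2 * N + 8 * spot_radius ^+ 2.
    have h := cabs_tri b w (corner spot_origin k i j); rewrite (cabsB b) in h.
    have h' : Nc <= (cabs (w - b) + 2 * spot_radius) ^+ 2.
      by apply: lerXn2r; rewrite ?nnegrE ?cabs_ge0 ?addr_ge0 ?cabs_ge0 //; lra.
    apply: le_trans h' _; rewrite /N; have := sqr_ge0 (cabs (w - b) - 2 * spot_radius); nra.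
  rewrite /spot_const mulrDl.
  have : (8 * spot_radius ^+ 2 + 4) <= (8 * spot_radius ^+ 2 + 4) / d ^+ 2 * N.
    rewrite mulrAC ler_pdivlMr //; apply: ler_wpM2l => //; have := sqr_ge0 spot_radius; lra.
  lra.
have : ln (Nc + eta) <= ln spot_const + ln N.
  rewrite -lnM ?posrE //; last by lra.
  by rewrite ler_ln ?posrE ?mulr_gt0 //; lra.
lra.
Qed.

Lemma spot_ge0 k S w : 0 < d -> d <= cabs (w - b) -> 0 <= spot k S w /\
  (cabs (w - b) ^+ 2 <= q%:R ^+ 2 -> 1 <= spot k S w).
Proof.
move=> d0 dw.
have T0 : 0 <= 24 * spot_level ^+ 2 * \sum_(0 <= i < spot_side * 2 ^ k) \sum_(0 <= j < spot_side * 2 ^ k)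
    ind R (square spot_origin k i j `<=` S) * log_term b spot_const spot_origin k i j w.
  apply: mulr_ge0; first by rewrite mulr_ge0 // sqr_ge0.
  rewrite big_nat; apply: sumr_ge0 => i /andP[_ ik]; rewrite big_nat; apply: sumr_ge0 => j /andP[_ jk].
  by apply: mulr_ge0; [exact: ind_ge0|exact: log_term_ge0].
rewrite /spot /hpot; split.
  by apply: addr_ge0 => //; rewrite /cube_pos exprn_ge0 // le_max lexx.
move=> wq; apply: (@le_trans _ _ (cube_pos (spot_level - cabs (w - b) ^+ 2))); last by rewrite lerDl.
by rewrite /cube_pos; apply: exprn_ege1; rewrite le_max /spot_level; apply/orP; right; lra.
Qed.

(** So far from [b] the cut-off vanishes and |w - b| is at most twice the distance to any corner.
    Each term is then at most its mass times ln (4 [spot_const]), and the masses add up to four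
    times the inner area. *)
Lemma spot_small k S w : 0 < d -> 4 * spot_radius <= cabs (w - b) ->
  spot k S w <= 24 * spot_level ^+ 2 * 4 * ln (4 * spot_const) * area spot_origin spot_side S k.
Proof.
move=> d0 wA; have [BA A1] := spot_level_le; have m0 := mesh_gt0 R k.
have A2 : 1 <= spot_radius ^+ 2 by exact: exprn_ege1.
rewrite /spot /hpot.
have wA2 : (4 * spot_radius) ^+ 2 <= cabs (w - b) ^+ 2 by apply: lerXn2r; rewrite ?nnegrE ?cabs_ge0 //; lra.
have -> : cube_pos (spot_level - cabs (w - b) ^+ 2) = 0.
  by rewrite /cube_pos max_l ?expr0n //; lra.
rewrite add0r; have -> : 24 * spot_level ^+ 2 * 4 * ln (4 * spot_const) * area spot_origin spot_side S k =
   24 * spot_level ^+ 2 * (4 * ln (4 * spot_const) * area spot_origin spot_side S k) by ring.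
apply: ler_wpM2l; first by rewrite mulr_ge0 // sqr_ge0.
rewrite /area /count.
have -> : 4 * ln (4 * spot_const) * ((\sum_(0 <= i < spot_side * 2 ^ k) \sum_(0 <= j < spot_side * 2 ^ k) ind R (square spot_origin k i j `<=` S)) * mesh R k ^+ 2) =
  \sum_(0 <= i < spot_side * 2 ^ k) \sum_(0 <= j < spot_side * 2 ^ k) ind R (square spot_origin k i j `<=` S) * ((2 * mesh R k) ^+ 2 * ln (4 * spot_const)).
  rewrite mulr_suml mulr_sumr; apply: eq_bigr => i _; rewrite mulr_suml mulr_sumr; apply: eq_bigr => j _; ring.
rewrite big_nat [X in _ <= X]big_nat; apply: ler_sum => i /andP[_ ik].
rewrite big_nat [X in _ <= X]big_nat; apply: ler_sum => j /andP[_ jk].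
apply: ler_wpM2l; first exact: ind_ge0.
rewrite /log_term; apply: ler_wpM2l; first exact: sqr_ge0.
have cd := corner_dist ik jk.
set N := cabs (w - b) ^+ 2; set Nc := cabs (w - corner spot_origin k i j) ^+ 2; set eta := (2 * mesh R k) ^+ 2.
have eta0 : 0 < eta by rewrite exprn_gt0 //; lra.
have Nc0 : 0 <= Nc by exact: sqr_ge0.
have N0 : 0 < N by rewrite exprn_gt0 //; lra.
have K0 : 0 < spot_const.
  by rewrite /spot_const; apply: ltr_wpDr => //; apply: divr_ge0; [lra|exact: sqr_ge0].
have E : N <= 4 * (Nc + eta).
  have h := cabs_tri (corner spot_origin k i j) w b.
  have : N <= (2 * cabs (w - corner spot_origin k i j)) ^+ 2.
    by apply: lerXn2r; rewrite ?nnegrE ?mulr_ge0 ?cabs_ge0 //; lra.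
  by rewrite exprMn -/Nc; lra.
have e1 : ln N <= ln 4 + ln (Nc + eta).
  rewrite -lnM ?posrE //; last by lra.
  by rewrite ler_ln ?posrE //; lra.
rewrite lnM ?posrE //; lra.
Qed.

End Scale.
End Potential.

(** * No bounded domain with disjoint images and non-escaping frontier *)

Section Star.
Variable R : realType.
Local Notation C := R[i].
Implicit Types (z w u a b c : C) (e t r s d M : R) (X S K : set C) (k n m q : nat) (f : C -> C).

Definition esc f : set C := [set z | forall M, exists N : nat, forall n, (N <= n)%N -> M < cabs (iter n f z)].

(** The value of f^n at [f a] is isolated near [f a], by induction, and [f] covers a neighbourhood
    of [f a]. *)
Lemma iter_nonconstant f n a : ent f -> ~ polynomial_fun f -> exists w, iter n f w != iter n f a.
Proof.
move=> ef npf; elim: n a => [|n IH] a.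
  by exists (a + 1) => /=; rewrite -subr_eq0 addrC addKr oner_eq0.
have [w0 hw0] := IH (f a).
have eg := ent_shift (iter n f (f a)) (ent_iter n ef).
have [|e e0 He] := @isolated_zero R _ (f a) eg.
  by exists w0; rewrite subr_eq0.
have [d d0 Hd] := open_mapping ef (ent_nonconstant npf a) (ltr01 : 0 < 1).
pose x := Num.min d e / 2; have m0 : 0 < Num.min d e by rewrite lt_min d0.
have x0 : 0 < x by rewrite /x; lra.
have : x < Num.min d e by rewrite /x; lra.
rewrite lt_min => /andP[xd xe].
have [|u _ fu] := Hd (f a + rc x); first by rewrite addrC addKr cabs_rc gtr0_norm.
exists u; rewrite !iterSr fu.
have := He (f a + rc x); rewrite subr_eq0; apply.
  by rewrite -subr_eq0 addrC addKr rc_eq0 gt_eqF.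
by rewrite addrC addKr cabs_rc gtr0_norm.
Qed.

Lemma open_iter_image f n X : ent f -> ~ polynomial_fun f -> open X -> open (iter n f @` X).
Proof.
move=> ef npf /openCP oX; apply/openCP => w [z Xz <-].
have [r r0 Hr] := oX z Xz.
have [d d0 Hd] := open_mapping (ent_iter n ef) (iter_nonconstant n z ef npf) r0.
by exists d => // u /Hd[y yr <-]; exists y => //; exact: Hr.
Qed.

Lemma le_sum_mem (s : seq nat) (y : nat -> R) i : (forall j, j \in s -> 0 <= y j) -> i \in s ->
  y i <= \sum_(j <- s) y j.
Proof.
elim: s => // j s IH y0; rewrite inE big_cons => /orP[/eqP->|h].
  rewrite lerDl big_seq; apply: sumr_ge0 => l ls; apply: y0; by rewrite inE ls orbT.
apply: le_trans (IH _ h) _; first by move=> l ls; apply: y0; rewrite inE ls orbT.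
by rewrite lerDr; apply: y0; rewrite inE eqxx.
Qed.

Lemma uniform_separation (S T : nat -> set C) n : (forall i, compact (S i)) -> (forall i, open (T i)) ->
  (forall i, S i `<=` T i) -> exists2 e, 0 < e & forall i x y, (i < n)%N -> S i x -> cabs (x - y) < e -> T i y.
Proof.
move=> cS oT ST; elim: n => [|n [e e0 He]]; first by exists 1.
have [||d d0 Hd] := @compact_separation R (S n) (~` T n) (cS n).
- exact: open_closedC.
- by apply/seteqP; split=> // w [/ST].
exists (Num.min e d); first by rewrite lt_min e0.
move=> i x y; rewrite ltnS leq_eqVlt lt_min => /orP[/eqP->|lt_in] Sx /andP[xe xd]; last exact: He Sx xe.
by apply: contrapT => /(Hd x y Sx); lra.
Qed.

Lemma half_sum m : \sum_(0 <= q < m) (2 : R) ^- q.+2 < 1.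
Proof.
suff : \sum_(0 <= q < m) (2 : R) ^- q.+2 = 2^-1 - 2 ^- m.+1.
  by move=> ->; have : (0 : R) < 2 ^- m.+1; [rewrite invr_gt0 exprn_gt0|lra].
elim: m => [|m IH]; first by rewrite big_geq // expr1 subrr.
rewrite big_nat_recr //= IH; set x := 2 ^- m.+1; have -> : (2 : R) ^- m.+2 = x / 2 by rewrite exprS invfM mulrC.
lra.
Qed.

Lemma no_disjoint_escaping_domain f X z0 : ent f -> ~ polynomial_fun f -> open X -> (exists M, forall z, X z -> cabs z <= M) ->
  X z0 -> esc f z0 -> (forall z, closure X z -> ~ X z -> ~ esc f z) ->
  (forall n m w, (iter n f @` X) w -> (iter m f @` X) w -> n = m) -> False.
Proof.
move=> ef npf oX [M0 XM] Xz0 ez0 frX disj; pose b := z0.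
have icont n z : cont_at (iter n f) z := iter_cont ef n z.
have [d d0 dX] : exists2 d, 0 < d & disc b d `<=` X by exact: (openCP _).1 oX _ Xz0.
have clX : closed (closure X) by exact: closed_closure.
have cM z : closure X z -> cabs z <= M0.
  move=> /closureCP Hz; apply/ler_addgt0Pl => e e0; have [w /= Xw wz] := Hz e e0.
  by have := XM w Xw; have := cabs_subr z w; rewrite (cabsB z); lra.
have cX : compact (closure X).
  by apply: (@closed_bounded_compact R _ 0 M0 clX) => z /cM; rewrite /cdisc /= subr0.
(* X contains a disc around [b] and is disjoint from its later images, so these images stay away
   from the singularity of the potentials at [b]. *)
have far z n : closure X z -> (0 < n)%N -> d <= cabs (iter n f z - b).
  move=> Xz n0; have := @closed_norm_ge _ (fun z => iter n f z - b) d
    (fun z => contB (icont n z) (cont_cst b z)); apply; apply: closureS Xz => w Xw /=.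
  rewrite leNgt; apply/negP => h; have := disj n 0%N (iter n f w) => H.
  have : n = 0%N by apply: H; [exists w|exists (iter n f w) => //; exact: dX].
  by move=> nE; rewrite nE in n0.
pose Cq q : R := 24 * spot_level R q ^+ 2 * 4 * ln (4 * spot_const d q).
have Cq0 q : 0 <= Cq q.
  apply: mulr_ge0; first by rewrite mulr_ge0 // mulr_ge0 // sqr_ge0.
  apply: ln_ge0; have : 0 <= (8 * spot_radius R q ^+ 2 + 4) / d ^+ 2.
    by apply: divr_ge0; [have := sqr_ge0 (spot_radius R q); lra|exact: sqr_ge0].
  by rewrite /spot_const; lra.
(* The conditions on [Nq] serve in turn [far], the hypothesis of [spot_small] at [z0], and a total
   mass so small that scale [q] contributes at most 2 ^- (q+2) at [z0], for every mesh. *)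
pose ar q n k := area (spot_origin b q) (spot_side q) (iter n f @` X) k.
have /choice[Nq HN] : forall q, exists Nq : nat, [/\ (0 < Nq)%N, forall n, (Nq <= n)%N -> 4 * spot_radius R q <= cabs (iter n f z0 - b) &
    forall N k, Cq q * \sum_(Nq <= n < N) ar q n k <= 2 ^- q.+2].
  move=> q.
  have e0 : 0 < 2 ^- q.+2 / (Cq q + 1).
    by rewrite divr_gt0 ?invr_gt0 ?exprn_gt0 //; have := Cq0 q; lra.
  have [|||N1 HN1] := @monotone_tail R (ar q) ((spot_side q)%:R ^+ 2) _ _ _ _ e0.
  - exact: (fun n k => area_ge0 (spot_origin b q) (spot_side q) (iter n f @` X) k).
  - exact: (fun n k => area_mono (spot_origin b q) (spot_side q) (iter n f @` X) k).
  - exact: (fun N k => area_sum (spot_origin b q) (spot_side q) k N disj).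
  have [N2 HN2] := ez0 (4 * spot_radius R q + cabs b).
  exists (maxn N1 N2).+1; split=> //.
    move=> n /ltnW; rewrite geq_max => /andP[_ /HN2].
    by have := cabs_subr (iter n f z0) b; lra.
  move=> N k; have h : \sum_((maxn N1 N2).+1 <= n < N) ar q n k <= 2 ^- q.+2 / (Cq q + 1).
    apply: le_trans (HN1 N k); have [le|lt] := leqP N (maxn N1 N2).+1.
      by rewrite big_geq //; apply: sumr_ge0 => n _; exact: area_ge0.
    rewrite [X in _ <= X](@big_cat_nat _ _ _ (maxn N1 N2).+1) //=; [|by rewrite leqW // leq_maxl|exact: ltnW].
    by rewrite lerDr; apply: sumr_ge0 => n _; exact: area_ge0.
  apply: le_trans (ler_wpM2l (Cq0 q) h) _; rewrite mulrCA ler_piMr ?invr_ge0 ?exprn_ge0 //.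
  by rewrite ler_pdivrMr; have := Cq0 q; lra.
(* These open sets increase with [m]. A frontier point does not escape, so for some [q] its orbit
   enters the disc of radius [q] at arbitrarily late times; compactness then gives one [m] for the
   whole frontier. *)
pose W m := [set z | exists q n, [/\ (q <= m)%N, (Nq q <= n <= m)%N & cabs (iter n f z - b) < q%:R]].
have oW m : open (W m).
  apply/openCP => z [q [n [qm nm zq]]].
  have e0 : 0 < q%:R - cabs (iter n f z - b) by rewrite subr_gt0.
  have /continuous_CP /(_ _ e0)[r r0 Hr] := icont n z.
  exists r => // w /Hr h; exists q, n; split=> //.
  by have := cabs_tri (iter n f z) (iter n f w) b; lra.
have [m Hm] : exists m, forall z, closure X z -> ~ X z -> W m z.
  apply: contrapT => nom.
  have [z Hz] : exists z, forall m, (closure X `&` ~` X `&` ~` W m) z.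
    have cl m : closed (closure X `&` ~` X `&` ~` W m).
      by apply: closedI; [apply: closedI => //|]; exact: open_closedC.
    apply: nested_compact => [|m|m|m].
    - by apply: (subclosed_compact (cl 0%N) cX) => z [[]].
    - exact: cl.
    - move=> z [Xz nW]; split=> // -[q [n [qm nm zq]]]; apply: nW; exists q, n; split=> //; lia.
    - apply: contrapT => em; apply: nom; exists m => z Xz nXz; apply: contrapT => nW.
      by apply: em; exists z.
  have [[Xz nXz] _] := Hz 0%N; apply: (frX z Xz nXz) => M; apply: contrapT => H.
  pose q := Num.bound `|M + cabs b|.
  have [n nN nM] : exists2 n, (Nq q <= n)%N & cabs (iter n f z) <= M.
    apply: contrapT => H'; apply: H; exists (Nq q) => n nn; rewrite ltNge; apply/negP => h.
    by apply: H'; exists n.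
  have [_ nW] := Hz (maxn q n); apply: nW; exists q, n; split; [exact: leq_maxl|by rewrite nN leq_maxr|].
  apply: le_lt_trans (cabsBD _ _) _; apply: (@le_lt_trans _ _ (M + cabs b)); first by lra.
  apply: le_lt_trans (ler_norm _) _; by apply: archi_boundP.
pose Y := closure X `&` ~` W m.
have YX : Y `<=` X by move=> z [Xz nW]; apply: contrapT => /(Hm z Xz).
have cY : compact Y.
  apply: (subclosed_compact _ cX); last by move=> z [].
  by apply: closedI => //; exact: open_closedC.
(* For the finitely many times involved, a grid square of diameter below [e] that meets f^n Y lies
   inside f^n X. Outside [W m] the squares counted in f^n X therefore cover what the cut-offs
   need. *)
have [e e0 He] : exists2 e, 0 < e & forall n x y, (n < m.+1)%N -> (iter n f @` Y) x -> cabs (x - y) < e ->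
    (iter n f @` X) y.
  apply: uniform_separation => n; first exact: compact_image.
    exact: open_iter_image.
  by move=> w [z Yz <-]; exists z => //; exact: YX.
have [k kE] := @mesh_small R (e / 2) (divr_gt0 e0 (ltr0Sn _ _)).
pose v z := \sum_(q <- index_iota 0 m.+1) \sum_(n <- index_iota (Nq q) m.+1) spot b d q k (iter n f @` X) (iter n f z).
have N1 q : (0 < Nq q)%N by have [] := HN q.
have ge0 z q n : closure X z -> n \in index_iota (Nq q) m.+1 -> 0 <= spot b d q k (iter n f @` X) (iter n f z).
  move=> Xz; rewrite mem_index_iota => /andP[n0 _].
  by have [] := spot_ge0 q k (iter n f @` X) d0 (far z n Xz (leq_trans (N1 q) n0)).
have v1 : 1 <= v z0.
  have KX : closure X z0 by exact: subset_closure.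
  apply: (@lap_min_principle R (closure X) v 1 cX _ _ z0 KX).
    move=> z Xz; apply: cont_sum => q _; apply: cont_sum => n; rewrite mem_index_iota => /andP[n0 _].
    apply: (cont_comp (icont n z)); apply: hpot_cont.
    have := far z n Xz (leq_trans (N1 q) n0); apply: contraTneq => ->.
    by rewrite subrr cabs0 -ltNge.
  move=> z Xz; have [[q [n [qm /andP[nN nm] zq]]]|nW] := pselect (W m z).
    left; have nI : n \in index_iota (Nq q) m.+1 by rewrite mem_index_iota nN ltnS.
    apply: (@le_trans _ _ (\sum_(n <- index_iota (Nq q) m.+1) spot b d q k (iter n f @` X) (iter n f z))).
      apply: (@le_trans _ _ (spot b d q k (iter n f @` X) (iter n f z))).
        have [_] := spot_ge0 q k (iter n f @` X) d0 (far z n Xz (leq_trans (N1 q) nN)); apply.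
        by apply: lerXn2r; rewrite ?nnegrE ?cabs_ge0 // ltW.
      by apply: (le_sum_mem (y := fun n => spot b d q k (iter n f @` X) (iter n f z))) => // j; exact: ge0.
    apply: (le_sum_mem (y := fun q => \sum_(n <- index_iota (Nq q) m.+1) spot b d q k (iter n f @` X) (iter n f z))).
      by move=> j _; rewrite big_seq; apply: sumr_ge0 => l; exact: ge0.
    by rewrite mem_index_iota.
  right; have Yz : Y z by [].
  have [r r0 Hr] := (openCP _).1 oX z (YX z Yz).
  exists r => //; split; first by move=> w /Hr; exact: subset_closure.
  apply: superharmonic_sum => q _; apply: superharmonic_sum => n; rewrite mem_index_iota => /andP[n0 n1].
  apply: hpot_superharmonic; first exact: ent_iter.
    have := far z n Xz (leq_trans (N1 q) n0); apply: contraTneq => ->.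
    by rewrite subrr cabs0 -ltNge.
  move=> /(spot_cover k)[i [j [ik jk sq]]]; exists i, j; split=> // u su.
  have Yn : (iter n f @` Y) (iter n f z) by exists z.
  apply: (He n (iter n f z) u n1 Yn).
  by apply: le_lt_trans (square_dist sq su) _; lra.
have : v z0 < 1; last by lra.
apply: le_lt_trans (half_sum m.+1); apply: ler_sum => q _; have [_ h1 h2] := HN q.
apply: le_trans (h2 m.+1 k); rewrite mulr_sumr big_seq [X in _ <= X]big_seq; apply: ler_sum => n.
rewrite mem_index_iota => /andP[n0 n1]; apply: spot_small => //; exact: h1.
Qed.

End Star.

(** * Components of the escaping set *)

Section Main.
Variable R : realType.
Local Notation C := R[i].
Implicit Types (z w u a b c p : C) (e t r s d M L : R) (X S K : set C) (i k l n m q : nat) (f : C -> C).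

Lemma connected_between S K : connected S -> S `<=` K -> K `<=` closure S -> connected K.
Proof.
move=> cS SK KS; apply/connectedP => E [Ene KE sE].
have SE : S `<=` E false `|` E true by rewrite -KE.
have [s1 s2] := sE.
have [h|h] := connected_subset sE SE cS.
  have [x Ex] := Ene true; have : (closure (E false) `&` E true) x; last by rewrite s1.
  by split=> //; apply: (closureS h); apply: KS; rewrite KE; right.
have [x Ex] := Ene false; have : (E false `&` closure (E true)) x; last by rewrite s2.
by split=> //; apply: (closureS h); apply: KS; rewrite KE; left.
Qed.

(** Components are relatively closed. Hence a frontier point of a component of the escaping set that
    lies outside the component does not escape. *)
Lemma component_closure S z w : S w -> closure (connected_component S z) w -> connected_component S z w.
Proof.
move=> Sw cw; have [Sz|nSz] := pselect (S z); last first.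
  by rewrite connected_component_out // in cw; rewrite (@closure0 C) in cw.
have h : connected (connected_component S z `|` [set w]).
  apply: (connected_between (@component_connected _ S z)); first by move=> u; left.
  by move=> u [|->//]; exact: subset_closure.
apply: (connected_component_max _ _ h); last by right.
  by left; exact: connected_component_refl.
by move=> u [|->//]; exact: connected_component_sub.
Qed.

(* The relation "[g n x] stays within bounded ratio of [g n y]" has open classes by
   [landau], hence is trivial on connected sets. *)
Lemma landau_chain (g : nat -> C -> C) p S x y : (forall n, ent (g n)) -> connected S ->
  (forall c, S c -> exists2 r, 0 < r & forall n, ~ has_circle (g n @` disc c r) p) -> S x -> S y ->
  exists2 L, 0 <= L & forall n, cabs (g n y - p) <= L * cabs (g n x - p).
Proof.
move=> eg cS HS Sx Sy; have [L0 L01 HL] := @landau R.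
pose T : set C := [set y | S y /\ exists2 L, 0 <= L & forall n, cabs (g n y - p) <= L * cabs (g n x - p)].
suff : T = S by move=> TS; have [_] : T y by rewrite TS.
have Tx : T x by split=> //; exists 1 => // n; rewrite mul1r.
have step c w L : 0 <= L -> (forall n, cabs (g n c - p) <= L * cabs (g n x - p)) ->
    (forall n, cabs (g n w - p) <= L0 * cabs (g n c - p)) ->
    exists2 L, 0 <= L & forall n, cabs (g n w - p) <= L * cabs (g n x - p).
  move=> l0 h1 h2; exists (L0 * L); first by rewrite mulr_ge0 //; lra.
  move=> n; apply: le_trans (h2 n) _; rewrite -mulrA; apply: ler_wpM2l => //; lra.
apply: cS; first by exists x.
- pose O := \bigcup_(cr in [set cr : C * R | T cr.1 /\ 0 < cr.2 /\ forall n, ~ has_circle (g n @` disc cr.1 cr.2) p])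
    disc cr.1 (cr.2 / 2).
  exists O; first by apply: bigcup_open => cr _; exact: open_disc.
  apply/seteqP; split=> w.
    move=> [Sw Lw]; split=> //; have [r r0 Hr] := HS w Sw; exists (w, r); first by [].
    by rewrite /disc /= subrr cabs0; lra.
  move=> [Sw [[c r] [[Sc [L l0 Hc]] [r0 nc]] wc]]; split=> //.
  apply: (step c w L l0 Hc) => n.
  by have [] := HL (g n) p c r (eg n) r0 (nc n) w (ltW wc).
- exists (closure T); first exact: closed_closure.
  apply/seteqP; split=> w; first by move=> Tw; split; [case: Tw|exact: subset_closure].
  move=> [Sw /closureCP Hw]; split=> //; have [r r0 nc] := HS w Sw.
  have [c [Sc [L l0 Hc]] cw] := Hw (r / 2) (divr_gt0 r0 (ltr0Sn _ _)).
  apply: (step c w L l0 Hc) => n.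
  by have [] := HL (g n) p w r (eg n) r0 (nc n) c (ltW cw).
Qed.

Lemma esc_iter f n z : esc f (iter n f z) <-> esc f z.
Proof.
split=> H M; have [N HN] := H M.
  exists (N + n)%N => m mN; have -> : m = (m - n + n)%N by lia.
  by rewrite iterD; apply: HN; lia.
by exists N => m mN; rewrite -iterD; apply: HN; lia.
Qed.

Lemma connected_image_iter f n S : ent f -> connected S -> connected (iter n f @` S).
Proof.
move=> ef cS; apply: connected_continuous_connected => //; apply: continuous_subspaceT => z.
by have [] := iter_cont ef n z.
Qed.

Lemma comp_image f n z : ent f -> iter n f @` connected_component (esc f) z `<=`
  connected_component (esc f) (iter n f z).
Proof.
move=> ef; have [Ez|nEz] := pselect (esc f z); last first.
  by rewrite connected_component_out // image_set0.
apply: connected_component_max.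
- by exists z => //; exact: connected_component_refl.
- by move=> w [u /(@connected_component_sub _ _ _) Eu <-]; apply/esc_iter.
- exact: connected_image_iter (@component_connected _ _ _).
Qed.

(* The image is open, and closed relative to the escaping set. *)
Lemma bounded_comp_image f n z : ent f -> ~ polynomial_fun f ->
  open (connected_component (esc f) z) -> ~ unb (connected_component (esc f) z) ->
  iter n f @` connected_component (esc f) z = connected_component (esc f) (iter n f z).
Proof.
move=> ef npf; set Z := connected_component _ _ => oZ bZ; set Y := connected_component _ _.
have [Ez|nEz] := pselect (esc f z); last first.
  rewrite /Y /Z !connected_component_out ?image_set0 //; by move/esc_iter.
have ZY : iter n f @` Z `<=` Y by exact: comp_image.
have [M HM] : exists M, forall w, Z w -> cabs w <= M.
  by apply/bounded_setCP; apply: contrapT => /unbP.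
have cZ : compact (closure Z).
  apply: (@closed_bounded_compact R _ 0 M); first exact: closed_closure.
  have h : Z `<=` cdisc 0 M by move=> w /HM; rewrite /cdisc /= subr0.
  by move=> w /(closureS h); exact: closed_cdisc.
apply: (@component_connected _ (esc f) (iter n f z)).
- by exists (iter n f z); exists z => //; exact: connected_component_refl.
- exists (iter n f @` Z); first exact: open_iter_image.
  by apply/seteqP; split=> w; [move=> h; split=> //; exact: ZY|case].
- exists (iter n f @` closure Z).
    by apply: compact_closed (@norm_hausdorff _ _) _; apply: compact_image => //; exact: iter_cont.
  apply/seteqP; split=> w.
    move=> h; split; first exact: ZY. 
    by case: h => u Zu <-; exists u => //; exact: subset_closure.
  move=> [/(@connected_component_sub _ _ _) Ew [u Zu uw]]; exists u => //.
  by apply: component_closure => //; apply/(esc_iter f n); rewrite uw.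
Qed.

Lemma bounded_iter_image f n S : ent f -> ~ unb S -> exists M, forall w, (iter n f @` S) w -> cabs w <= M.
Proof.
move=> ef bS; have [M HM] : exists M, forall w, S w -> cabs w <= M.
  by apply/bounded_setCP; apply: contrapT => /unbP.
have cD : compact (iter n f @` cdisc 0 M) by apply: compact_image (iter_cont ef n) (@compact_cdisc R 0 M).
have [M' HM'] := compact_cabs_bounded cD.
by exists M' => w [u /HM uM <-]; apply: HM'; exists u => //; rewrite /cdisc /= subr0.
Qed.

(** * Consequences of having finitely many unbounded components *)

Section Finite.
Variables (f : C -> C) (r0 : R).
Local Notation E := (esc f).
Local Notation comp := (connected_component (esc f)).
Hypotheses (ef : ent f) (npf : ~ polynomial_fun f).
Hypothesis finU : finite_set (unbounded_components (esc f)).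
Hypotheses (r1 : 1 <= r0) (fr : forall s, r0 <= s -> s <= maxmod f s).

Lemma unb_comp z : E z -> unb (comp z) -> unbounded_components E (comp z).
Proof. by move=> Ez /unbP uz; exists z. Qed.

Lemma fast_esc l : fast_set f r0 l `<=` E.
Proof.
move=> z Hz M; have [N HN] := sseq_unbounded r1 fr (M + 1).
exists (N + l)%N => n nN; have := Hz (n - l)%N; rewrite subnK; last by lia.
by have := sseq_mono r1 fr (_ : (N <= n - l)%N); move=> /(_ ltac:(lia)); lra.
Qed.

Lemma fast_unb l z : fast_set f r0 l z -> unb (comp z).
Proof.
move=> Fz; apply: unb_sub (fast_component r1 fr ef Fz).
apply: connected_component_max; first exact: connected_component_refl.
  by move=> w /(@connected_component_sub _ _ _); exact: fast_esc.
exact: component_connected.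
Qed.

Lemma fast_pull l m z : fast_set f r0 l (iter m f z) -> fast_set f r0 (l + m) z.
Proof. by move=> H n; have := H n; rewrite -iterD addnA. Qed.

Lemma fast_iter i z : fast_set f r0 0 z -> fast_set f r0 0 (iter i f z).
Proof.
move=> H n; rewrite addn0 -iterD; apply: le_trans (_ : sseq f r0 (n + i) <= _).
  by apply: sseq_mono => //; exact: leq_addr.
by have := H (n + i)%N; rewrite addn0.
Qed.

Lemma recurrent_component a : fast_set f r0 0 a -> exists a' q, [/\ fast_set f r0 0 a', (0 < q)%N &
  comp a' = comp (iter q f a')].
Proof.
move=> Fa; apply: contrapT => H; apply: (infinite_nat).
have inj i j : (i < j)%N -> comp (iter i f a) <> comp (iter j f a).
  move=> ij eqc; apply: H; exists (iter i f a), (j - i)%N; split.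
  - exact: fast_iter.
  - by rewrite subn_gt0.
  - by rewrite -iterD subnK // ltnW.
have -> : [set: nat] = (fun i => comp (iter i f a)) @^-1` unbounded_components E.
  apply/seteqP; split=> // i _ /=; have Fi := fast_iter i Fa.
  by apply: unb_comp; [exact: fast_esc Fi|exact: fast_unb Fi].
apply: finite_preimage finU => i j _ _ /= eqc.
by have [/inj//|/inj h|//] := ltngtP i j; case: h.
Qed.

Section Component.
Variables (a : C) (q : nat).
Hypotheses (Fa : fast_set f r0 0 a) (q0 : (0 < q)%N) (aq : comp a = comp (iter q f a)).

Lemma surrounding_point p : exists2 c, comp a c & forall r, 0 < r ->
  exists n, has_circle (iter (q * n) f @` disc c r) p.
Proof.
apply: contrapT => H.
have HS c : comp a c -> exists2 r, 0 < r & forall n, ~ has_circle (iter (q * n) f @` disc c r) p.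
  move=> Cc; apply: contrapT => nr; apply: H; exists c => // r rp.
  apply: contrapT => nn; apply: nr; exists r => // n hn; apply: nn; by exists n.
have Ea : E a by exact: fast_esc Fa.
have Ca : comp a a by exact: connected_component_refl.
have Cb : comp a (iter q f a) by rewrite aq; apply: connected_component_refl; apply/esc_iter.
have [L L0 HL] := landau_chain (fun n => ent_iter (q * n) ef) (@component_connected _ E a) HS Ca Cb.
(* As f^(qn) (f^q a) is f^(q(n+1)) a, bounded ratios let the orbit of [a] under f^q grow at most
   geometrically, against [sseq_super]. *)
have growL n : cabs (iter (q * n) f a - p) <= L ^+ n * cabs (a - p).
  elim: n => [|n IH]; first by rewrite muln0 expr0 mul1r.
  rewrite mulnS addnC iterD; apply: le_trans (HL n) _.
  by rewrite exprS -mulrA; apply: ler_wpM2l.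
pose L1 := L + 1; have L11 : 1 <= L1 by rewrite /L1; lra.
have [|m Hm] := @sseq_super R f r0 r1 fr L1 (cabs (a - p) + cabs p) 0.
  by move=> K; have [s0 s01 Hs] := growth K ef npf; exists s0 => // s /Hs[].
have Lm : L ^+ m <= L1 ^+ m by apply: lerXn2r; rewrite ?nnegrE /L1; lra.
have L1m : 1 <= L1 ^+ m by exact: exprn_ege1.
have h1 : L ^+ m * cabs (a - p) <= L1 ^+ m * cabs (a - p) by apply: ler_wpM2r => //; exact: cabs_ge0.
have h2 : cabs p <= cabs p * L1 ^+ m by rewrite ler_peMr // cabs_ge0.
have h3 : sseq f r0 (0 + m) <= cabs (iter (q * m) f a).
  apply: le_trans (_ : sseq f r0 (q * m) <= _); last by have := Fa (q * m)%N; rewrite addn0.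
  by apply: sseq_mono => //; rewrite add0n leq_pmull.
have := growL m; have := cabs_subr (iter (q * m) f a) p; lra.
Qed.

Lemma comp_iter_back n u w : comp u w -> comp (iter n f u) (iter n f w).
Proof. by move=> uw; apply: (@comp_image f n u ef); exists w. Qed.

Lemma comp_iter_q n u : comp a u -> comp a (iter (q * n) f u).
Proof.
elim: n => [|n IH]; first by rewrite muln0.
by move=> /IH; rewrite mulnS iterD => h; rewrite aq; exact: comp_iter_back.
Qed.

(** By finiteness and [component_closure], a neighbourhood of [c] misses the closures of all
    unbounded components other than [comp a]. A circle around a point of [S] is covered from this
    neighbourhood, and [S] crosses it; the preimage of the crossing lies in an unbounded component,
    hence in [comp a], which f^q maps into itself. *)
Lemma invariant_unbounded_sub S : connected S -> unb S -> S `<=` E ->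
  (forall m z, S (iter m f z) -> unb (comp z)) -> S `<=` comp a.
Proof.
move=> cS uS SE HS; have [p Sp _] := uS 0.
have [c Cc Hc] := surrounding_point p.
have Ec : E c by exact: connected_component_sub Cc.
pose BB : set (set C) := [set B | unbounded_components E B /\ B <> comp a].
have [r rp Hr] : exists2 r, 0 < r & forall u, cabs (u - c) < r -> ~ (\bigcup_(B in BB) closure B) u.
  have fB : finite_set BB by apply: sub_finite_set finU => B [].
  have cl : closed (\bigcup_(B in BB) closure B).
    by apply: closed_bigcup => // B _; exact: closed_closure.
  have op : open (~` \bigcup_(B in BB) closure B) by exact: closed_openC.
  have [|r rp Hr] := (openCP _).1 op c; last by exists r.
  move=> -[B [[z Ez [BE _]] nB]].
  rewrite BE => /(component_closure Ec) zc; apply: nB; rewrite BE (same_connected_component zc).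
  by apply/esym/same_connected_component.
have [n [t t0 Ht]] := Hc r rp.
have [y Sy yt] := uS (t + cabs p).
have [|w Sw wt] := @connected_circle R S p p y t cS Sp Sy.
  by rewrite subrr cabs0 t0; have := cabs_subr y p; lra.
have [u uc uw] := Ht w wt.
have Eu : E u by apply/(esc_iter f (q * n)); rewrite uw; exact: SE.
have Cu : comp a u.
  have nBu := Hr u uc; have uu : comp u u by exact: connected_component_refl.
  have [eqC|neC] := pselect (comp u = comp a); first by rewrite -eqC.
  exfalso; apply: nBu; exists (comp u); last exact: subset_closure.
  split=> //; apply: unb_comp => //; by apply: (HS (q * n)%N); rewrite uw.
have Cw : comp a w by rewrite -uw; exact: comp_iter_q.
by rewrite (same_connected_component Cw); exact: connected_component_max Sw SE cS.
Qed.

Lemma fast_in_comp l : fast_set f r0 l `<=` comp a.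
Proof.
move=> z Fz; have Gz : connected_component (fast_set f r0 l) z z by exact: connected_component_refl.
apply: (invariant_unbounded_sub _ _ _ _ Gz).
- exact: component_connected.
- exact: fast_component.
- by move=> w /(@connected_component_sub _ _ _); exact: fast_esc.
- by move=> m w /(@connected_component_sub _ _ _) /fast_pull; exact: fast_unb.
Qed.

(** If small discs at [z] are mapped over circles around [a], these meet the unbounded fast
    component of [a]; fast points then accumulate at [z] and put it in [comp a]. Otherwise [landau]
    makes points near [z] escape along with [z]. *)
Lemma escape_near z : E z -> ~ comp a z -> exists2 r, 0 < r & disc z r `<=` E.
Proof.
move=> Ez nCz.
have [H|H] := pselect (forall r, 0 < r -> exists n, has_circle (iter n f @` disc z r) a).
  exfalso; apply: nCz; apply: component_closure => //; apply/closureCP => e e0.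
  have [n [t t0 Ht]] := H e e0.
  pose G := connected_component (fast_set f r0 0) a.
  have Ga : G a by exact: connected_component_refl.
  have [y Gy yt] := fast_component r1 fr ef Fa (t + cabs a).
  have [|w Gw wt] := @connected_circle R G a a y t (@component_connected _ _ _) Ga Gy.
    by rewrite subrr cabs0 t0; have := cabs_subr y a; lra.
  have [u uz uw] := Ht w wt; exists u => //; apply: (@fast_in_comp (0 + n)).
  by apply: fast_pull; rewrite uw; exact: connected_component_sub Gw.
have [r rp Hr] : exists2 r, 0 < r & forall n, ~ has_circle (iter n f @` disc z r) a.
  apply: contrapT => nr; apply: H => r rp; apply: contrapT => nn; apply: nr; exists r => // n hn.
  by apply: nn; exists n.
have [L L1 HL] := @landau R.
exists (r / 2); first by rewrite divr_gt0.
move=> w wz M; have [N HN] := Ez (L * (M + cabs a) + cabs a); exists N => n /HN h.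
have [_ h1] := HL (iter n f) a z r (ent_iter n ef) rp (Hr n) w (ltW wz).
have h2 := cabs_subr (iter n f z) a; have h3 := cabsBD (iter n f w) a.
have : L * (M + cabs a) < L * cabs (iter n f w - a) by lra.
by rewrite ltr_pM2l; lra.
Qed.

Lemma other_comp_open z : E z -> ~ comp a z -> open (comp z).
Proof.
move=> Ez nCz; apply/openCP => w zw.
have nCw : ~ comp a w by move=> aw; apply: nCz; apply: connected_component_trans aw (connected_component_sym zw).
have [r rp Hr] := escape_near (connected_component_sub zw) nCw; exists r => // u uw.
apply: connected_component_trans zw _.
apply: (connected_component_max _ Hr (@connected_disc R w r)) => //.
by rewrite /disc /= subrr cabs0.
Qed.

(** A preimage in a bounded component would lie outside [comp a], so that component would be open
    and its image, which is bounded, would be all of [comp z]. Preimages therefore lie in unbounded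
    components and [invariant_unbounded_sub] applies. *)
Lemma other_comp_bounded z : E z -> ~ comp a z -> ~ unb (comp z).
Proof.
move=> Ez nCz uz; apply: nCz; apply: (invariant_unbounded_sub _ uz _ _); last exact: connected_component_refl.
- exact: component_connected.
- exact: connected_component_sub.
move=> m u zu; apply: contrapT => nu.
have Eu : E u by apply/(esc_iter f m); exact: connected_component_sub zu.
have nCu : ~ comp a u.
  by move=> au; apply: nu; rewrite -(same_connected_component au); exact: fast_unb Fa.
have := bounded_comp_image m ef npf (other_comp_open Eu nCu) nu.
rewrite -(same_connected_component zu) => imE.
have [M HM] := bounded_iter_image m ef nu.
by have [y] := uz M; rewrite -imE => /HM h1; rewrite ltNge h1.
Qed.

Lemma esc_sub_comp : E `<=` comp a.
Proof.
move=> z Ez; apply: contrapT => nCz.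
have oZ := other_comp_open Ez nCz; have bZ := other_comp_bounded Ez nCz.
have im n := bounded_comp_image n ef npf oZ bZ.
apply: (no_disjoint_escaping_domain (X := comp z) ef npf oZ _ (connected_component_refl Ez) Ez).
- by apply/bounded_setCP; apply: contrapT => /unbP.
- by move=> w cw nw Ew; apply: nw; exact: component_closure.
have disj n k w : (0 < k)%N -> (iter n f @` comp z) w -> (iter (k + n) f @` comp z) w -> False.
  move=> k0; rewrite !im => nw kw.
  have eqY : comp (iter (k + n) f z) = comp (iter n f z).
    by rewrite (same_connected_component nw) (same_connected_component kw).
  (* If two images meet, they are one component, mapped into itself by f^k. It is bounded, so the
     orbit of f^n z returns to a bounded set infinitely often. *)
  have stay l : comp (iter n f z) (iter (l * k) f (iter n f z)).
    elim: l => [|l IH]; first by apply: connected_component_refl; apply/esc_iter.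
    by rewrite mulSn iterD -eqY iterD; exact: comp_iter_back.
  have [M HM] := bounded_iter_image n ef bZ.
  have : E (iter n f z) by apply/esc_iter.
  move=> /(_ M)[N HN]; have := HN (N * k)%N (leq_pmulr _ k0).
  rewrite ltNge => /negP; apply; apply: HM; rewrite im; exact: stay.
move=> n m w nw mw; have [lt|lt|//] := ltngtP n m; exfalso.
  by apply: (disj n (m - n)%N w) => //; rewrite ?subn_gt0 ?subnK // ltnW.
by apply: (disj m (n - m)%N w) => //; rewrite ?subn_gt0 ?subnK // ltnW.
Qed.

End Component.
End Finite.

Lemma escaping_setE f : escaping_set f = esc f.
Proof.
apply/seteqP; split=> z H M.
  have [N _ HN] := H M; exists N => n nN; have := HN n nN.
  by rewrite /= norm_cabs rc_ltr.
have [N HN] := H M; exists N => // n nN; have := HN n nN.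
by rewrite /= norm_cabs rc_ltr.
Qed.

Lemma esc_connected f : entire f -> ~ polynomial_fun f -> finite_set (unbounded_components (esc f)) ->
  connected (esc f).
Proof.
move=> /entire_ent ef npf fin; have [r r1 [fr [a0 Fa0]]] := fast_point ef npf.
have [a [q [Fa q0 aq]]] := recurrent_component ef fin r1 fr Fa0.
have h := esc_sub_comp ef npf fin r1 fr Fa q0 aq.
have -> : esc f = connected_component (esc f) a.
  by apply/seteqP; split=> // z; exact: connected_component_sub.
exact: component_connected.
Qed.

End Main.

Unset Implicit Arguments.

Theorem theorem1p3 (R : realType) (f : R[i] -> R[i]) :
  transcendental_entire f ->
  connected (escaping_set f) \/ infinite_set (unbounded_components (escaping_set f)).
Proof.
move=> [ef npf]; rewrite escaping_setE.
have [fin|inf] := pselect (finite_set (unbounded_components (esc f))); last by right.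
by left; exact: esc_connected.
Qed.
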